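(* Let $X$ be an ep-groupoid based on separable sc-Hilbert spaces and let $\Theta:X\to\mathbb{Q}^+$ be an $n$-dimensional branched ep-subgroupoid whose orbit space $S=|\operatorname{supp}\Theta|$ is compact. Put $\partial S=\{|x|\in S : x\in\operatorname{supp}\Theta\cap\partial X\}$. Then the compact topological spaces $S$ and $\partial S$ possess canonical $\sigma$-algebras $\mathcal{L}(S)$ and $\mathcal{L}(\partial S)$ of subsets, containing the Borel $\sigma$-algebras of $S$ and $\partial S$, respectively. Explicitly: the notions of a subset of $S$ (respectively of $\partial S$) of measure zero, as defined in the context, do not depend on the choices of open sets and local branching structures made in their definition, and $\mathcal{L}(S)$ (respectively $\mathcal{L}(\partial S)$) is the smallest $\sigma$-algebra containing the Borel sets and all subsets of measure zero.
   Context: Sc-calculus. An sc-Banach space is a Banach space $E=E_0$ with a nested sequence of Banach spaces $E_0\supset E_1\supset\cdots$ such that the inclusions $E_{m+1}\to E_m$ are compact and $E_\infty=\bigcap_mE_m$ is dense in every $E_m$ (finite-dimensional spaces carry the constant sequence); it is a separable sc-Hilbert space if all $E_m$ are separable Hilbert spaces. $E^k$ denotes $E_k$ with levels $(E^k)_m=E_{k+m}$. A partial quadrant in an sc-Banach space $W$ is a closed subset $C$ that some linear isomorphism $W\to\mathbb{R}^l\oplus Q$ (an isomorphism on all levels) maps onto $[0,\infty)^l\oplus Q$. For $U$ relatively open in a partial quadrant of $E$ put $U_m=U\cap E_m$, and let $U^k$ be $U_k$ with levels $U_{k+m}$. A map $f:U\to F$ is $\mathrm{sc}^0$ if it maps $U_m$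 continuously to $F_m$ for all $m$; it is $\mathrm{sc}^1$ if moreover for each $x\in U_1$ there is a bounded linear $Df(x):E_0\to F_0$ with $\|f(x+h)-f(x)-Df(x)h\|_0/\|h\|_1\to0$ as $h\to0$ in $E_1$ ($x+h\in U_1$), and $Tf:TU=U^1\oplus E\to TF=F^1\oplus F$, $Tf(x,h)=(f(x),Df(x)h)$, is $\mathrm{sc}^0$; it is $\mathrm{sc}^{k+1}$ if $Tf$ is $\mathrm{sc}^k$, and sc-smooth if $\mathrm{sc}^k$ for all $k$. M-polyfolds. A splicing $\mathcal S=(\pi,E,V)$ consists of an sc-Banach space $E$, an open subset $V$ of a partial quadrant $C$ in an sc-Banach space $W$, and an sc-smooth map $\pi:V\oplus E\to E$ such that each $\pi_v=\pi(v,\cdot)$ is a bounded linear projection. Its splicing core is $K^{\mathcal S}=\{(v,e)\in V\oplus E: \pi_v e=e\}$; let $r(v,e)=(v,\pi_ve)$. A map $f$ on an open subset $O\subset K^{\mathcal S}$ is sc-smooth if $f\circ r$ is sc-smooth on $r^{-1}(O)$; $TO=Tr(T(r^{-1}(O)))$ and $Tf=T(f\circ r)|_{TO}$. An M-polyfold is a second countable paracompact Hausdorff space $X$ with an atlas of homeomorphisms from open subsets onto open subsets of splicing cores with sc-smooth transition maps. It has levels $X=X_0\supset X_1\supset\cdots\supset X_\infty=\bigcap X_m$; $X^i$ is $X_i$ with levels $X_{i+m}$; the tangent bundle is $TX\to X^1$. Sc-smooth maps and (local) sc-diffeomorphisms are defined via charts. The degeneracy index $d(x)$ is the number of the first $l$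 coordinates (of $[0,\infty)^l\oplus Q\cong C$) that vanish at the $V$-component of $x$ in a chart (chart independent); $\partial X=\{d\ge1\}$. Submanifolds. A finite-dimensional subspace $N\subset (W\oplus E)_\infty$ is in good position to $C\oplus E$ if $N\cap(C\oplus E)$ has nonempty interior in $N$ and there are an sc-complement $N^\perp$ (a closed subspace with $N\oplus(N^\perp\cap(W\oplus E)_m)=(W\oplus E)_m$ for all $m$) and $c>0$ such that for $a\in N$, $b\in N^\perp$ with $\|b\|_0\le c\|a\|_0$ one has $a+b\in C\oplus E$ iff $a\in C\oplus E$. A subset $M\subset X_\infty$ is a finite dimensional submanifold (in good position to $\partial X$) if for every $m\in M$ there are a chart $\varphi:U\to O\subset K^{\mathcal S}$ with $m\in U$, $\varphi(m)=0$, such an $N$ with complement $N^\perp$, an open neighborhood $Q$ of $0$ in $N\cap(C\oplus E)$ and an sc-smooth $A:Q\to N^\perp$ with $A(0)=0$, $DA(0)=0$, such that $q\mapsto q+A(q)$ has image in $O$ and $q\mapsto\varphi^{-1}(q+A(q))$ is a homeomorphism of $Q$ onto $M\cap U$. The inverses of these homeomorphisms make $M$ a smooth manifold with boundary with corners. Ep-groupoids. An ep-groupoid is a groupoid (object set $X$, morphism set $\mathbf X$, all morphisms invertible) with M-polyfold structures on $X$ and $\mathbf X$ such that all structure maps (source $s$, target $t$, multiplication, unit, inverse) are sc-smooth, $s,t$ are surjective local sc-diffeomorphisms (étale), and every $x\in X$ has an open neighborhood $V(x)$ for which $t:s^{-1}(\overline{V(x)})\to X$ is proper. ''Based on separable sc-Hilbert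 spaces'' means the sc-spaces in the charts are separable sc-Hilbert spaces. $|X|=X/\!\sim$ is the orbit space ($x\sim y$ iff there is a morphism $x\to y$), $|x|$ the class of $x$, $|A|$ the image of $A\subset X$; $G_x$ is the (finite) isotropy group of $x$. A natural representation of $G_x$ on an open neighborhood $U$ of $x$ is a homomorphism $g\mapsto\varphi_g$ into the sc-diffeomorphisms of $U$ together with an sc-smooth $\Gamma:G_x\times U\to\mathbf X$ such that $\Gamma(g,x)=g$, $s(\Gamma(g,y))=y$, $t(\Gamma(g,y))=\varphi_g(y)$, and every morphism $h:y\to z$ with $y,z\in U$ equals $\Gamma(g,y)$ for a unique $g$. Branched ep-subgroupoids. Let $\mathbb{Q}^+=\mathbb{Q}\cap[0,\infty)$, a category with only identities. A branched ep-subgroupoid is a functor $\Theta:X\to\mathbb{Q}^+$ (so $\Theta(x)=\Theta(y)$ if there is a morphism $x\to y$) such that: $\operatorname{supp}\Theta=\{\Theta>0\}\subset X_\infty$; every $x\in\operatorname{supp}\Theta$ has an open neighborhood $U$ with a natural representation of $G_x$ and with $\operatorname{supp}\Theta\cap U=\bigcup_{i\in I}M_i$, $I$ finite, where the $M_i$ (local branches) are finite dimensional submanifolds of $X$, all of the same dimension, in good position to $\partial X$, with proper inclusions $M_i\to U$; and there are rational weights $\sigma_i>0$ with $\Theta(y)=\sum_{\{i: y\in M_i\}}\sigma_i$ for $y\in\operatorname{supp}\Theta\cap U$. $(M_i,\sigma_i)_{i\in I}$ is a local branching structure on $U$. $\Theta$ is $n$-dimensional if all local branches have dimension $n$. Measure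 zero. Since $S$ is compact, choose finitely many points $x_\alpha\in\operatorname{supp}\Theta$, open neighborhoods $U_\alpha$ of $x_\alpha$ with natural $G_{x_\alpha}$-action and local branching structures $(M_i^\alpha)_{i\in I^\alpha}$, and $G_{x_\alpha}$-invariant open $V_\alpha\ni x_\alpha$ with $\overline{V_\alpha}\subset U_\alpha$ such that the sets $|V_\alpha|$ cover $S$. For $A\subset S$ let $A_i^\alpha\subset M_i^\alpha$ be the preimage of $A\cap|V_\alpha|$ under $M_i^\alpha\to S$, $x\mapsto|x|$. $A$ has measure zero if every $A_i^\alpha$ has Lebesgue measure zero in the $n$-manifold $M_i^\alpha$. Analogously, $A\subset\partial S$ has measure zero if its preimages (of $A\cap|V_\alpha|$) in $\partial M_i^\alpha$ have $(n-1)$-dimensional Lebesgue measure zero, i.e. their intersections with each local face of $M_i^\alpha$ have measure zero in that face (intersections of two distinct local faces are null sets). *)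

(* Defs.v *)
From HB Require Import structures.
From mathcomp Require Import all_boot all_order all_algebra.
From mathcomp Require Import all_classical all_reals all_analysis.

Set Implicit Arguments.
Unset Strict Implicit.
Unset Printing Implicit Defensive.

Import Order.TTheory GRing.Theory Num.Theory.
Import numFieldNormedType.Exports.

Local Open Scope classical_set_scope.
Local Open Scope ring_scope.

Lemma matrix_complete (R : realType) m n (F : set_system 'M[R]_(m, n)) :
  ProperFilter F -> cauchy F -> cvg F.
Proof. by move=> PF cF; exact: (@mx_complete R^o). Qed.

HB.instance Definition _ (R : realType) m n :=
  Uniform_isComplete.Build 'M[R]_(m, n) (@matrix_complete R m n).

Section prod_complete.
Variables (R : realType) (E F : completeNormedModType R).

HB.instance Definition _ := Pointed.on (E * F)%type.
HB.instance Definition _ := Uniform.on (E * F)%type.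

Lemma prod_complete (G : set_system (E * F)%type) :
  ProperFilter G -> cauchy G -> cvg G.
Proof.
move=> PG /cauchy_ballP cG.
have cE : cvg (fst @ G).
  apply: cauchy_cvg; apply/cauchy_ballP => e e0.
  case: (cG e e0) => -[A B] [/= GA GB] AB; exists (fst @` A, fst @` B).
    by split; [apply: filterS GA|apply: filterS GB] => p ?; exists p.
  by move=> [_ _] [/= [x Ax <-] [y By <-]]; have [] := AB (x, y) (conj Ax By).
have cF : cvg (snd @ G).
  apply: cauchy_cvg; apply/cauchy_ballP => e e0.
  case: (cG e e0) => -[A B] [/= GA GB] AB; exists (snd @` A, snd @` B).
    by split; [apply: filterS GA|apply: filterS GB] => p ?; exists p.
  by move=> [_ _] [/= [x Ax <-] [y By <-]]; have [] := AB (x, y) (conj Ax By).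
apply/cvg_ex; exists (lim (fst @ G), lim (snd @ G)).
have := cvg_pair cE cF.
have -> : (fun x : E * F => (x.1, x.2)) = id by apply/funext => -[].
exact.
Qed.

HB.instance Definition _ :=
  Uniform_isComplete.Build (E * F)%type prod_complete.

End prod_complete.

(* The spaces E_m are linear injective images inside one ambient vector space,
   so that E_m and the intersection of all levels are subsets of a single type,
   and E^1 or E^1 (+) E has the same kind of carrier as E. The carrier itself
   has no topology and may be larger than E_0; everything below is restricted
   to E_0. *)
Record scBanach (R : realType) := ScBanach {
  sc_carrier :> lmodType R;
  sc_space : nat -> completeNormedModType R;
  sc_emb : forall m, {linear sc_space m -> sc_carrier};
  sc_emb_inj : forall m, injective (sc_emb m);
  sc_nested : forall m, range (sc_emb m.+1) `<=` range (sc_emb m);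
  sc_compact : forall m, precompact
    [set y : sc_space m |
      exists2 x : sc_space m.+1, `|x| <= 1 & sc_emb m y = sc_emb m.+1 x];
  sc_dense : forall m, dense (sc_emb m @^-1` \bigcap_k range (sc_emb k))
}.

Section sc_levels.
Variables (R : realType) (E : scBanach R).

Definition sc_level (m : nat) : set E := range (sc_emb E m).

Definition sc_infty : set E := \bigcap_m sc_level m.

(* the element of the Banach space E_m given by x, when x lies in E_m *)
Definition sc_at (m : nat) (x : E) : sc_space E m :=
  xget 0 [set y | sc_emb E m y = x].

Definition sc_norm0 (x : E) : R := `|sc_at 0 x|.

Definition sc_rel_open (C V : set E) : Prop :=
  exists2 O : set (sc_space E 0), open O & V = C `&` sc_emb E 0 @` O.

End sc_levels.
Arguments sc_level {R} E m _.
Arguments sc_infty {R} E _.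

(* separable sc-Hilbert: the given norms come from inner products *)
Definition inner_product_norm (R : realType) (H : normedModType R) : Prop :=
  exists ip : H -> H -> R,
    [/\ forall x y, ip x y = ip y x,
        forall a x y z, ip (a *: x + y) z = a * ip x z + ip y z &
        forall x, ip x x = `|x| ^+ 2].

Definition sc_separable_hilbert (R : realType) (E : scBanach R) : Prop :=
  forall m, inner_product_norm (sc_space E m) /\
    exists2 D : set (sc_space E m), countable D & dense D.

Section sc_const.
Variables (R : realType) (n : nat).

Let emb (m : nat) : {linear 'rV[R]_n -> 'rV[R]_n} := idfun.

Lemma sc_const_nested m : range (emb m.+1) `<=` range (emb m).
Proof. by []. Qed.

Lemma sc_const_compact m : precompact
  [set y : 'rV[R]_n | exists2 x : 'rV[R]_n, `|x| <= 1 & emb m y = emb m.+1 x].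
Proof.
exists (closed_ball_ Num.norm (0 : 'rV[R]_n) 1).
  by move=> y [x x1 /= ->]; rewrite /closed_ball_ /= sub0r normrN.
have cb : closed (closed_ball_ Num.norm (0 : 'rV[R]_n) 1).
  exact: closed_closed_ball_.
split=> //; apply: bounded_closed_compact => //.
exists 1; split=> // M M1 x; rewrite /closed_ball_ /= sub0r normrN => x1.
exact: le_trans x1 (ltW M1).
Qed.

Lemma sc_const_dense m : dense (emb m @^-1` \bigcap_k range (emb k)).
Proof.
by move=> O [x Ox] _; exists x; split=> // k _; exists x.
Qed.

Definition sc_const : scBanach R :=
  @ScBanach R 'rV[R]_n (fun=> 'rV[R]_n) emb (fun _ _ _ => id)
    sc_const_nested sc_const_compact sc_const_dense.

End sc_const.

Section sc_shift.
Variables (R : realType) (E : scBanach R).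

Lemma sc_shift_dense m : dense
  (sc_emb E m.+1 @^-1` \bigcap_k range (sc_emb E k.+1)).
Proof.
move=> O O0 oO; have [x [Ox Ex]] := @sc_dense _ E m.+1 O O0 oO.
by exists x; split=> // k _; exact: Ex.
Qed.

(* E^1 *)
Definition sc_shift : scBanach R :=
  @ScBanach R E (fun m => sc_space E m.+1) (fun m => sc_emb E m.+1)
    (fun m => @sc_emb_inj _ E m.+1) (fun m => @sc_nested _ E m.+1)
    (fun m => @sc_compact _ E m.+1) sc_shift_dense.

End sc_shift.

Section sc_prod.
Variables (R : realType) (E F : scBanach R).

Definition prod_emb (m : nat) (p : sc_space E m * sc_space F m) : E * F :=
  (sc_emb E m p.1, sc_emb F m p.2).

Lemma prod_emb_linear m : linear (@prod_emb m).
Proof. by move=> a [x y] [x' y']; rewrite /prod_emb /= !linearP. Qed.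

HB.instance Definition _ m := GRing.isLinear.Build R
  (sc_space E m * sc_space F m)%type (E * F)%type *:%R (@prod_emb m)
  (@prod_emb_linear m).

Lemma prod_emb_inj m : injective (@prod_emb m).
Proof. by move=> [x y] [x' y'] [/sc_emb_inj -> /sc_emb_inj ->]. Qed.

Lemma prod_nested m : range (@prod_emb m.+1) `<=` range (@prod_emb m).
Proof.
move=> _ [[x y] _ <-].
have [x' _ ex] := @sc_nested _ E m _ (imageP (sc_emb E m.+1) (I : setT x)).
have [y' _ ey] := @sc_nested _ F m _ (imageP (sc_emb F m.+1) (I : setT y)).
by exists (x', y') => //; rewrite /prod_emb /= ex ey.
Qed.

Lemma prod_compact m : precompact
  [set q : sc_space E m * sc_space F m |
    exists2 p : sc_space E m.+1 * sc_space F m.+1,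
      `|p| <= 1 & prod_emb q = prod_emb p].
Proof.
have [A sA [cA clA]] := @sc_compact _ E m.
have [B sB [cB clB]] := @sc_compact _ F m.
exists (A `*` B).
  move=> [x y] [[x' y'] + [ex ey]].
  rewrite prod_normE ge_max => /andP[x1 y1].
  by split; [apply: sA; exists x'|apply: sB; exists y'].
split; first exact: compact_setX.
have -> : A `*` B = fst @^-1` A `&` snd @^-1` B by [].
by apply: closedI; apply: closed_comp => // p _;
  [exact: cvg_fst|exact: cvg_snd].
Qed.

Lemma prod_dense m : dense (@prod_emb m @^-1` \bigcap_k range (@prod_emb k)).
Proof.
move=> O [[x y] Oxy] oO.
have [[P Q] [/= Px Qy] PQ] : nbhs (x, y) O by exact: open_nbhs_nbhs.
have [x' [/interior_subset Px' Ex']] :=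
  @sc_dense _ E m _ (ex_intro _ x Px) (@open_interior _ P).
have [y' [/interior_subset Qy' Fy']] :=
  @sc_dense _ F m _ (ex_intro _ y Qy) (@open_interior _ Q).
exists (x', y'); split; first exact: PQ.
move=> k _; have [u _ eu] := Ex' k I; have [v _ ev] := Fy' k I.
by exists (u, v) => //; rewrite /prod_emb /= eu ev.
Qed.

Definition sc_prod : scBanach R :=
  @ScBanach R (E * F)%type (fun m => (sc_space E m * sc_space F m)%type)
    (fun m => @prod_emb m) prod_emb_inj prod_nested prod_compact prod_dense.

End sc_prod.

(* TE = E^1 (+) E *)
Definition sc_tangent (R : realType) (E : scBanach R) : scBanach R :=
  sc_prod (sc_shift E) E.

Section sc_calculus.
Variable R : realType.

Definition sc_map (E F : scBanach R) (m : nat) (f : E -> F) :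
  sc_space E m -> sc_space F m := fun x => sc_at m (f (sc_emb E m x)).
Arguments sc_map {E F} m f x.

Definition sc0 (E F : scBanach R) (U : set E) (f : E -> F) : Prop :=
  forall m,
    (forall x, U x -> sc_level E m x -> sc_level F m (f x)) /\
    {within sc_emb E m @^-1` U, continuous (sc_map m f)}.

Definition bounded_linear0 (E F : scBanach R) (D : E -> F) : Prop :=
  exists T : {linear sc_space E 0 -> sc_space F 0},
    continuous T /\ forall h, D (sc_emb E 0 h) = sc_emb F 0 (T h).

(* D is the linearization at x : the remainder, measured in F_0, is o(|h|_1) *)
Definition sc_deriv (E F : scBanach R) (U : set E) (f : E -> F) (x : E)
    (D : E -> F) : Prop :=
  bounded_linear0 D /\
  (fun h : sc_space E 1 =>
     sc_norm0 (f (x + sc_emb E 1 h) - f x - D (sc_emb E 1 h)) / `|h|)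
    @ within [set h | U (x + sc_emb E 1 h)] 0^' --> (0 : R).

Definition tangent_dom (E : scBanach R) (U : set E) : set (sc_tangent E) :=
  [set p | [/\ U p.1, sc_level E 1 p.1 & sc_level E 0 p.2]].

Fixpoint sc_k (k : nat) (E F : scBanach R) (U : set E) (f : E -> F) : Prop :=
  sc0 U f /\
  match k with
  | 0 => True
  | k'.+1 => exists Df : E -> E -> F,
      (forall x, U x -> sc_level E 1 x -> sc_deriv U f x (Df x)) /\
      @sc_k k' (sc_tangent E) (sc_tangent F) (tangent_dom U)
        (fun p => (f p.1, Df p.1 p.2))
  end.

Definition sc_smooth (E F : scBanach R) (U : set E) (f : E -> F) : Prop :=
  forall k, sc_k k U f.

(* A partial quadrant, presented by a linear sc-isomorphism onto
   [0,oo)^l (+) Q. *)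
Record quadrant (W : scBanach R) := Quadrant {
  qd_dim : nat;
  qd_rest : scBanach R;
  qd_iso : {linear W -> sc_prod (sc_const R qd_dim) qd_rest};
  qd_inv : {linear sc_prod (sc_const R qd_dim) qd_rest -> W};
  qd_iso_sc0 : sc0 setT qd_iso;
  qd_inv_sc0 : sc0 setT qd_inv;
  qd_isoK : forall w, sc_level W 0 w -> qd_inv (qd_iso w) = w;
  qd_invK : forall y, sc_level (sc_prod (sc_const R qd_dim) qd_rest) 0 y ->
    qd_iso (qd_inv y) = y
}.

Definition qd_coord (W : scBanach R) (C : quadrant W) (i : 'I_(qd_dim C))
  (w : W) : R := (qd_iso C w).1 ord0 i.

Definition qd_set (W : scBanach R) (C : quadrant W) : set W :=
  [set w | sc_level W 0 w /\ forall i, 0 <= qd_coord (C := C) i w].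

Record splicing := Splicing {
  sp_W : scBanach R;
  sp_E : scBanach R;
  sp_quad : quadrant sp_W;
  sp_V : set sp_W;
  sp_V_open : sc_rel_open (qd_set sp_quad) sp_V;
  sp_proj : sp_W * sp_E -> sp_E;
  sp_proj_smooth : @sc_smooth (sc_prod sp_W sp_E) sp_E
    (sp_V `*` sc_level sp_E 0) sp_proj;
  sp_proj_linear : forall v, sp_V v ->
    bounded_linear0 (fun e => sp_proj (v, e));
  sp_proj_idem : forall v e, sp_V v -> sc_level sp_E 0 e ->
    sp_proj (v, sp_proj (v, e)) = sp_proj (v, e)
}.

Definition sp_space (S : splicing) : scBanach R := sc_prod (sp_W S) (sp_E S).

Definition sp_quadrant (S : splicing) : set (sp_space S) :=
  qd_set (sp_quad S) `*` sc_level (sp_E S) 0.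

Definition sp_dom (S : splicing) : set (sp_space S) :=
  @sp_V S `*` sc_level (sp_E S) 0.

Definition sp_core (S : splicing) : set (sp_space S) :=
  [set p | @sp_dom S p /\ @sp_proj S p = p.2].

Definition sp_retr (S : splicing) (p : sp_space S) : sp_space S :=
  (p.1, @sp_proj S p).

Definition core_smooth (S : splicing) (F : scBanach R) (O : set (sp_space S))
    (f : sp_space S -> F) : Prop :=
  sc_smooth (@sp_dom S `&` @sp_retr S @^-1` O) (f \o @sp_retr S).

End sc_calculus.
Arguments sp_V {R} s _.
Arguments sp_proj {R} s _.
Arguments sp_quadrant {R} S _.
Arguments sp_dom {R} S _.
Arguments sp_core {R} S _.
Arguments sp_retr {R} S p.

Definition paracompact (T : topologicalType) : Prop :=
  forall C : set (set T), C `<=` open -> \bigcup_(A in C) A = setT ->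
  exists C' : set (set T),
    [/\ C' `<=` open, \bigcup_(A in C') A = setT,
        (forall A, C' A -> exists2 B, C B & A `<=` B) &
        forall x : T, exists2 N, nbhs x N &
          finite_set [set A | C' A /\ A `&` N !=set0]].

Section mpolyfold.
Variable R : realType.

Record chart (X : topologicalType) := Chart {
  ch_spl : splicing R;
  ch_dom : set X;
  ch_img : set (sp_space ch_spl);
  ch_map : X -> sp_space ch_spl;
  ch_inv : sp_space ch_spl -> X;
  ch_dom_open : open ch_dom;
  ch_img_open : sc_rel_open (sp_core ch_spl) ch_img;
  ch_map_img : forall x, ch_dom x -> ch_img (ch_map x);
  ch_inv_dom : forall p, ch_img p -> ch_dom (ch_inv p);
  ch_mapK : forall x, ch_dom x -> ch_inv (ch_map x) = x;
  ch_invK : forall p, ch_img p -> ch_map (ch_inv p) = p;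
  ch_map_cont : {within ch_dom, continuous (fun x => sc_at 0 (ch_map x))};
  ch_inv_cont : {within sc_emb (sp_space ch_spl) 0 @^-1` ch_img,
    continuous (ch_inv \o sc_emb (sp_space ch_spl) 0)}
}.

Definition transition_smooth (X : topologicalType) (c d : chart X) : Prop :=
  core_smooth (ch_map c @` (ch_dom c `&` ch_dom d))
    (ch_map d \o ch_inv (c := c)).

Record mpolyfold (X : topologicalType) := MPolyfold {
  mp_atlas : chart X -> Prop;
  mp_cover : forall x, exists2 c, mp_atlas c & ch_dom c x;
  mp_compat : forall c d, mp_atlas c -> mp_atlas d -> transition_smooth c d;
  mp_second_countable : @second_countable X;
  mp_paracompact : paracompact X;
  mp_hausdorff : hausdorff_space X
}.

(* charts of the maximal atlas *)
Definition mp_chart (X : topologicalType) (P : mpolyfold X) (c : chart X) :=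
  forall d, mp_atlas P d -> transition_smooth c d /\ transition_smooth d c.

Definition mp_level (X : topologicalType) (P : mpolyfold X) (m : nat) : set X :=
  [set x | exists c, [/\ mp_atlas P c, ch_dom c x &
    sc_level (sp_space (ch_spl c)) m (ch_map c x)]].

Definition mp_infty (X : topologicalType) (P : mpolyfold X) : set X :=
  \bigcap_m mp_level P m.

Definition mp_separable_hilbert (X : topologicalType) (P : mpolyfold X) :=
  forall c, mp_atlas P c ->
    sc_separable_hilbert (sp_W (ch_spl c)) /\
    sc_separable_hilbert (sp_E (ch_spl c)).

(* degeneracy index of x, read in the chart c *)
Definition degeneracy (X : topologicalType) (c : chart X) (x : X) : nat :=
  #|[pred i | qd_coord (C := sp_quad (ch_spl c)) i (ch_map c x).1 == 0]|.

(* the degeneracy index does not depend on the chart *)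
Definition mp_boundary (X : topologicalType) (P : mpolyfold X) : set X :=
  [set x | exists c, [/\ mp_atlas P c, ch_dom c x & (1 <= degeneracy c x)%N]].

(* sc-smoothness on an open subset U *)
Definition mp_smooth (X Y : topologicalType) (P : mpolyfold X)
    (Q : mpolyfold Y) (U : set X) (f : X -> Y) : Prop :=
  {within U, continuous f} /\
  forall c d, mp_atlas P c -> mp_atlas Q d ->
    core_smooth (ch_map c @` (ch_dom c `&` U `&` f @^-1` ch_dom d))
      (ch_map d \o f \o ch_inv (c := c)).

Definition mp_diffeo (X Y : topologicalType) (P : mpolyfold X)
    (Q : mpolyfold Y) (U : set X) (U' : set Y) (f : X -> Y) : Prop :=
  [/\ open U, open U', f @` U = U', mp_smooth P Q U f &
    exists g : Y -> X, mp_smooth Q P U' g /\ forall x, U x -> g (f x) = x].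

Definition mp_local_diffeo (X Y : topologicalType) (P : mpolyfold X)
    (Q : mpolyfold Y) (f : X -> Y) : Prop :=
  forall x, exists U U', U x /\ mp_diffeo P Q U U' f.

Definition sc_complement (F : scBanach R) (N Nc : set F) : Prop :=
  [/\ Nc `<=` sc_level F 0,
      Nc 0 /\ (forall (a : R) x y, Nc x -> Nc y -> Nc (a *: x + y)),
      closed (sc_emb F 0 @^-1` Nc),
      N `&` Nc = [set 0] &
      forall m x, sc_level F m x ->
        exists a b, [/\ N a, Nc b, sc_level F m b & x = a + b]].

(* N is in good position to the quadrant D, with complement Nc *)
Definition good_position (F : scBanach R) (D N Nc : set F) : Prop :=
  [/\ N `<=` sc_infty F,
      exists O : set (sc_space F 0),
        [/\ open O, N `&` sc_emb F 0 @` O !=set0 &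
            N `&` sc_emb F 0 @` O `<=` D],
      sc_complement N Nc &
      exists2 c : R, 0 < c & forall a b, N a -> Nc b ->
        sc_norm0 b <= c * sc_norm0 a -> (D (a + b) <-> D a)].

(* A local parametrization q |-> phi^-1 (q + A q) of M. The n-dimensional
   space N is the range of an injective linear map from R^n, and Q and A are
   written in the resulting linear coordinates. *)
Record local_param (X : topologicalType) (P : mpolyfold X) (n : nat)
    (M : set X) := LocalParam {
  lp_chart : chart X;
  lp_space := sp_space (ch_spl lp_chart);
  lp_is_chart : mp_chart P lp_chart;
  lp_lin : {linear 'rV[R]_n -> lp_space};
  lp_lin_inj : injective lp_lin;
  lp_compl : set lp_space;
  lp_good : good_position (sp_quadrant (ch_spl lp_chart)) (range lp_lin)
    lp_compl;
  lp_dom : set 'rV[R]_n;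
  lp_dom_open : exists2 O, open O &
    lp_dom = O `&` lp_lin @^-1` sp_quadrant (ch_spl lp_chart);
  lp_dom0 : lp_dom 0;
  lp_map : 'rV[R]_n -> lp_space;
  lp_map_smooth : @sc_smooth R (sc_const R n) lp_space lp_dom lp_map;
  lp_map_compl : forall q, lp_dom q -> lp_compl (lp_map q);
  lp_map0 : lp_map 0 = 0;
  lp_dmap0 : @sc_deriv R (sc_const R n) lp_space lp_dom lp_map 0 (fun=> 0);
  lp_img : forall q, lp_dom q -> ch_img (c := lp_chart) (lp_lin q + lp_map q);
  lp_pt := fun q : 'rV[R]_n => ch_inv (c := lp_chart) (lp_lin q + lp_map q);
  lp_bij : set_bij lp_dom (M `&` ch_dom lp_chart) lp_pt;
  lp_pt_cont : {within lp_dom, continuous lp_pt};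
  lp_coord_cont : exists g : X -> 'rV[R]_n,
    {within M `&` ch_dom lp_chart, continuous g} /\
    forall q, lp_dom q -> g (lp_pt q) = q
}.

Definition submanifold (X : topologicalType) (P : mpolyfold X) (n : nat)
    (M : set X) : Prop :=
  M `<=` mp_infty P /\
  forall x, M x -> exists L : local_param P n M,
    ch_dom (lp_chart L) x /\ ch_map (lp_chart L) x = 0.

(* Lebesgue measure zero in R^n, by coverings with countably many boxes. The
   index set D may be empty, which matters for n = 0, where every box has
   volume 1 and only the empty set is null. *)
Definition lebesgue_null (n : nat) (A : set 'rV[R]_n) : Prop :=
  forall e : R, 0 < e -> exists (D : set nat) (a b : nat -> 'rV[R]_n),
    [/\ forall k i, a k ord0 i <= b k ord0 i,
        A `<=` \bigcup_(k in D)
          [set x | forall i, a k ord0 i <= x ord0 i <= b k ord0 i] &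
        (\esum_(k in D) (\prod_i (b k ord0 i - a k ord0 i))%:E <= e%:E)%E].

Definition manifold_null (X : topologicalType) (P : mpolyfold X) (n : nat)
    (M B : set X) : Prop :=
  forall L : local_param P n M,
    lebesgue_null (lp_dom L `&` lp_pt L @^-1` B).

(* The local faces of M are the sets {x_i = 0}, i < k, in coordinates in which
   the quadrant N `&` (C (+) E) is [0,oo)^k x R^(n-k). *)
Definition manifold_boundary_null (X : topologicalType) (P : mpolyfold X)
    (n : nat) (M B : set X) : Prop :=
  forall (L : local_param P n M) (k : nat),
    lp_lin L @^-1` sp_quadrant (ch_spl (lp_chart L)) =
      [set q | forall i : 'I_n, (i < k)%N -> 0 <= q ord0 i] ->
    forall i : 'I_n, (i < k)%N ->
      lebesgue_null (col' i @`
        (lp_dom L `&` [set q | q ord0 i = 0] `&` lp_pt L @^-1` B)).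

(* Sc-smoothness of f(h, g) on the fibre product {(h, g) | s h = t g}, for s
   a local sc-diffeomorphism. The M-polyfold structure of the fibre product is
   the one making (h, g) |-> g a local sc-diffeomorphism; its local inverses
   are g |-> (sigma (t g), g), for sigma an inverse of s on an open set H. *)
Definition fibre_product_smooth (X M : topologicalType) (P : mpolyfold M)
    (s t : M -> X) (f : M -> M -> M) : Prop :=
  forall (H : set M) (sigma : X -> M), open H ->
    (forall h, H h -> sigma (s h) = h) ->
    mp_smooth P P (t @^-1` (s @` H)) (fun g => f (sigma (t g)) g).

Record ep_groupoid (X M : topologicalType) := EpGroupoid {
  ep_obj : mpolyfold X;
  ep_mor : mpolyfold M;
  ep_src : M -> X;
  ep_tgt : M -> X;
  (* ep_comp h g is h after g; only meaningful when ep_src h = ep_tgt g *)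
  ep_comp : M -> M -> M;
  ep_unit : X -> M;
  ep_inv : M -> M;
  ep_src_comp : forall h g, ep_src h = ep_tgt g ->
    ep_src (ep_comp h g) = ep_src g;
  ep_tgt_comp : forall h g, ep_src h = ep_tgt g ->
    ep_tgt (ep_comp h g) = ep_tgt h;
  ep_compA : forall k h g, ep_src k = ep_tgt h -> ep_src h = ep_tgt g ->
    ep_comp k (ep_comp h g) = ep_comp (ep_comp k h) g;
  ep_src_unit : forall x, ep_src (ep_unit x) = x;
  ep_tgt_unit : forall x, ep_tgt (ep_unit x) = x;
  ep_comp1g : forall g, ep_comp (ep_unit (ep_tgt g)) g = g;
  ep_compg1 : forall g, ep_comp g (ep_unit (ep_src g)) = g;
  ep_src_inv : forall g, ep_src (ep_inv g) = ep_tgt g;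
  ep_tgt_inv : forall g, ep_tgt (ep_inv g) = ep_src g;
  ep_compVg : forall g, ep_comp (ep_inv g) g = ep_unit (ep_src g);
  ep_compgV : forall g, ep_comp g (ep_inv g) = ep_unit (ep_tgt g);
  ep_src_smooth : mp_smooth ep_mor ep_obj setT ep_src;
  ep_tgt_smooth : mp_smooth ep_mor ep_obj setT ep_tgt;
  ep_unit_smooth : mp_smooth ep_obj ep_mor setT ep_unit;
  ep_inv_smooth : mp_smooth ep_mor ep_mor setT ep_inv;
  ep_comp_smooth : fibre_product_smooth ep_mor ep_src ep_tgt ep_comp;
  ep_src_etale : range ep_src = setT /\ mp_local_diffeo ep_mor ep_obj ep_src;
  ep_tgt_etale : range ep_tgt = setT /\ mp_local_diffeo ep_mor ep_obj ep_tgt;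
  ep_proper : forall x, exists V : set X, [/\ open V, V x &
    forall K : set X, compact K ->
      compact (ep_src @^-1` closure V `&` ep_tgt @^-1` K)]
}.

Section branched.
Variables (X M : topologicalType) (G : ep_groupoid X M).

Definition ep_separable_hilbert : Prop :=
  mp_separable_hilbert (ep_obj G) /\ mp_separable_hilbert (ep_mor G).

Definition isotropy (x : X) : set M := [set g | ep_src G g = x /\ ep_tgt G g = x].

(* G_x is finite and discrete, so Gamma is sc-smooth on G_x x U iff every
   Gamma g is sc-smooth on U. *)
Record natural_rep (x : X) (U : set X) := NaturalRep {
  nr_act : M -> X -> X;
  nr_Gamma : M -> X -> M;
  nr_open : open U;
  nr_mem : U x;
  nr_diffeo : forall g, isotropy x g ->
    mp_diffeo (ep_obj G) (ep_obj G) U U (nr_act g);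
  nr_comp : forall g h y, isotropy x g -> isotropy x h -> U y ->
    nr_act (ep_comp G g h) y = nr_act g (nr_act h y);
  nr_Gamma_smooth : forall g, isotropy x g ->
    mp_smooth (ep_obj G) (ep_mor G) U (nr_Gamma g);
  nr_Gamma_x : forall g, isotropy x g -> nr_Gamma g x = g;
  nr_src : forall g y, isotropy x g -> U y -> ep_src G (nr_Gamma g y) = y;
  nr_tgt : forall g y, isotropy x g -> U y ->
    ep_tgt G (nr_Gamma g y) = nr_act g y;
  nr_uniq : forall h, U (ep_src G h) -> U (ep_tgt G h) ->
    exists! g, isotropy x g /\ h = nr_Gamma g (ep_src G h)
}.

Definition orbit_rel : rel X :=
  fun x y => `[< exists g, ep_src G g = x /\ ep_tgt G g = y >].

Lemma orbit_rel_refl : reflexive orbit_rel.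
Proof.
move=> x; apply/asboolP; exists (ep_unit G x).
by rewrite ep_src_unit ep_tgt_unit.
Qed.

Lemma orbit_rel_sym : symmetric orbit_rel.
Proof.
move=> x y; apply/idP/idP => /asboolP[g [<- <-]]; apply/asboolP;
  by exists (ep_inv G g); rewrite ep_src_inv ep_tgt_inv.
Qed.

Lemma orbit_rel_trans : transitive orbit_rel.
Proof.
move=> y x z /asboolP[g [<- gy]] /asboolP[h [hy <-]]; apply/asboolP.
have hg : ep_src G h = ep_tgt G g by rewrite hy gy.
by exists (ep_comp G h g); rewrite ep_src_comp // ep_tgt_comp.
Qed.

Definition orbit_equiv : equiv_rel X :=
  EquivRel orbit_rel orbit_rel_refl orbit_rel_sym orbit_rel_trans.

Definition orbit_space : topologicalType :=
  quotient_topology {eq_quot orbit_equiv}%qT.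

Definition orbit (x : X) : orbit_space :=
  (\pi_(quotient_topology {eq_quot orbit_equiv}%qT) x)%qT.

Definition supp (Theta : X -> rat) : set X := [set x | 0 < Theta x].

Record local_branching (Theta : X -> rat) (U : set X) := LocalBranching {
  lb_num : nat;
  lb_branch : 'I_lb_num -> set X;
  lb_weight : 'I_lb_num -> rat;
  lb_union : supp Theta `&` U = \bigcup_i lb_branch i;
  lb_submanifold : exists d, forall i, submanifold (ep_obj G) d (lb_branch i);
  (* properness of the inclusion of the branch into U *)
  lb_proper : forall i K, K `<=` U -> compact K -> compact (lb_branch i `&` K);
  lb_weight_gt0 : forall i, 0 < lb_weight i;
  lb_sum : forall y, (supp Theta `&` U) y ->
    Theta y = \sum_(i | `[< lb_branch i y >]) lb_weight i
}.

Definition branched_ep_subgroupoid (Theta : X -> rat) : Prop :=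
  [/\ forall x, 0 <= Theta x,
      forall g, Theta (ep_src G g) = Theta (ep_tgt G g),
      supp Theta `<=` mp_infty (ep_obj G) &
      forall x, supp Theta x -> exists U : set X,
        inhabited (natural_rep x U) /\ inhabited (local_branching Theta U)].

Definition dimensional (Theta : X -> rat) (n : nat) : Prop :=
  forall x U, supp Theta x -> natural_rep x U ->
  forall (B : local_branching Theta U) (i : 'I_(lb_num B)),
    submanifold (ep_obj G) n (lb_branch i).

Definition orbit_supp (Theta : X -> rat) : set orbit_space :=
  orbit @` supp Theta.

Definition orbit_supp_boundary (Theta : X -> rat) : set orbit_space :=
  orbit @` (supp Theta `&` mp_boundary (ep_obj G)).

(* the choices entering the definition of measure zero *)
Record branched_cover (Theta : X -> rat) := BranchedCover {
  bc_num : nat;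
  bc_pt : 'I_bc_num -> X;
  bc_U : 'I_bc_num -> set X;
  bc_V : 'I_bc_num -> set X;
  bc_pt_supp : forall a, supp Theta (bc_pt a);
  bc_rep : forall a, natural_rep (bc_pt a) (bc_U a);
  bc_branching : forall a, local_branching Theta (bc_U a);
  bc_V_open : forall a, open (bc_V a);
  bc_V_pt : forall a, bc_V a (bc_pt a);
  bc_V_closure : forall a, closure (bc_V a) `<=` bc_U a;
  bc_V_invariant : forall a g, isotropy (bc_pt a) g ->
    nr_act (bc_rep a) g @` bc_V a = bc_V a;
  bc_cover : orbit_supp Theta `<=` \bigcup_a (orbit @` bc_V a)
}.

Definition branch_preimage (Theta : X -> rat) (C : branched_cover Theta)
    (A : set orbit_space) (a : 'I_(bc_num C))
    (i : 'I_(lb_num (bc_branching a))) : set X :=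
  lb_branch i `&` orbit @^-1` (A `&` orbit @` bc_V a).

Definition measure_zero (Theta : X -> rat) (n : nat) (C : branched_cover Theta)
    (A : set orbit_space) : Prop :=
  A `<=` orbit_supp Theta /\
  forall (a : 'I_(bc_num C)) (i : 'I_(lb_num (bc_branching a))),
    manifold_null (ep_obj G) n (lb_branch i) (branch_preimage A i).

Definition boundary_measure_zero (Theta : X -> rat) (n : nat)
    (C : branched_cover Theta) (A : set orbit_space) : Prop :=
  A `<=` orbit_supp_boundary Theta /\
  forall (a : 'I_(bc_num C)) (i : 'I_(lb_num (bc_branching a))),
    manifold_boundary_null (ep_obj G) n (lb_branch i) (branch_preimage A i).

End branched.

End mpolyfold.
Arguments orbit_supp {R X M} G Theta _.
Arguments orbit_supp_boundary {R X M} G Theta _.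

(* Borel sets of a subspace S, as subsets of the ambient space *)
Definition borel_on (T : topologicalType) (S : set T) : set (set T) :=
  <<s S, [set S `&` O | O in open] >>.

Definition borel_completion (T : topologicalType) (S : set T)
    (Z : set (set T)) : set (set T) :=
  <<s S, borel_on S `|` Z >>.

(* Main.v *)
Require Import Defs.
From HB Require Import structures.
From mathcomp Require Import all_boot all_order all_algebra.
From mathcomp Require Import all_classical all_reals all_analysis.
From mathcomp Require Import ring lra.

(** Two choices of patches and local branches are compared through morphisms.
Let a branch M1 of one choice and a branch M2 of the other contain z and y, and
let a morphism run from z to y. As source and target are local diffeomorphisms,
the morphism extends to a local diffeomorphism psi carrying z to y, and near z
the support is the union of the finitely many branches through z. So near y the
branch M2 is covered by the psi-images of these branches. The part of M1 that
psi maps into M2 need not be open in M1, so M1 and M2 are not related by a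
change of coordinates. However, in local parameters q of M1 and q' of M2 the
relation q |-> q' is Lipschitz at each point of its domain, without any
uniformity, and this is enough to map null sets to null sets
([null_pointwise_lipschitz]): the domain is a countable union of sets on which
the map is Lipschitz at a fixed scale. Being null is a local property
([null_local]), whence the independence of the choices.

The pointwise Lipschitz property comes from sc-calculus. An sc-smooth map is
differentiable from level m+1 to level m at each point of level m+1
([sc_k_diff]), so passing through a chart costs one level. A branch is
parametrized by q + A(q), with q in a finite dimensional space of smooth points
and A smooth into every level; starting high enough, the four transitions that
make up psi can be afforded ([lip_at], [local_morphism]). Finally q' is
controlled by q' + A'(q'), because a finite dimensional space meets the closed
complement containing A'(q') only in 0 ([compl_lower_bound]).

On the boundary the same argument is run on local faces, once it is known that
near the centre of a parametrization a point of the branch lying in the boundary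
of X lies on a local face ([lp_boundary_face]). This rests on two facts. Being a
boundary point does not depend on the chart and is preserved by morphisms, at
smooth points ([corner_recognition], [src_boundary]): at an interior point every
tangent direction can be followed both ways, and a transition map cannot send
both rays into a quadrant if its derivative points out of a face. And in good
position the quadrant cuts out of N a product of half-lines and lines
([cone_standard]): a coordinate of the quadrant that vanishes at a nonzero point
of the cone must vanish on the complement, hence such coordinates are independent
on N.

The boundary of S is compact because interior points form an open subset of the
support ([nonboundary_near]) and the orbit map is open. Patches exist because
isotropy groups are finite, by properness, and X is regular, being paracompact
and Hausdorff ([invariant_neighbourhood]). *)

Set Implicit Arguments.
Unset Strict Implicit.
Unset Printing Implicit Defensive.

Import Order.TTheory GRing.Theory Num.Theory.
Import numFieldNormedType.Exports.

Local Open Scope classical_set_scope.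
Local Open Scope ring_scope.

(** * Lebesgue null sets and their covers *)

Lemma esum_geometric_le (R : realType) (D : set nat) (e : R) : 0 <= e ->
  (\esum_(k in D) (e / (2 ^ k.+1)%:R)%:E <= e%:E)%E.
Proof.
move=> e0; have d0 k : (0%:E <= (e / (2 ^ k.+1)%:R)%:E)%E.
  by rewrite lee_fin divr_ge0.
apply: le_trans (@epsilon_trick0 _ e xpredT e0).
rewrite nneseries_esumT // [leLHS]esum_mkcond.
by apply: le_esum => k _; case: ifP.
Qed.

Section covers.
Variables (R : realType) (T : Type).
Implicit Types (F : set T -> R -> Prop) (A : set T).

(** The family F of weighted sets will be the boxes with their volume, or the cubes
of bounded side; passing between the two is what makes Lipschitz images of null
sets tractable. *)
Definition covers F (v : R) A : Prop :=
  exists (D : set nat) (B : nat -> set T) (w : nat -> R),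
    [/\ forall k, D k -> F (B k) (w k), forall k, D k -> 0 <= w k,
        A `<=` \bigcup_(k in D) B k & (\esum_(k in D) (w k)%:E <= v%:E)%E].

Lemma covers_sub F v v' A A' :
  v <= v' -> A' `<=` A -> covers F v A -> covers F v' A'.
Proof.
move=> vv' AA' [D [B [w [FB w0 AB wv]]]]; exists D, B, w; split=> //.
  exact: subset_trans AA' AB.
by apply: le_trans wv _; rewrite lee_fin.
Qed.

(** The covers of the pieces, indexed by pairs of naturals, are reindexed by a
single natural through a pairing. *)
Lemma covers_bigcup F (D : set nat) (v : nat -> R) (A : nat -> set T) u :
  (forall k, D k -> covers F (v k) (A k)) -> (forall k, D k -> 0 <= v k) ->
  (\esum_(k in D) (v k)%:E <= u%:E)%E -> covers F u (\bigcup_(k in D) A k).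
Proof.
move=> cA v0 vu.
have /choice[p hp] : forall k, exists p : set nat * (nat -> set T) * (nat -> R),
    D k -> [/\ forall j, p.1.1 j -> F (p.1.2 j) (p.2 j),
      forall j, p.1.1 j -> 0 <= p.2 j, A k `<=` \bigcup_(j in p.1.1) p.1.2 j &
      (\esum_(j in p.1.1) (p.2 j)%:E <= (v k)%:E)%E].
  move=> k; have [Dk|nDk] := pselect (D k); last first.
    by exists (set0, fun=> set0, fun=> 0).
  by have [D' [B [w h]]] := cA k Dk; exists (D', B, w).
pose J := D `*`` (fun k => (p k).1.1).
pose dec n : nat * nat := odflt (0%N, 0%N) (unpickle n).
have decK q : dec (pickle q) = q by rewrite /dec pickleK.
exists (pickle @` J), (fun n => (p (dec n).1).1.2 (dec n).2),
  (fun n => (p (dec n).1).2 (dec n).2); split.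
- by move=> _ [[k j] [/= Dk Jj] <-]; rewrite decK /=; have [+ _ _ _] := hp k Dk; apply.
- by move=> _ [[k j] [/= Dk Jj] <-]; rewrite decK /=; have [_ + _ _] := hp k Dk; apply.
- move=> x [k Dk Akx]; have [_ _ /(_ _ Akx)[j Jj Bj] _] := hp k Dk.
  by exists (pickle (k, j)); [exists (k, j)|rewrite decK].
- rewrite esum_image; last by move=> q q' _ _ /(pcan_inj pickleK).
  under eq_esum => q _ do rewrite decK.
  rewrite -(@esum_esum _ _ _ D (fun k => (p k).1.1) (fun k j => ((p k).2 j)%:E)).
    by apply: le_trans vu; apply: le_esum => k Dk; have [_ _ _] := hp k Dk.
  by move=> k j Dk Jj; have [_ + _ _] := hp k Dk; rewrite lee_fin; apply.
Qed.

Lemma covers_seq F (I : eqType) (s : seq I) (B : I -> set T) (w : I -> R) :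
  (forall i, F (B i) (w i)) -> (forall i, 0 <= w i) ->
  covers F (\sum_(i <- s) w i) [set x | exists2 i, i \in s & B i x].
Proof.
move=> FB w0; case: s => [|i0 s'].
  exists set0, (fun=> set0), (fun=> 0); split=> //; first by move=> x [i].
  by rewrite esum_set0 big_nil.
set s := i0 :: s'.
exists `I_(size s), (fun k => B (nth i0 s k)), (fun k => w (nth i0 s k)).
split=> //.
- by move=> x [i /(nthP i0)[k ks <-] Bi]; exists k.
- rewrite esum_fset; [|exact: finite_II|by move=> k _; rewrite lee_fin].
  by rewrite -fsbig_ord sumEFin lee_fin (big_nth i0) big_mkord.
Qed.

(** The error at the k-th member of the cover is taken to be e / 2 ^ (k + 1). *)
Lemma covers_comp (F G : set T -> R -> Prop) v A :
  (forall B w e, F B w -> 0 < e -> covers G (w + e) B) ->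
  covers F v A -> forall e, 0 < e -> covers G (v + e) A.
Proof.
move=> FG [D [B [w [FB w0 AB wv]]]] e e0.
pose d k : R := e / (2 ^ k.+1)%:R.
have d0 k : 0 < d k by rewrite divr_gt0 // ltr0n expn_gt0.
apply: (@covers_sub _ (v + e) _ (\bigcup_(k in D) B k)) => //.
apply: (covers_bigcup (v := fun k => w k + d k)).
- by move=> k Dk; apply: FG; [exact: FB|exact: d0].
- by move=> k Dk; rewrite addr_ge0 ?w0// ltW.
- under eq_esum do rewrite EFinD.
  rewrite esumD; [|by move=> k Dk; rewrite lee_fin w0|
    by move=> k Dk; rewrite lee_fin ltW].
  by rewrite EFinD leeD // esum_geometric_le // ltW.
Qed.

End covers.

Section null_sets.
Variable R : realType.

Section boxes.
Variable n : nat.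
Implicit Types (A B : set 'rV[R]_n) (a b c : 'rV[R]_n).

Definition box a b : set 'rV[R]_n :=
  [set x | forall i, a ord0 i <= x ord0 i <= b ord0 i].

Definition is_box B (w : R) : Prop :=
  exists a b, [/\ forall i, a ord0 i <= b ord0 i, B = box a b &
    w = \prod_i (b ord0 i - a ord0 i)].

Definition is_cube (s0 : R) B (w : R) : Prop :=
  exists c s, [/\ 0 <= s, s <= s0, B = box c (c + const_mx s) & w = s ^+ n].

(** In the definition of null sets every index, used or not, carries a nonempty
box; the box reduced to 0 fills the gaps. *)
Lemma lebesgue_nullP A :
  lebesgue_null A <-> forall e, 0 < e -> covers is_box e A.
Proof.
split=> h e e0.
  have [D [a [b [ab AD De]]]] := h e e0.
  exists D, (fun k => box (a k) (b k)),
    (fun k => \prod_i (b k ord0 i - a k ord0 i)); split=> //.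
    by move=> k _; exists (a k), (b k).
  by move=> k _; apply: prodr_ge0 => i _; rewrite subr_ge0.
have [D [B [w [FB w0 AB we]]]] := h e e0.
have /choice[p hp] : forall k, exists p : 'rV[R]_n * 'rV[R]_n,
    (forall i, p.1 ord0 i <= p.2 ord0 i) /\
    (D k -> B k = box p.1 p.2 /\ w k = \prod_i (p.2 ord0 i - p.1 ord0 i)).
  move=> k; have [Dk|nDk] := pselect (D k); last by exists (0, 0).
  by have [a [b [ab e1 e2]]] := FB k Dk; exists (a, b).
exists D, (fun k => (p k).1), (fun k => (p k).2); split.
- by move=> k; have [] := hp k.
- move=> x /AB[k Dk Bx]; exists k => //.
  by have [_ /(_ Dk)[e1 _]] := hp k; rewrite e1 in Bx.
- apply: le_trans we; apply: le_esum => k Dk.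
  by have [_ /(_ Dk)[_ ->]] := hp k.
Qed.

Lemma null_set0 : lebesgue_null (set0 : set 'rV[R]_n).
Proof.
move=> e e0; exists set0, (fun=> 0), (fun=> 0); split=> //.
by rewrite esum_set0 lee_fin ltW.
Qed.

Lemma null_sub A A' : A' `<=` A -> lebesgue_null A -> lebesgue_null A'.
Proof.
move=> AA' /lebesgue_nullP nA; apply/lebesgue_nullP => e e0.
exact: covers_sub (lexx e) AA' (nA e e0).
Qed.

Lemma null_bigcup (D : set nat) (A : nat -> set 'rV[R]_n) :
  (forall k, D k -> lebesgue_null (A k)) ->
  lebesgue_null (\bigcup_(k in D) A k).
Proof.
move=> nA; apply/lebesgue_nullP => e e0.
pose d k : R := e / (2 ^ k.+1)%:R.
have d0 k : 0 < d k by rewrite divr_gt0 // ltr0n expn_gt0.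
apply: (covers_bigcup (v := d)).
- by move=> k /nA /lebesgue_nullP; apply.
- by move=> k _; exact: ltW.
- by rewrite esum_geometric_le // ltW.
Qed.

Lemma null_bigcup_count (I : countType) (A : I -> set 'rV[R]_n) :
  (forall k, lebesgue_null (A k)) -> lebesgue_null (\bigcup_k A k).
Proof.
move=> nA.
apply: (@null_sub (\bigcup_(k in setT)
    [set x | exists2 i, unpickle k = Some i & A i x])); last first.
  apply: null_bigcup => k _; case e : (unpickle k) => [i|].
    by apply: null_sub (nA i) => x [j []] <-.
  by apply: null_sub null_set0 => x [].
by move=> x [i _ Ax]; exists (pickle i) => //; exists i; rewrite ?pickleK.
Qed.

End boxes.
End null_sets.

Section row_norm.
Variables (R : realType) (n : nat).
Implicit Types x : 'rV[R]_n.

Lemma rV_normP x (s : R) : 0 <= s ->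
  `|x| <= s <-> forall i, `|x ord0 i| <= s.
Proof.
move=> s0; rewrite /Num.norm /= mx_normrE; split=> [h i|h].
  by apply: le_trans h; exact: (le_bigmax _ (fun ij => `|x ij.1 ij.2|) (ord0, i)).
by apply: bigmax_le => // -[i j] _ /=; rewrite (ord1 i); exact: h.
Qed.

Lemma rV_norm_ge x i : `|x ord0 i| <= `|x|.
Proof. by move: i; apply/(rV_normP x (normr_ge0 x)). Qed.

End row_norm.

Section null_sets.
Variable R : realType.

(** The left-hand side is a polynomial in s, hence continuous at s = 0. *)
Lemma prod_shift_le n (l : 'I_n -> R) (s0 e : R) : 0 < s0 -> 0 < e ->
  exists s, [/\ 0 < s, s <= s0 & \prod_i (l i + s) <= \prod_i l i + e].
Proof.
move=> s00 e0; pose p : {poly R} := \prod_i ((l i)%:P + 'X).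
have pE x : p.[x] = \prod_i (l i + x).
  by rewrite /p horner_prod; apply: eq_bigr => i _; rewrite !hornerE.
have := @continuous_horner _ p 0 => /cvgrPdist_lt/(_ _ e0)/nbhs_ballP[r /= r0 h].
exists (Num.min s0 (r / 2)); split.
- by rewrite lt_min s00 divr_gt0.
- by rewrite ge_min lexx.
- have /h : ball (0 : R) r (Num.min s0 (r / 2)).
    rewrite /ball /= sub0r normrN gtr0_norm ?lt_min ?s00 ?divr_gt0//.
    by rewrite gt_min ltr_pdivrMr // mulr_natr mulr2n ltrDl r0 orbT.
  rewrite /= !pE distrC ltr_norml => /andP[_]; rewrite ltrBlDl => /ltW.
  have -> // : \prod_i (l i + 0) = \prod_i l i.
  by apply: eq_bigr => i _; rewrite addr0.
Qed.

(** A thin box is not contained in a cube of comparable volume, so it is cut into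
cubes of one small side s; at most l / s + 1 of them fit along an edge of length
l, hence a total volume of at most the product of the l + s. *)
Lemma box_covers_cubes n (a b : 'rV[R]_n) (s0 e : R) :
  (forall i, a ord0 i <= b ord0 i) -> 0 < s0 -> 0 < e ->
  covers (is_cube s0) (\prod_i (b ord0 i - a ord0 i) + e) (box a b).
Proof.
move=> ab s00 e0; pose l i := b ord0 i - a ord0 i.
have [s [sp ss0 hs]] := prod_shift_le l s00 e0.
(* m i cubes along the i-th edge; N only bounds them to index by a finite type *)
pose m i := (Num.truncn (l i / s)).+1.
pose N := (\max_i m i).+1.
have mN i : (m i <= N)%N by rewrite /N ltnW// ltnS; exact: leq_bigmax.
pose Q i : pred 'I_N := fun j => (j < m i)%N.
pose c (f : {ffun 'I_n -> 'I_N}) := \row_i (a ord0 i + (f i)%:R * s).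
apply: covers_sub; last first.
- apply: (covers_seq (enum (family Q)) (w := fun=> s ^+ n)
    (B := fun f => box (c f) (c f + const_mx s))) => [f|f].
    by exists (c f), s; rewrite ltW.
  by rewrite exprn_ge0 // ltW.
- move=> x abx.
  have xa0 i : 0 <= (x ord0 i - a ord0 i) / s.
    by rewrite divr_ge0 ?subr_ge0 ?(ltW sp)//; have /andP[] := abx i.
  have fP i : (Num.truncn ((x ord0 i - a ord0 i) / s) < m i)%N.
    rewrite ltnS le_truncn// ler_pM2r ?invr_gt0// lerD2r.
    by have /andP[] := abx i.
  exists [ffun i => inord (Num.truncn ((x ord0 i - a ord0 i) / s))].
    rewrite mem_enum; apply/familyP => i; rewrite ffunE /Q unfold_in /=.
    by rewrite inordK ?fP// (leq_trans (fP i)).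
  move=> i; rewrite !mxE ffunE inordK ?(leq_trans (fP i))//.
  have /andP[h1 h2] := truncn_itv (xa0 i).
  rewrite -lerBrDl -ler_pdivlMr// h1 /=.
  by move: h2; rewrite ltr_pdivrMr// -natr1 => h2; lra.
- rewrite big_enum /= (_ : \sum_(f in family Q) s ^+ n =
    \sum_(f in family Q) \prod_(i < n) s); last first.
    by apply: eq_bigr => f _; rewrite prodr_const card_ord.
  rewrite -(bigA_distr_big_dep Q (fun _ _ => s)); apply: le_trans hs.
  apply: ler_prod => i _; rewrite sumr_ge0 => [/=|j _]; last exact: ltW.
  rewrite -(big_ord_widen N (fun=> s)) // sumr_const card_ord.
  rewrite /m -mulr_natl -natr1 mulrDl mul1r lerD2r -ler_pdivlMr//.
  by rewrite truncn_le// divr_ge0 ?(ltW sp)// subr_ge0.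
Qed.

Lemma covers1 (T : Type) (F : set T -> R -> Prop) w B :
  F B w -> 0 <= w -> covers F w B.
Proof.
move=> FB w0; exists [set 0%N], (fun=> B), (fun=> w); split=> //.
  by move=> x Bx; exists 0%N.
by rewrite esum_set1.
Qed.

Lemma esumZ_le (D : set nat) (w : nat -> R) (K v : R) : 0 <= K ->
  (\esum_(k in D) (w k)%:E <= v%:E)%E ->
  (\esum_(k in D) (K * w k)%:E <= (K * v)%:E)%E.
Proof.
move=> K0 wv; apply: ge_ereal_sup => _ [A [fA AD] <-].
rewrite fsbig_finite // sumEFin -mulr_sumr EFinM.
rewrite EFinM; apply: lee_wpmul2l; first by rewrite lee_fin.
apply: le_trans wv.
by apply: ereal_sup_ubound; exists A => //; rewrite fsbig_finite // sumEFin.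
Qed.

(** The Lipschitz constant C and the scale d may depend on the point. The points
for which both C and 1 / d are at most k + 1 belong to [E k]; these sets
are countably many, and on [E k] a cube of side below 1 / (k + 1) has its
image in a cube that is at most 2 (k + 1) times as large. *)
Lemma null_pointwise_lipschitz (T : Type) n (D : set T) (alpha beta : T -> 'rV[R]_n) :
  (forall t0, D t0 -> exists C d : R, 0 < d /\ forall t, D t ->
    `|alpha t - alpha t0| < d ->
    `|beta t - beta t0| <= C * `|alpha t - alpha t0|) ->
  lebesgue_null (alpha @` D) -> lebesgue_null (beta @` D).
Proof.
move=> lip /lebesgue_nullP nA.
pose E (k : nat) := [set t0 | D t0 /\ forall t, D t ->
  `|alpha t - alpha t0| < k.+1%:R^-1 ->
  `|beta t - beta t0| <= k.+1%:R * `|alpha t - alpha t0|].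
apply: (@null_sub _ _ (\bigcup_k (beta @` E k))).
  move=> _ [t0 Dt0 <-]; have [C [d [d0 h]]] := lip _ Dt0.
  pose k := maxn (Num.truncn C) (Num.truncn d^-1).
  exists k => //; exists t0 => //; split=> // t Dt atk.
  have kd : k.+1%:R^-1 <= d.
    rewrite invf_ple ?posrE// ltW// (lt_le_trans (truncnS_gt _))//.
    by rewrite ler_nat ltnS leq_maxr.
  apply: le_trans (h _ Dt (lt_le_trans atk kd)) _.
  rewrite ler_wpM2r // ltW// (lt_le_trans (truncnS_gt _))//.
  by rewrite ler_nat ltnS leq_maxl.
apply: null_bigcup => k _; apply/lebesgue_nullP => e e0.
pose K : R := k.+1%:R; have K0 : 0 < K by rewrite ltr0n.
pose V := (2 * K) ^+ n; have V0 : 0 < V by rewrite exprn_gt0// mulr_gt0.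
(* cubes of total volume 2 e' have images of total volume at most V * 2 e' *)
pose e' := e / V / 2; have e'0 : 0 < e' by rewrite !divr_gt0.
pose s0 := K^-1 / 2; have s00 : 0 < s0 by rewrite divr_gt0 // invr_gt0.
have [D' [B [w [FB w0 AB we]]]] : covers (is_cube s0) (e' + e') (alpha @` D).
  apply: (covers_comp (F := @is_box R n)) => //; last exact: nA.
  by move=> _ _ e1 [a [b [ab -> ->]]] e10; exact: box_covers_cubes.
apply: (@covers_sub _ _ _ e _
  (\bigcup_(j in D') (beta @` (E k `&` alpha @^-1` B j)))) => //.
  move=> _ [t Et <-]; have [j D'j Bj] := AB _ (imageP alpha Et.1).
  by exists j => //; exists t.
apply: (covers_bigcup (v := fun j => V * w j)).
- move=> j Dj; have [c [s [s1 ss0 -> ->]]] := FB j Dj.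
  set Z := E k `&` _.
  have [q hq] : exists q : 'rV[R]_n, forall t, Z t -> `|beta t - q| <= K * s.
    have [[t0 [Et0 Bt0]]|nZ] := pselect (Z !=set0); last first.
      by exists 0 => t Zt; case: nZ; exists t.
    exists (beta t0) => t [[Dt _] Bt].
    have ts : `|alpha t - alpha t0| <= s.
      apply/rV_normP => // i; rewrite !mxE.
      have := Bt i; have := Bt0 i; rewrite !mxE => /andP[x1 x2] /andP[y1 y2].
      rewrite ler_norml; lra.
    apply: le_trans (Et0.2 _ Dt _) _.
      apply: le_lt_trans ts _; apply: le_lt_trans ss0 _.
      by rewrite /s0 ltr_pdivrMr// mulr_natr mulr2n ltrDl invr_gt0.
    by rewrite ler_pM2l.
  have Ks0 : 0 <= K * s by rewrite mulr_ge0 // ltW.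
  apply: (@covers_sub _ _ _ (V * s ^+ n) _
    (box (q - const_mx (K * s)) (q + const_mx (K * s)))) => //.
    move=> _ [t Zt <-] i; rewrite !mxE.
    have /(rV_normP _ Ks0)/(_ i) := hq t Zt.
    by rewrite !mxE ler_distl.
  apply: covers1; last by rewrite mulr_ge0 ?(ltW V0)// exprn_ge0.
  exists (q - const_mx (K * s)), (q + const_mx (K * s)); split=> //.
    by move=> i; rewrite !mxE; lra.
  rewrite /V -exprMn.
  rewrite (eq_bigr (fun=> 2 * K * s)) => [|i _]; last by rewrite !mxE; ring.
  by rewrite prodr_const card_ord.
- by move=> j Dj; rewrite mulr_ge0 ?w0// ltW.
- apply: le_trans (esumZ_le (ltW V0) we) _; rewrite lee_fin /e'.
  by rewrite -splitr mulrC divfK// gt_eqF.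
Qed.

(** Balls with rational centre and radius 1 / (k + 1) form a countable basis. *)
Lemma null_local n (Z : set 'rV[R]_n) :
  (forall q, Z q -> exists2 d : R, 0 < d &
    lebesgue_null (Z `&` [set x | `|x - q| < d])) -> lebesgue_null Z.
Proof.
move=> loc.
pose b (p : 'rV[rat]_n * nat) :=
  [set x : 'rV[R]_n | `|x - map_mx (@ratr R) p.1| < p.2.+1%:R^-1].
pose good p := `[< lebesgue_null (Z `&` b p) >].
apply: (@null_sub _ _ (\bigcup_p (if good p then Z `&` b p else set0))); last first.
  apply: null_bigcup_count => p.
  by case: ifP => [/asboolP//|_]; exact: null_set0.
move=> q Zq; have [d d0 nd] := loc q Zq.
pose k := Num.truncn (2 / d).
have k0 : (0 : R) < k.+1%:R^-1 by rewrite invr_gt0 ltr0n.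
have kd : 2 * k.+1%:R^-1 < d.
  by rewrite ltr_pdivrMr ?ltr0n// mulrC -ltr_pdivrMr// truncnS_gt.
have /choice[r hr] : forall i, exists r : rat,
    ratr r \in `]q ord0 i - k.+1%:R^-1 / 2, q ord0 i + k.+1%:R^-1 / 2[%R.
  have gap (u v : R) : 0 < u -> v - u / 2 < v + u / 2 by lra.
  by move=> i; apply: rat_in_itvoo; exact: gap.
pose p := (\row_i r i, k).
have bq : b p q.
  apply: (@le_lt_trans _ _ (k.+1%:R^-1 / 2)); last by rewrite ltr_pdivrMr// mulr_natr mulr2n ltrDl.
  apply/rV_normP => [|i]; first by rewrite divr_ge0 // ltW.
  have near (u v w : R) : w - u / 2 < v < w + u / 2 -> `|w - v| <= u / 2.
    by move=> /andP[h1 h2]; rewrite ler_norml; lra.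
  by rewrite !mxE; apply: near; have := hr i; rewrite in_itv.
exists p => //; have -> : good p.
  apply/asboolP; apply: null_sub nd => x [Zx bx]; split=> //=.
  rewrite -(subrKA (map_mx (@ratr R) p.1)) (le_lt_trans (ler_normD _ _))//.
  apply: lt_trans kd; rewrite mulr_natl mulr2n ltrD// distrC; exact: bq.
by [].
Qed.

End null_sets.

(** * Levels and linearizations in sc-calculus *)

Section sc_levels.
Variables (R : realType) (E : scBanach R).
Implicit Types (x y : E) (m : nat).

Definition sc_norm m x : R := `|sc_at m x|.

Lemma sc_embK m (x : sc_space E m) : sc_at m (sc_emb E m x) = x.
Proof. by rewrite /sc_at; case: xgetP => [y -> /= /sc_emb_inj//|/(_ x) /(_ erefl)]. Qed.

Lemma sc_atK m x : sc_level E m x -> sc_emb E m (sc_at m x) = x.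
Proof. by move=> [y _ <-]; rewrite sc_embK. Qed.

Lemma sc_level_emb m (x : sc_space E m) : sc_level E m (sc_emb E m x).
Proof. by exists x. Qed.

Lemma sc_norm_emb m (x : sc_space E m) : sc_norm m (sc_emb E m x) = `|x|.
Proof. by rewrite /sc_norm sc_embK. Qed.

Lemma sc_level_linear m a x y :
  sc_level E m x -> sc_level E m y -> sc_level E m (a *: x + y).
Proof. by move=> [u _ <-] [v _ <-]; exists (a *: u + v); rewrite ?linearP. Qed.

Lemma sc_level0 m : sc_level E m 0.
Proof. by exists 0; rewrite ?linear0. Qed.

Lemma sc_levelZ m a x : sc_level E m x -> sc_level E m (a *: x).
Proof.
by move=> hx; rewrite -[_ *: _]addr0; apply: sc_level_linear (sc_level0 m).
Qed.

Lemma sc_levelD m x y :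
  sc_level E m x -> sc_level E m y -> sc_level E m (x + y).
Proof. by move=> hx hy; rewrite -[x]scale1r; exact: sc_level_linear. Qed.

Lemma sc_levelN m x : sc_level E m x -> sc_level E m (- x).
Proof. by rewrite -scaleN1r; exact: sc_levelZ. Qed.

Lemma sc_levelB m x y :
  sc_level E m x -> sc_level E m y -> sc_level E m (x - y).
Proof. by move=> hx hy; apply: sc_levelD => //; exact: sc_levelN. Qed.

Lemma sc_level_le m k x : (m <= k)%N -> sc_level E k x -> sc_level E m x.
Proof.
move=> /subnK <-; elim: (k - m)%N => // j IH.
by rewrite addSn => /(@sc_nested _ E) /IH.
Qed.

Lemma sc_at_linear m a x y : sc_level E m x -> sc_level E m y ->
  sc_at m (a *: x + y) = a *: sc_at m x + sc_at m y.
Proof. by move=> [u _ <-] [v _ <-]; rewrite -linearP !sc_embK. Qed.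

Lemma sc_atB m x y : sc_level E m x -> sc_level E m y ->
  sc_at m (x - y) = sc_at m x - sc_at m y.
Proof.
move=> hx hy; rewrite [x - y]addrC -scaleN1r sc_at_linear // scaleN1r.
by rewrite addrC.
Qed.

Lemma sc_norm_ge0 m x : 0 <= sc_norm m x. Proof. exact: normr_ge0. Qed.

Lemma sc_normr0 m : sc_norm m 0 = 0.
Proof. by rewrite -(linear0 (sc_emb E m)) sc_norm_emb normr0. Qed.

Lemma sc_normZ m a x : sc_level E m x -> sc_norm m (a *: x) = `|a| * sc_norm m x.
Proof. by move=> [u _ <-]; rewrite -linearZ !sc_norm_emb normrZ. Qed.

Lemma sc_normD m x y : sc_level E m x -> sc_level E m y ->
  sc_norm m (x + y) <= sc_norm m x + sc_norm m y.
Proof. by move=> [u _ <-] [v _ <-]; rewrite -linearD !sc_norm_emb ler_normD. Qed.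

Lemma sc_norm_eq0 m x : sc_level E m x -> sc_norm m x = 0 -> x = 0.
Proof.
by move=> [u _ <-]; rewrite sc_norm_emb => /normr0_eq0 ->; rewrite linear0.
Qed.

(** A precompact image of the unit ball is bounded. *)
Lemma sc_norm_incl m : exists2 C : R, 0 < C &
  forall x, sc_level E m.+1 x -> sc_norm m x <= C * sc_norm m.+1 x.
Proof.
have [K hK [cK _]] := @sc_compact _ E m.
have [r [_ hr]] := compact_bounded cK.
pose C := Num.max 1 (r + 1).
have C0 : 0 < C by rewrite lt_max ltr01.
have rC : r < C by rewrite lt_max ltrDl ltr01 orbT.
exists C => // _ [u _ <-].
have [->|u0] := eqVneq u 0; first by rewrite linear0 !sc_normr0 mulr0.
have hu : sc_level E m (sc_emb E m.+1 u).
  by apply: (sc_level_le (leqnSn m)); exact: sc_level_emb.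
have nu : 0 < `|u| by rewrite normr_gt0.
have /hK/(hr _ rC) : [set y : sc_space E m | exists2 x : sc_space E m.+1,
    `|x| <= 1 & sc_emb E m y = sc_emb E m.+1 x]
    (sc_at m (`|u|^-1 *: sc_emb E m.+1 u)).
  exists (`|u|^-1 *: u).
    by rewrite normrZ ger0_norm ?invr_ge0// mulVf ?gt_eqF.
  by rewrite sc_atK ?linearZ//; exact: sc_levelZ.
rewrite /= -/(sc_norm m _) sc_normZ // ger0_norm ?invr_ge0// sc_norm_emb.
by rewrite mulrC ler_pdivrMr.
Qed.

End sc_levels.

(** Makes the change of levels visible to rewriting. *)
Lemma sc_norm_shift (R : realType) (E : scBanach R) m (x : E) :
  sc_norm (E := sc_shift E) m x = sc_norm (E := E) m.+1 x.
Proof. reflexivity. Qed.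

Section sc_products.
Variables (R : realType) (E F : scBanach R).

Lemma sc_level_pair m (p : sc_prod E F) :
  sc_level (sc_prod E F) m p <-> sc_level E m p.1 /\ sc_level F m p.2.
Proof.
split=> [[[x y] _ <-]|[[x _ ex] [y _ ey]]]; first by split; eexists.
by exists (x, y) => //; case: p ex ey => a b /= <- <-.
Qed.

Lemma sc_at_pair m (p : sc_prod E F) : sc_level (sc_prod E F) m p ->
  sc_at m p = (sc_at m p.1, sc_at m p.2).
Proof. by move=> [[x y] _ <-]; rewrite sc_embK /= !sc_embK. Qed.

Lemma sc_norm_pair m (p : sc_prod E F) : sc_level (sc_prod E F) m p ->
  sc_norm m p = Num.max (sc_norm m p.1) (sc_norm m p.2).
Proof. by move=> hp; rewrite /sc_norm sc_at_pair // prod_normE. Qed.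

End sc_products.

Lemma sc_level_const (R : realType) n m (q : 'rV[R]_n) :
  sc_level (sc_const R n) m q.
Proof. by exists q. Qed.

Lemma sc_norm_const (R : realType) n m (q : 'rV[R]_n) :
  sc_norm (E := sc_const R n) m q = `|q|.
Proof. exact: (sc_norm_emb (E := sc_const R n) (m := m) q). Qed.

Section sc_derivatives.
Variable R : realType.

(** L is a Frechet derivative of f at x from level m+1 to level m, with L bounded
on level m. For m = 0 this is the linearization of sc-calculus ([sc_derivP]). *)
Definition sc_diff (E F : scBanach R) m (U : set E) (f : E -> F) (x : E)
    (L : E -> F) : Prop :=
  [/\ forall h, sc_level E m h -> sc_level F m (L h),
      forall a h k, sc_level E m h -> sc_level E m k ->
        L (a *: h + k) = a *: L h + L k,
      exists2 C : R, 0 <= C & forall h, sc_level E m h ->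
        sc_norm m (L h) <= C * sc_norm m h &
      forall e : R, 0 < e -> exists2 d : R, 0 < d & forall h,
        sc_level E m.+1 h -> sc_norm m.+1 h < d -> U (x + h) ->
        sc_norm m (f (x + h) - f x - L h) <= e * sc_norm m.+1 h].

Lemma bounded_linear0P (E F : scBanach R) (D : E -> F) :
  bounded_linear0 D <->
  [/\ forall h, sc_level E 0 h -> sc_level F 0 (D h),
      forall a h k, sc_level E 0 h -> sc_level E 0 k ->
        D (a *: h + k) = a *: D h + D k &
      exists2 C : R, 0 <= C & forall h, sc_level E 0 h ->
        sc_norm 0 (D h) <= C * sc_norm 0 h].
Proof.
split=> [[T [cT DT]]|[DE Dl [C C0 Db]]].
  split.
  - by move=> _ [h _ <-]; rewrite DT; exact: sc_level_emb.
  - by move=> a _ _ [h _ <-] [k _ <-]; rewrite -linearP !DT !linearP.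
  - have /linear_boundedP [r [_ hr]] :=
      @continuous_linear_bounded _ _ _ 0 T (cT 0).
    exists (Num.max 0 (r + 1)); first by rewrite le_max lexx.
    move=> _ [h _ <-]; rewrite DT !sc_norm_emb; apply: hr.
    by rewrite lt_max ltrDl ltr01 orbT.
pose T (h : sc_space E 0) : sc_space F 0 := sc_at 0 (D (sc_emb E 0 h)).
have Tl : linear T.
  move=> a h k; rewrite /T linearP Dl ?sc_at_linear //;
    do ?[apply: DE]; exact: sc_level_emb.
pose T' : {linear sc_space E 0 -> sc_space F 0} :=
  HB.pack T (GRing.isLinear.Build _ _ _ _ T Tl).
exists T'; split; last first.
  by move=> h; rewrite /= /T sc_atK //; apply: DE; exact: sc_level_emb.
apply: bounded_linear_continuous; apply/linear_boundedP.
exists C; split; first by rewrite ger0_real.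
move=> r Cr h; rewrite /= /T.
apply: le_trans (Db _ (sc_level_emb h)) _; rewrite sc_norm_emb.
by rewrite ler_wpM2r // ltW.
Qed.

Lemma sc_derivP (E F : scBanach R) (U : set E) (f : E -> F) (x : E)
    (D : E -> F) : sc_deriv U f x D <-> sc_diff 0 U f x D.
Proof.
split=> [[/bounded_linear0P[D1 D2 D3] lim]|[D1 D2 D3 lim]].
  split=> // e e0.
  move: lim => /cvgrPdist_lt/(_ e e0); rewrite near_withinE.
  rewrite /dnbhs near_withinE => /nbhs_ballP[d /= d0 hd].
  exists d => // _ [h _ <-]; rewrite sc_norm_emb => hd' Uh.
  have [->|h0] := eqVneq h 0.
    have D0 : D 0 = 0.
      have := D2 (-1) 0 0 (sc_level0 E 0) (sc_level0 E 0).
      by rewrite scaler0 addr0 scaleN1r addNr.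
    by rewrite linear0 addr0 D0 subrr subr0 sc_normr0 normr0 mulr0.
  have /hd/(_ h0 Uh) : ball (0 : sc_space E 1) d h.
    by rewrite -ball_normE /= sub0r normrN.
  rewrite sub0r normrN ger0_norm; last by apply: divr_ge0; exact: normr_ge0.
  by rewrite ltr_pdivrMr ?normr_gt0// => /ltW.
split; first exact/bounded_linear0P.
apply/cvgrPdist_le => e e0; rewrite near_withinE /dnbhs near_withinE.
have [d d0 hd] := lim e e0; apply/nbhs_ballP; exists d => //= h.
rewrite -ball_normE /= sub0r normrN => hd' h0 Uh.
rewrite sub0r normrN ger0_norm; last by apply: divr_ge0; exact: normr_ge0.
rewrite ler_pdivrMr ?normr_gt0//.
by rewrite -sc_norm_emb; apply: hd; rewrite ?sc_norm_emb//; exact: sc_level_emb.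
Qed.

(** Induction on m. The tangent map Tf is differentiable at (x, 0) from level m+1
to level m of the tangents, whose first components are the levels m+2 and m+1
of the original spaces; the first component of its derivative along (h, 0) is
the derivative of f along h. *)
Lemma sc_k_diff m (E F : scBanach R) (U : set E) (f : E -> F) (x : E) :
  sc_k m.+1 U f -> U x -> sc_level E m.+1 x -> exists L, sc_diff m U f x L.
Proof.
elim: m E F U f x => [|m IH] E F U f x.
  move=> [_ [Df [hD _]]] Ux x1; exists (Df x); apply/sc_derivP; exact: hD.
move=> [f0 [Df [hD hT]]] Ux x1.
have lE k h : sc_level E k.+1 h ->
    sc_level (sc_tangent E) k ((h, 0) : E * E).
  by move=> hh; apply/sc_level_pair; split=> //; exact: sc_level0.
have nE k h : sc_level E k.+1 h ->
    sc_norm (E := sc_tangent E) k ((h, 0) : E * E) = sc_norm k.+1 h.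
  move=> hh; rewrite sc_norm_pair; last exact: lE.
  rewrite sc_normr0; apply/max_idPl; exact: normr_ge0.
have Tx : tangent_dom U ((x, 0) : E * E).
  split=> //=; last exact: sc_level0.
  by apply: sc_level_le x1.
have [L [L1 L2 [C C0 L3] L4]] := IH _ _ _ _ _ hT Tx (lE _ _ x1).
have F1 (p : sc_tangent F) k : sc_level (sc_tangent F) k p ->
    sc_level F k.+1 p.1 /\ sc_norm (E := F) k.+1 p.1 <= sc_norm k p.
  move=> hp; have [h1 h2] := proj1 (sc_level_pair _ _) hp.
  split; first exact: h1.
  by rewrite sc_norm_pair // le_max; rewrite sc_norm_shift lexx.
exists (fun h => (L (h, 0)).1); split.
- by move=> h hh; have [] := F1 _ _ (L1 _ (lE _ _ hh)).
- move=> a h k hh hk.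
  rewrite (_ : (a *: h + k, 0) = a *: (h, 0) + (k, 0) :> E * E); last first.
    by congr pair; rewrite /= scaler0 addr0.
  by rewrite L2 //; exact: lE.
- exists C => // h hh; have [_ b] := F1 _ _ (L1 _ (lE _ _ hh)).
  by apply: le_trans b _; rewrite -nE //; exact/L3/lE.
- move=> e e0; have [d d0 hd] := L4 e e0; exists d => // h hh hhd Uh.
  have x1' : sc_level E 1 x by exact: sc_level_le x1.
  have xh1 : sc_level E m.+2 (x + h) by exact: sc_levelD.
  have Txh : tangent_dom U ((x, 0) + (h, 0) : E * E).
    split=> //=; first by apply: sc_level_le xh1.
    by rewrite addr0; exact: sc_level0.
  have := hd _ (lE _ _ hh); rewrite nE // => /(_ hhd Txh).
  apply: le_trans.
  set p := (X in sc_norm m X).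
  have [] := F1 p m; last by move=> _; apply.
  rewrite /p; apply: sc_levelB; last by apply: L1; apply: lE; apply: sc_level_le hh.
  have [hT0 _] := hT.
  apply: sc_levelB; apply: (proj1 (hT0 m)) => //.
    rewrite (_ : (x, 0) + (h, 0) = (x + h, 0) :> E * E).
      by apply: lE; apply: sc_level_le xh1.
    by congr pair; rewrite /= addr0.
  by apply: lE; apply: sc_level_le x1.
Qed.

Lemma sc_diff_lipschitz (E F : scBanach R) m (U : set E) (f : E -> F) (x : E) L :
  sc0 U f -> U x -> sc_level E m.+1 x -> sc_diff m U f x L ->
  exists C d : R, 0 < d /\ forall y, sc_level E m.+1 y -> U y ->
    sc_norm m.+1 (y - x) < d ->
    sc_norm m (f y - f x) <= C * sc_norm m.+1 (y - x).
Proof.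
move=> f0 Ux x1 [L1 L2 [C C0 L3] L4].
have [K K0 hK] := sc_norm_incl E m.
have [d d0 hd] := L4 1 ltr01.
exists (1 + C * K), d; split=> // y y1 Uy yx.
have h1 : sc_level E m.+1 (y - x) by exact: sc_levelB.
have h0 : sc_level E m (y - x) by exact: sc_level_le h1.
have fl z : U z -> sc_level E m.+1 z -> sc_level F m (f z).
  by move=> Uz z1; apply: (proj1 (f0 m)) => //; apply: sc_level_le z1.
have := hd _ h1 yx; rewrite subrKC => /(_ Uy) hy.
rewrite -(subrK (L (y - x)) (f y - f x)).
apply: le_trans (sc_normD _ _) _.
- by apply: sc_levelB; [apply: sc_levelB; exact: fl|exact: L1].
- exact: L1.
rewrite mulrDl lerD// -mulrA.
apply: le_trans (L3 _ h0) _; rewrite ler_wpM2l//; exact: hK.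
Qed.

Lemma sc0_comp_linear (E' E F : scBanach R) (T : E' -> E) (V : set E')
    (U : set E) (f : E -> F) :
  linear T ->
  (forall m, exists2 C : R, 0 < C & forall h, sc_level E' m h ->
    sc_level E m (T h) /\ sc_norm m (T h) <= C * sc_norm m h) ->
  (forall q, V q -> U (T q)) ->
  sc0 U f -> sc0 V (f \o T).
Proof.
move=> Tl Tb VU f0 m; have [fl fc] := f0 m; have [C C0 hC] := Tb m; split.
  by move=> x Vx x1; apply: fl; [exact: VU|have [] := hC _ x1].
apply/subspace_continuousP => x /= Vx.
have [lx _] := hC _ (sc_level_emb x).
move: fc => /subspace_continuousP/(_ (sc_at m (T (sc_emb E' m x)))).
rewrite /= sc_atK // => /(_ (VU _ Vx)) fc.
apply/cvgrPdist_lt => e e0; move: fc => /cvgrPdist_lt/(_ e e0).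
rewrite !near_withinE => /nbhs_ballP[d /= d0 hd].
apply/nbhs_ballP; exists (d / C) => [|y]; rewrite /= ?divr_gt0 //.
rewrite -ball_normE /= => xy Vy; have [ly _] := hC _ (sc_level_emb y).
have := hd (sc_at m (T (sc_emb E' m y))).
rewrite /from_subspace /sc_map /= !sc_atK //; apply; last exact: VU.
rewrite -ball_normE /= -sc_atB//.
have Tsub u v : T u - T v = T (u - v).
  by rewrite [in RHS]addrC -[in RHS]scaleN1r Tl scaleN1r addrC.
rewrite Tsub -linearB; have [_] := hC _ (sc_level_emb (x - y)).
rewrite -/(sc_norm _ _) => /le_lt_trans; apply.
by rewrite sc_norm_emb mulrC -ltr_pdivlMr.
Qed.

(** A chain rule that needs no loss of level, because T is bounded on each level.
For the induction, T x T is again such a map between the tangents. *)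
Lemma sc_k_comp_linear k (E' E F : scBanach R) (T : E' -> E) (V : set E')
    (U : set E) (f : E -> F) :
  linear T ->
  (forall m, exists2 C : R, 0 < C & forall h, sc_level E' m h ->
    sc_level E m (T h) /\ sc_norm m (T h) <= C * sc_norm m h) ->
  (forall q, V q -> U (T q)) ->
  sc_k k U f -> sc_k k V (f \o T).
Proof.
elim: k E' E F T V U f => [|k IH] E' E F T V U f Tl Tb VU.
  by move=> [f0 _]; split=> //; exact: sc0_comp_linear f0.
move=> [f0 [Df [hD hT]]]; split; first exact: sc0_comp_linear f0.
exists (fun x h => Df (T x) (T h)); split.
  move=> x Vx x1; have [C1 C10 h1] := Tb 1%N; have [C2 C20 h2] := Tb 0%N.
  have /sc_derivP[D1 D2 [C C0 D3] D4] := hD _ (VU _ Vx) (proj1 (h1 _ x1)).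
  apply/sc_derivP; split.
  - by move=> h /h2[+ _]; exact: D1.
  - by move=> a u v /h2[hu _] /h2[hv _]; rewrite Tl D2.
  - exists (C * C2); first by rewrite mulr_ge0 // ltW.
    move=> h hh; have [hh' b] := h2 _ hh.
    by apply: le_trans (D3 _ hh') _; rewrite -mulrA ler_wpM2l.
  - move=> e e0; have [d d0 hd] := D4 (e / C1) (divr_gt0 e0 C10).
    exists (d / C1); first exact: divr_gt0.
    move=> h hh hhd Vxh; have [hh' b] := h1 _ hh.
    have Txh : T (x + h) = T x + T h by rewrite -[x]scale1r Tl !scale1r.
    rewrite /= Txh; apply: le_trans (hd _ hh' _ _) _.
    + by apply: le_lt_trans b _; rewrite mulrC -ltr_pdivlMr.
    + by rewrite -Txh; exact: VU.
    + by rewrite -mulrA ler_wpM2l ?(ltW e0)// mulrC ler_pdivrMr// mulrC.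
pose TT (p : sc_tangent E') : sc_tangent E := (T p.1, T p.2).
apply: (IH _ _ _ TT _ (tangent_dom U) _ _ _ _ hT).
- by move=> a u v; rewrite /TT /= !Tl.
- move=> m; have [C1 C10 h1] := Tb m.+1; have [C2 C20 h2] := Tb m.
  exists (C1 + C2); first exact: addr_gt0.
  move=> p hp; have [hp1 hp2] := proj1 (sc_level_pair _ _) hp.
  have [l1 n1] := h1 _ hp1; have [l2 n2] := h2 _ hp2.
  have lp : sc_level (sc_tangent E) m (TT p) by apply/sc_level_pair.
  split=> //; rewrite !sc_norm_pair //= ge_max; apply/andP; split.
    apply: le_trans n1 _; apply: ler_pM; rewrite ?(ltW C10) ?sc_norm_ge0 //.
      by rewrite lerDl ltW.
    by rewrite le_max lexx.
  apply: le_trans n2 _; apply: ler_pM; rewrite ?(ltW C20) ?sc_norm_ge0 //.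
    by rewrite lerDr ltW.
  by rewrite le_max lexx orbT.
- move=> p [Vp p1 p2]; have [C1 C10 h1] := Tb 1%N; have [C2 C20 h2] := Tb 0%N.
  by split; [exact: VU|have [] := h1 _ p1|have [] := h2 _ p2].
Qed.

End sc_derivatives.

(** * Directions in quadrants and splicing cores *)

Section linear_bounds.
Variable R : realType.

Lemma sc0_linear_bound (E F : scBanach R) (T : {linear E -> F}) m :
  sc0 setT T -> exists2 C : R, 0 < C & forall h, sc_level E m h ->
    sc_level F m (T h) /\ sc_norm m (T h) <= C * sc_norm m h.
Proof.
move=> /(_ m)[Tl Tc].
have Tl' h : sc_level E m h -> sc_level F m (T h) by exact: Tl.
pose t (h : sc_space E m) : sc_space F m := sc_at m (T (sc_emb E m h)).
have tl : linear t.
  move=> a h k; rewrite /t !linearP sc_at_linear //;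
    by apply: Tl'; exact: sc_level_emb.
pose t' : {linear sc_space E m -> sc_space F m} :=
  HB.pack t (GRing.isLinear.Build _ _ _ _ t tl).
have ct : {for 0, continuous t'}.
  move: Tc => /subspace_continuousP/(_ 0 I).
  by rewrite preimage_setT withinET.
have /linear_boundedP [r [_ hr]] := @continuous_linear_bounded _ _ _ 0 t' ct.
exists (Num.max 1 (r + 1)); first by rewrite lt_max ltr01.
move=> _ [h _ <-]; split; first by apply: Tl'; exact: sc_level_emb.
rewrite sc_norm_emb; apply: hr.
by rewrite lt_max ltrDl ltr01 orbT.
Qed.

Lemma rel_open_ball (E : scBanach R) (C V : set E) p :
  C `<=` sc_level E 0 -> sc_rel_open C V -> V p ->
  exists2 d : R, 0 < d & forall q, C q -> sc_norm 0 (q - p) < d -> V q.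
Proof.
move=> C0 [V' oV' ->] [Cp [p0 Vp0 ep]].
have [d /= d0 hd] : nbhs_ball p0 V'.
  by rewrite nbhs_ballE; exact: open_nbhs_nbhs.
exists d => // q Cq qp; split=> //; exists (sc_at 0 q).
  apply: hd; rewrite -ball_normE /= distrC.
  by rewrite -(sc_embK p0) ep -sc_atB //; exact: C0.
by rewrite sc_atK //; exact: C0.
Qed.

Lemma near_mul_lt (c d : R) : 0 < d -> \forall t \near (0 : R)^'+, t * c < d.
Proof.
move=> d0; near=> t.
have t0 : 0 < t by near: t; exact: nbhs_right_gt.
apply: (@le_lt_trans _ _ (t * (`|c| + 1))).
  by rewrite ler_pM2l // (le_trans (ler_norm c)) // lerDl.
rewrite -ltr_pdivlMr; last by rewrite ltr_wpDl.
by near: t; apply: nbhs_right_lt; rewrite divr_gt0 // ltr_wpDl.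
Unshelve. all: end_near. Qed.

Lemma sc_diff_direction (E F : scBanach R) m (U : set E) (f : E -> F) x L h :
  sc_diff m U f x L -> sc_level E m.+1 h ->
  (\forall t \near (0 : R)^'+, U (x + t *: h)) ->
  forall e : R, 0 < e -> \forall t \near (0 : R)^'+,
    sc_norm m (f (x + t *: h) - f x - t *: L h) <= e * t.
Proof.
move=> [L1 L2 L3 L4] hh Uh e e0.
pose N := sc_norm m.+1 h + 1.
have N0 : 0 < N by rewrite ltr_wpDl // sc_norm_ge0.
have [d d0 hd] := L4 (e / N) (divr_gt0 e0 N0).
have hm : sc_level E m h by exact: sc_level_le hh.
have LZ t : L (t *: h) = t *: L h.
  have L0 : L 0 = 0.
    have := L2 (-1) 0 0 (sc_level0 E m) (sc_level0 E m).
    by rewrite scaler0 addr0 scaleN1r addNr.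
  by have := L2 t h 0 hm (sc_level0 E m); rewrite !addr0 L0 addr0.
near=> t.
have t0 : 0 < t by near: t; exact: nbhs_right_gt.
rewrite -LZ; apply: le_trans (hd _ _ _ _) _.
- exact: sc_levelZ.
- rewrite sc_normZ // gtr0_norm //.
  by near: t; exact: near_mul_lt.
- by near: t.
- rewrite sc_normZ // gtr0_norm // mulrCA mulrC ler_pM2r //.
  by rewrite -mulrA ler_piMr ?(ltW e0)// mulrC ler_pdivrMr// mul1r lerDl.
Unshelve. all: end_near. Qed.

End linear_bounds.

Section quadrants.
Variables (R : realType) (W : scBanach R) (C : quadrant W).

Lemma qd_coord_linear i a v w :
  qd_coord (C := C) i (a *: v + w) =
    a * qd_coord (C := C) i v + qd_coord (C := C) i w.
Proof. by rewrite /qd_coord linearP /= !mxE. Qed.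

Lemma qd_coord_bound : exists2 K : R, 0 < K & forall i w, sc_level W 0 w ->
  `|qd_coord (C := C) i w| <= K * sc_norm 0 w.
Proof.
have [K K0 hK] := sc0_linear_bound 0 (@qd_iso_sc0 _ _ C).
exists K => // i w w0; have [l b] := hK _ w0; apply: le_trans b.
rewrite sc_norm_pair // le_max sc_norm_const; apply/orP; left.
exact: rV_norm_ge.
Qed.

(** The isomorphism with [0,oo)^l (+) Q and its inverse preserve all levels, and
every vector of R^l is smooth. *)
Lemma qd_section (a : 'I_(qd_dim C) -> R) : exists2 w, sc_infty W w &
  forall j, qd_coord (C := C) j w = a j.
Proof.
pose y : sc_prod (sc_const R (qd_dim C)) (qd_rest C) := (\row_j a j, 0).
have yl m : sc_level (sc_prod (sc_const R (qd_dim C)) (qd_rest C)) m y.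
  by apply/sc_level_pair; split; [exact: sc_level_const|exact: sc_level0].
exists (qd_inv C y).
  by move=> m _; have [h _] := @qd_inv_sc0 _ _ C m; apply: h.
by move=> j; rewrite /qd_coord qd_invK //= mxE.
Qed.

End quadrants.

Section cores.
Variable R : realType.
Implicit Types S : splicing R.

Lemma sp_V_quadrant S v : sp_V S v -> qd_set (sp_quad S) v.
Proof. by have [V' _ ->] := @sp_V_open _ S; case. Qed.

Lemma sp_dom_level0 S p : sp_dom S p -> sc_level (sp_space S) 0 p.
Proof. by move=> [/sp_V_quadrant[h _] e0]; apply/sc_level_pair. Qed.

Lemma sp_core_level0 S : sp_core S `<=` sc_level (sp_space S) 0.
Proof. by move=> p [/sp_dom_level0]. Qed.

Lemma sp_retr_core S p : sp_core S p -> sp_retr S p = p.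
Proof. by case: p => v e [_ /= h]; rewrite /sp_retr /= h. Qed.

Lemma sp_retr_in_core S p : sp_dom S p -> sp_core S (sp_retr S p).
Proof.
case: p => v e [/= Vv e0]; split; last exact: sp_proj_idem.
split=> //=; have [/(_ 0%N)[h _] _] := @sp_proj_smooth _ S 0%N.
apply: h => //; apply/sc_level_pair; split=> //.
by have [] := sp_V_quadrant Vv.
Qed.

Lemma core_dom S (O : set (sp_space S)) p : O `<=` sp_core S -> O p ->
  (sp_dom S `&` sp_retr S @^-1` O) p.
Proof.
by move=> Oc Op; split; [case: (Oc _ Op)|rewrite /= sp_retr_core//; exact: Oc].
Qed.

Lemma core_smooth_level S (F : scBanach R) (O : set (sp_space S)) f p m :
  core_smooth (F := F) O f -> O `<=` sp_core S -> O p ->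
  sc_level (sp_space S) m p -> sc_level F m (f p).
Proof.
move=> /(_ 0%N)[/(_ m)[h _] _] Oc Op pm.
rewrite -[p]sp_retr_core; last exact: Oc.
by apply: h => //; exact: core_dom.
Qed.

Lemma core_smooth_lipschitz S (F : scBanach R) (O : set (sp_space S)) f p m :
  core_smooth (F := F) O f -> O `<=` sp_core S -> O p ->
  sc_level (sp_space S) m.+1 p ->
  exists C d : R, 0 < d /\ forall q, sc_level (sp_space S) m.+1 q -> O q ->
    sc_norm m.+1 (q - p) < d ->
    sc_norm m (f q - f p) <= C * sc_norm m.+1 (q - p).
Proof.
move=> fs Oc Op pm.
have [L hL] := sc_k_diff (fs m.+1) (core_dom Oc Op) pm.
have [f0 _] := fs 0%N.
have [C [d [d0 hd]]] := sc_diff_lipschitz f0 (core_dom Oc Op) pm hL.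
exists C, d; split=> // q qm Oq qp.
have := hd q qm (core_dom Oc Oq) qp.
by rewrite /= !sp_retr_core //; exact: Oc.
Qed.

(** If a ray from p enters the quadrant, its retraction stays in the open subset O
of the splicing core for small times: the retraction is Lipschitz at p from
level 1 to level 0. *)
Lemma core_direction S (O : set (sp_space S)) p h :
  O `<=` sp_core S -> sc_rel_open (sp_core S) O -> O p ->
  sc_level (sp_space S) 1 p -> sc_level (sp_space S) 1 h ->
  (\forall t \near (0 : R)^'+, qd_set (sp_quad S) (p.1 + t *: h.1)) ->
  \forall t \near (0 : R)^'+, (sp_dom S `&` sp_retr S @^-1` O) (p + t *: h).
Proof.
move=> Oc Oo Op p1 h1 hq.
have [Dp pip] := Oc _ Op.
have [h11 h12] := proj1 (sc_level_pair _ _) h1.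
have h110 : sc_level (sp_W S) 0 h.1 by exact: sc_level_le h11.
have h120 : sc_level (sp_E S) 0 h.2 by exact: sc_level_le h12.
have [d1 d10 hd1] : exists2 d : R, 0 < d & forall v, qd_set (sp_quad S) v ->
    sc_norm 0 (v - p.1) < d -> sp_V S v.
  by apply: rel_open_ball (@sp_V_open _ S) (proj1 Dp) => v [].
have [d2 d20 hd2] := rel_open_ball (@sp_core_level0 S) Oo Op.
have ps := @sp_proj_smooth _ S.
have [L hL] := sc_k_diff (ps 1%N) Dp p1.
have [p0 _] := ps 0%N.
have [C [d3 [d30 hd3]]] := sc_diff_lipschitz p0 Dp p1 hL.
near=> t.
have t0 : 0 < t by near: t; exact: nbhs_right_gt.
have th1 : sc_level (sp_space S) 1 (t *: h) by exact: sc_levelZ.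
have Dpt : sp_dom S (p + t *: h).
  split; last first.
    apply: sc_levelD; first exact: (proj2 Dp).
    exact: sc_levelZ.
  apply: hd1; first by near: t.
  rewrite /= addrC addKr sc_normZ // gtr0_norm //.
  by near: t; exact: near_mul_lt.
split=> //=; apply: hd2; first exact: sp_retr_in_core.
have Dpt' := sp_retr_in_core Dpt; have := sp_core_level0 Dpt' => l0.
rewrite sc_norm_pair; last first.
  by apply: sc_levelB => //; exact: sp_core_level0 (Oc _ Op).
rewrite /= gt_max; apply/andP; split.
  rewrite addrC addKr sc_normZ // gtr0_norm //.
  by near: t; exact: near_mul_lt.
rewrite -pip; apply: le_lt_trans (hd3 (p + t *: h) _ _ _) _.
- exact: sc_levelD.
- exact: Dpt.
- rewrite addrC addKr sc_normZ // gtr0_norm //.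
  by near: t; exact: near_mul_lt.
- rewrite addrC addKr sc_normZ // gtr0_norm // mulrCA.
  by near: t; exact: near_mul_lt.
Unshelve. all: end_near. Qed.

End cores.

(** * Recognition of interior points *)

Section corner_recognition.
Variables (R : realType) (S S' : splicing R).
Variables (O : set (sp_space S)) (O' : set (sp_space S')).
Variables (f : sp_space S -> sp_space S') (g : sp_space S' -> sp_space S).
Hypothesis Oc : O `<=` sp_core S.
Hypothesis Oc' : O' `<=` sp_core S'.
Hypothesis Oo : sc_rel_open (sp_core S) O.
Hypothesis Oo' : sc_rel_open (sp_core S') O'.
Hypothesis fs : core_smooth O f.
Hypothesis gs : core_smooth O' g.
Hypothesis fO : forall x, O x -> O' (f x).
Hypothesis gO : forall y, O' y -> O (g y).
Hypothesis fK : forall x, O x -> g (f x) = x.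
Hypothesis gK : forall y, O' y -> f (g y) = y.

(** Suppose that the j-th coordinate lam vanishes at p' = f p. The ray from p' on
which lam = t pulls back under g to a curve from p with some velocity k on
level 1. As p is interior, the ray with velocity - k is also available, and f
maps it to a curve along which lam decreases from 0, although lam >= 0 on O'. *)
Lemma corner_recognition p : O p -> sc_infty (sp_space S) p ->
  (forall i, 0 < qd_coord (C := sp_quad S) i p.1) ->
  forall j, 0 < qd_coord (C := sp_quad S') j (f p).1.
Proof.
move=> Op pinf ppos j.
pose p' := f p; pose lam (y : sp_space S') := qd_coord (C := sp_quad S') j y.1.
have Op' : O' p' by exact: fO.
have p'inf m : sc_level (sp_space S') m p' by apply: core_smooth_level fs Oc Op (pinf m I).
have quad' y : O' y -> qd_set (sp_quad S') y.1.
  by move=> /Oc'[[/sp_V_quadrant]].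
have [p'0 p'pos] := quad' _ Op'.
rewrite lt_neqAle p'pos andbT; apply/eqP => /esym lam0.
have [K K0 hK] := qd_coord_bound (sp_quad S').
have lamL a u v : lam (a *: u + v) = a * lam u + lam v.
  by rewrite /lam /= qd_coord_linear.
have lamB y : sc_level (sp_space S') 0 y -> `|lam y| <= K * sc_norm 0 y.
  move=> y0; have [y1 _] := proj1 (sc_level_pair _ _) y0.
  apply: le_trans (hK j _ y1) _; rewrite ler_pM2l // sc_norm_pair //.
  by rewrite le_max lexx.
have [w winf hw] := @qd_section _ _ (sp_quad S') (fun i => (j == i)%:R).
pose h : sp_space S' := (w, 0).
have hinf m : sc_level (sp_space S') m h.
  by apply/sc_level_pair; split; [exact: winf|exact: sc_level0].
have near0 : \forall t \near (0 : R)^'+, 0 < t by exact: nbhs_right_gt.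
(* The curve t |-> r' (p' + t h) stays in O' and has j-th coordinate t. *)
have Dg : \forall t \near (0 : R)^'+,
    (sp_dom S' `&` sp_retr S' @^-1` O') (p' + t *: h).
  apply: core_direction => //; near=> t.
  have t0 : 0 < t by near: t.
  split; first by apply: sc_levelD => //; apply: sc_levelZ; exact: (winf 0%N).
  move=> i; rewrite addrC qd_coord_linear addr_ge0 //.
  by rewrite mulr_ge0 ?(ltW t0) //= hw ler0n.
have [L hL] := sc_k_diff (gs 2) (core_dom Oc' Op') (p'inf 2).
have [L1 _ _ _] := hL.
pose k := L h.
have k1 : sc_level (sp_space S) 1 k by exact: L1.
have gp' : (g \o sp_retr S') p' = p.
  by rewrite /= sp_retr_core ?fK //; exact: Oc'.
have gdir := sc_diff_direction hL (hinf 2) Dg.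
have p1 := pinf 1%N I.
have [L' hL'] := sc_k_diff (fs 1) (core_dom Oc Op) p1.
have [M1 M2 [C C0 M3] M4] := hL'.
have [N N0 hN] := sc_norm_incl (sp_space S) 0.
have k0 : sc_level (sp_space S) 0 k by exact: sc_level_le k1.
have fp : (f \o sp_retr S) p = p'.
  by rewrite /= sp_retr_core //; exact: Oc.
(* Pulled back by g the curve is p + t k + o(t) on level 1, which f maps back
   to the curve. Up to error terms of at most t / 2 this gives
   t = t * lam (L' k). *)
have Lk : 1 / 2 <= lam (L' k).
  pose B := sc_norm 1 k + 1.
  have B0 : 0 < B by rewrite ltr_wpDl // sc_norm_ge0.
  (* e1 and e2 make both error terms at most t / 4 after applying lam *)
  pose e1 := (4 * K * B)^-1.
  have e10 : 0 < e1 by rewrite invr_gt0 !mulr_gt0.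
  have [d d0 hd] := M4 e1 e10.
  pose e2 := Num.min 1 (4 * K * (C + 1) * N)^-1.
  have e20 : 0 < e2.
    by rewrite lt_min ltr01 invr_gt0 !mulr_gt0 // ltr_wpDl.
  have [t [t0 [Dt [gt tB]]]] : exists t, 0 < t /\
      (sp_dom S' `&` sp_retr S' @^-1` O') (p' + t *: h) /\
      sc_norm 1 ((g \o sp_retr S') (p' + t *: h) - p - t *: k) <= e2 * t /\
      t * B < d.
    have := gdir e2 e20; rewrite gp' => gdir2.
    apply: (@filter_ex _ ((0 : R)^'+)); near=> t.
    split; first by near: t.
    split; first by near: t.
    by split; near: t => //; exact: near_mul_lt.
  set y := sp_retr S' (p' + t *: h) in gt.
  have Oy : O' y by case: Dt.
  have lamy : lam y = t.
    rewrite /lam /y /= addrC qd_coord_linear hw eqxx mulr1.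
    by rewrite /p' lam0 addr0.
  pose u := g y; have Ou : O u by exact: gO.
  have lpth m : sc_level (sp_space S') m (p' + t *: h).
    by apply: sc_levelD => //; exact: sc_levelZ.
  have u1 : sc_level (sp_space S) 1 u.
    by have [/(_ 1%N)[+ _] _] := gs 0%N; exact.
  pose r := u - p - t *: k.
  have up1 : sc_level (sp_space S) 1 (u - p) by exact: sc_levelB.
  have r1 : sc_level (sp_space S) 1 r.
    by apply: sc_levelB => //; exact: sc_levelZ.
  have r0 : sc_level (sp_space S) 0 r by exact: sc_level_le r1.
  have rt : sc_norm 1 r <= e2 * t by exact: gt.
  have upE : u - p = t *: k + r by rewrite /r [RHS]addrC subrK.
  have upt : sc_norm 1 (u - p) <= t * B.
    rewrite upE; apply: le_trans (sc_normD _ _) _ => //; first exact: sc_levelZ.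
    rewrite sc_normZ // gtr0_norm // /B mulrDr mulr1 lerD2l.
    apply: le_trans rt _; rewrite ler_piMl ?(ltW t0)//.
    by rewrite ge_min lexx.
  have := hd _ up1 (le_lt_trans upt tB); rewrite subrKC => /(_ (core_dom Oc Ou)).
  rewrite fp /= sp_retr_core; last exact: Oc.
  rewrite gK // => hfy.
  have L'up0 : sc_level (sp_space S') 0 (L' (u - p)).
    by apply: M1; exact: sc_level_le up1.
  have y0 : sc_level (sp_space S') 0 y by apply: sp_core_level0; exact: Oc'.
  have lamE u1' u2' : lam (u1' - u2') = lam u1' - lam u2'.
    by rewrite addrC -scaleN1r lamL mulN1r addrC.
  have p'00 : lam p' = 0 by exact: lam0.
  have h1 : `|t - lam (L' (u - p))| <= t / 4.
    have := lamB (y - p' - L' (u - p)).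
    rewrite !lamE lamy p'00 subr0 => /(_ _)/le_trans; apply.
      by apply: sc_levelB => //; apply: sc_levelB.
    apply: (@le_trans _ _ (K * (e1 * (t * B)))).
      rewrite ler_pM2l//; apply: le_trans hfy _.
      by rewrite ler_pM2l.
    rewrite /e1 le_eqVlt; apply/orP; left; apply/eqP; field.
    by rewrite !gt_eqF.
  have h2 : `|lam (L' r)| <= t / 4.
    apply: le_trans (lamB _ (M1 _ r0)) _.
    apply: (@le_trans _ _ (K * (C + 1) * N * (e2 * t))).
      rewrite -!mulrA ler_pM2l//; apply: le_trans (M3 _ r0) _.
      apply: ler_pM => //; first exact: sc_norm_ge0.
        by rewrite lerDl.
      by apply: le_trans (hN _ r1) _; rewrite ler_pM2l.
    have e2b : e2 <= (4 * K * (C + 1) * N)^-1 by rewrite ge_min lexx orbT.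
    have CC : 0 < C + 1 by rewrite ltr_wpDl.
    apply: (@le_trans _ _ (K * (C + 1) * N * ((4 * K * (C + 1) * N)^-1 * t))).
      by rewrite ler_pM2l ?mulr_gt0// ler_pM2r.
    rewrite le_eqVlt; apply/orP; left; apply/eqP; field.
    by rewrite !gt_eqF.
  have h3 : lam (L' (u - p)) = t * lam (L' k) + lam (L' r).
    by rewrite upE M2 // lamL.
  rewrite -(ler_pM2l t0).
  move: h1 h2; rewrite h3 !ler_norml => /andP[h11 h12] /andP[h21 h22]; lra.
(* Backwards, t |-> r (p - t k) is a curve in O because p is interior; its
   image under f lies in O', but lam of it is at most - t / 4. *)
have k01 := proj1 (sc_level_pair _ _) k0.
have De : \forall t \near (0 : R)^'+,
    (sp_dom S `&` sp_retr S @^-1` O) (p + t *: - k).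
  apply: core_direction => //; first exact: sc_levelN.
  have npos : \forall t \near (0 : R)^'+, forall i : 'I_(qd_dim (sp_quad S)),
      t * qd_coord (C := sp_quad S) i k.1 < qd_coord (C := sp_quad S) i p.1.
    by apply: filter_forall => i; exact: near_mul_lt.
  near=> t.
  split.
    apply: sc_levelD; first by have [] := proj1 (sc_level_pair _ _) (pinf 0%N I).
    by apply: sc_levelZ; apply: sc_levelN; case: k01.
  move=> i; rewrite [p.1 + _]addrC scalerN -scaleNr qd_coord_linear mulNr.
  by rewrite addrC subr_ge0 ltW //; move: i; near: t.
have K4 : 0 < (4 * K)^-1 by rewrite invr_gt0 mulr_gt0.
have := sc_diff_direction hL' (sc_levelN k1) De K4; rewrite fp => fdir.
have [t [t0 [[Dt Ot] ft]]] : exists t, 0 < t /\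
    (sp_dom S `&` sp_retr S @^-1` O) (p + t *: - k) /\
    sc_norm 0 ((f \o sp_retr S) (p + t *: - k) - p' - t *: L' (- k))
      <= (4 * K)^-1 * t.
  apply: (@filter_ex _ ((0 : R)^'+)); near=> t.
  by split; [|split]; near: t.
set y := (f \o sp_retr S) _ in ft.
have Oy : O' y by exact: fO.
have [_ /(_ j) ypos] := quad' _ Oy.
have lamE u1' u2' : lam (u1' - u2') = lam u1' - lam u2'.
  by rewrite addrC -scaleN1r lamL mulN1r addrC.
have L'0 : L' 0 = 0.
  have := M2 (-1) 0 0 (sc_level0 _ 0) (sc_level0 _ 0).
  by rewrite scaler0 addr0 scaleN1r addNr.
have L'N : L' (- k) = - L' k.
  have := M2 (-1) k 0 k0 (sc_level0 _ 0).
  by rewrite L'0 !addr0 !scaleN1r.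
have := lamB (y - p' - t *: L' (- k)).
have lN : lam (t *: L' (- k)) = - (t * lam (L' k)).
  rewrite L'N scalerN -scaleNr -[_ *: _]addr0 lamL mulNr.
  have -> : lam 0 = 0 by have := lamE 0 0; rewrite !subrr.
  by rewrite addr0.
rewrite !lamE lN (_ : lam p' = 0) // subr0 opprK.
have y0 : sc_level (sp_space S') 0 y by apply: sp_core_level0; exact: Oc'.
have ly0 : sc_level (sp_space S') 0 (y - p' - t *: L' (- k)).
  apply: sc_levelB; first exact: sc_levelB.
  by apply: sc_levelZ; apply: M1; exact: sc_levelN.
move=> /(_ ly0) hy.
have {hy} : `|lam y + t * lam (L' k)| <= t / 4.
  apply: le_trans hy _; apply: (@le_trans _ _ (K * ((4 * K)^-1 * t))).
    by rewrite ler_pM2l.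
  rewrite le_eqVlt; apply/orP; left; apply/eqP; field.
  by rewrite gt_eqF.
have : t * (1 / 2) <= t * lam (L' k) by rewrite ler_pM2l.
have : 0 <= lam y by exact: ypos.
rewrite ler_norml => a1 a2 /andP[_ a3]; lra.
Unshelve. all: end_near. Qed.


End corner_recognition.

(** * Charts, smooth points and the boundary *)

Section charts.
Variables (R : realType) (X : topologicalType).
Implicit Types (c : chart R X) (P : mpolyfold R X).

(** The relative openness of images follows from the continuity of the inverse
chart, which is only given on the preimage of [ch_img] on level 0. *)
Lemma chart_image_open c (W : set X) : open W ->
  sc_rel_open (sp_core (ch_spl c)) (ch_map c @` (ch_dom c `&` W)).
Proof.
move=> oW; have [V' oV' imgE] := ch_img_open c.
pose D := sc_emb (sp_space (ch_spl c)) 0 @^-1` ch_img (c := c).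
pose F := @ch_inv _ _ c \o sc_emb (sp_space (ch_spl c)) 0.
pose V2 := interior [set p | D p -> W (F p)].
exists (V' `&` V2); first by apply: openI => //; exact: open_interior.
have V2P p : D p -> W (F p) -> V2 p.
  move=> Dp Wp; have /subspace_continuousP/(_ p Dp) := @ch_inv_cont _ _ c.
  by move=> /(_ W (open_nbhs_nbhs (conj oW Wp))).
apply/seteqP; split=> [_ [x [cx Wx] <-]|y [cy [p [V'p V2p] py]]].
  have := ch_map_img cx; rewrite imgE => -[cy [p V'p py]]; split=> //.
  exists p => //; split=> //; apply: V2P; rewrite /D /F /= py.
    exact: ch_map_img.
  by rewrite ch_mapK.
have img : ch_img (c := c) (sc_emb (sp_space (ch_spl c)) 0 p).
  by rewrite imgE py; split=> //; exists p.
rewrite -py; exists (ch_inv (sc_emb (sp_space (ch_spl c)) 0 p)); last exact: ch_invK.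
by split; [exact: ch_inv_dom|exact: (interior_subset V2p)].
Qed.

Lemma chart_img_core c : ch_img (c := c) `<=` sp_core (ch_spl c).
Proof. by move=> p; have [V' _ ->] := ch_img_open c; case. Qed.

Lemma chart_map_core c x : ch_dom c x -> sp_core (ch_spl c) (ch_map c x).
Proof. by move=> /ch_map_img /chart_img_core. Qed.

Lemma chart_image_core c (W : set X) :
  ch_map c @` (ch_dom c `&` W) `<=` sp_core (ch_spl c).
Proof. by move=> _ [x [cx _] <-]; exact: chart_map_core. Qed.

Lemma atlas_chart P c : mp_atlas P c -> mp_chart P c.
Proof. by move=> Pc d Pd; split; exact: (@mp_compat _ _ P). Qed.

Lemma transition_level c d x m : transition_smooth c d -> ch_dom c x ->
  ch_dom d x -> sc_level (sp_space (ch_spl c)) m (ch_map c x) ->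
  sc_level (sp_space (ch_spl d)) m (ch_map d x).
Proof.
move=> cd cx dx lx.
have := core_smooth_level cd (@chart_image_core c (ch_dom d)) _ lx.
by rewrite /= ch_mapK //; apply; exists x.
Qed.

(** Transition maps preserve all levels, so smoothness of a point can be read in
any chart of the maximal atlas. *)
Lemma infty_chart P c x : mp_infty P x -> mp_chart P c -> ch_dom c x ->
  sc_infty (sp_space (ch_spl c)) (ch_map c x).
Proof.
move=> Px Pc cx m _; have [d [Pd dx lx]] := Px m I.
by apply: transition_level dx cx lx; have [] := Pc d Pd.
Qed.

Lemma chart_infty P c x : mp_chart P c -> ch_dom c x ->
  sc_infty (sp_space (ch_spl c)) (ch_map c x) -> mp_infty P x.
Proof.
move=> Pc cx lx m _; have [d Pd dx] := mp_cover P x.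
exists d; split=> //; apply: transition_level cx dx (lx m I).
by have [] := Pc d Pd.
Qed.

Lemma chart_coord_ge0 c x i : ch_dom c x ->
  0 <= qd_coord (C := sp_quad (ch_spl c)) i (ch_map c x).1.
Proof. by move=> /chart_map_core[[/sp_V_quadrant[_ +] _] _]; apply. Qed.

Lemma degeneracyP c x : ch_dom c x ->
  degeneracy c x = 0%N <->
  forall i, 0 < qd_coord (C := sp_quad (ch_spl c)) i (ch_map c x).1.
Proof.
move=> cx; split=> [/card0_eq h i|h].
  rewrite lt_neqAle chart_coord_ge0 // andbT eq_sym.
  by have := h i; rewrite inE => ->.
by apply: eq_card0 => i; rewrite inE gt_eqF.
Qed.

Lemma transition_interior c d x : transition_smooth c d ->
  transition_smooth d c -> ch_dom c x -> ch_dom d x ->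
  sc_infty (sp_space (ch_spl c)) (ch_map c x) ->
  degeneracy c x = 0%N -> degeneracy d x = 0%N.
Proof.
move=> cd dc cx dx xinf /(degeneracyP cx) pos; apply/degeneracyP => //.
have := @corner_recognition R _ _ _ _ _ _ (@chart_image_core c (ch_dom d))
  (@chart_image_core d (ch_dom c)) (chart_image_open c (ch_dom_open d))
  (chart_image_open d (ch_dom_open c)) cd dc _ _ _ _ (ch_map c x) _ xinf pos.
rewrite /= ch_mapK //; apply.
- by move=> _ [y [cy dy] <-]; rewrite ch_mapK //; exists y.
- by move=> _ [y [cy dy] <-]; rewrite ch_mapK //; exists y.
- by move=> _ [y [cy dy] <-]; rewrite !ch_mapK.
- by move=> _ [y [cy dy] <-]; rewrite !ch_mapK.
- by exists x.
Qed.

(** [mp_boundary] refers to some chart of the atlas; at a smooth point every chart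
of the maximal atlas gives the same answer. *)
Lemma boundary_chart P c x : mp_infty P x -> mp_chart P c -> ch_dom c x ->
  mp_boundary P x <-> degeneracy c x <> 0%N.
Proof.
move=> Px Pc cx; split=> [[d [Pd dx dg]] dg0|dg].
  have [cd dc] := Pc d Pd; move: dg.
  by rewrite (transition_interior cd dc cx dx (infty_chart Px Pc cx) dg0).
have [d Pd dx] := mp_cover P x; exists d; split=> //.
rewrite lt0n; apply/eqP => dg0; apply: dg.
have [cd dc] := Pc d Pd.
exact: transition_interior dc cd dx cx (infty_chart Px (atlas_chart Pd) dx) dg0.
Qed.

End charts.

Lemma smooth_preimage_open (X Y : topologicalType) (U : set X) (f : X -> Y)
    (V : set Y) : open U -> open V ->
  {within U, continuous f} -> open (U `&` f @^-1` V).
Proof.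
move=> oU oV fc; rewrite openE => x [Ux Vx]; apply: filterI.
  exact: open_nbhs_nbhs.
have := fc; rewrite continuous_open_subspace // => /(_ x).
rewrite inE => /(_ Ux); apply; exact: open_nbhs_nbhs.
Qed.

Section diffeos.
Variables (R : realType) (X Y : topologicalType).
Variables (P : mpolyfold R X) (Q : mpolyfold R Y).
Implicit Types (U : set X) (V : set Y).

Lemma smooth_infty U (f : X -> Y) x : open U -> mp_smooth P Q U f -> U x ->
  mp_infty P x -> mp_infty Q (f x).
Proof.
move=> oU [fc fs] Ux Px.
have [c Pc cx] := mp_cover P x; have [d Qd dy] := mp_cover Q (f x).
apply: (chart_infty (atlas_chart Qd) dy) => m _.
have := core_smooth_level (fs c d Pc Qd) _ _ (infty_chart Px (atlas_chart Pc) cx I).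
rewrite /= ch_mapK //; apply.
  by rewrite -setIA; exact: chart_image_core.
by exists x.
Qed.

(** A local diffeomorphism read in charts is a pair (f, g) as in
[corner_recognition]. *)
Lemma diffeo_boundary U V (f : X -> Y) (g : Y -> X) x :
  open U -> open V -> mp_smooth P Q U f -> mp_smooth Q P V g ->
  (forall x, U x -> V (f x) /\ g (f x) = x) ->
  (forall y, V y -> U (g y) /\ f (g y) = y) ->
  U x -> mp_infty P x -> mp_boundary Q (f x) -> mp_boundary P x.
Proof.
move=> oU oV [fc fs] [gc gs] fK gK Ux Px Qfx.
have [c Pc cx] := mp_cover P x; have [d Qd dy] := mp_cover Q (f x).
have Qinf : mp_infty Q (f x) by apply: smooth_infty Ux Px; [exact: oU|split].
apply/(boundary_chart Px (atlas_chart Pc) cx) => dg.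
have := proj1 (boundary_chart Qinf (atlas_chart Qd) dy) Qfx; apply.
apply/degeneracyP => //; move/degeneracyP : dg => /(_ cx) dg.
have oO := chart_image_open c (smooth_preimage_open oU (ch_dom_open d) fc).
have oO' := chart_image_open d (smooth_preimage_open oV (ch_dom_open c) gc).
have := @corner_recognition R _ _ _ _ _ _ (@chart_image_core _ _ c _)
  (@chart_image_core _ _ d _) oO oO' _ _ _ _ _ _ (ch_map c x) _
  (infty_chart Px (atlas_chart Pc) cx) dg.
rewrite !setIA => /(_ _ _ (fs c d Pc Qd) (gs d c Qd Pc)).
rewrite /= ch_mapK //; apply.
- move=> _ [y [[cy Uy] dfy] <-]; rewrite ch_mapK //; exists (f y) => //.
  by have [Vy e] := fK _ Uy; rewrite /= e.
- move=> _ [y [[cy Uy] dfy] <-]; rewrite ch_mapK //; exists (g y) => //.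
  by have [Vy e] := gK _ Uy; rewrite /= e.
- move=> _ [y [[cy Uy] dfy] <-]; rewrite !ch_mapK //.
  by have [_ ->] := fK _ Uy.
- move=> _ [y [[cy Uy] dfy] <-]; rewrite !ch_mapK //.
  by have [_ ->] := gK _ Uy.
- by exists x.
Qed.

End diffeos.

(** * Polyhedral cones with independent facets *)

Section row_linear.
Variables (R : realType) (n : nat).

Lemma rV_linear_bound (V : normedModType R) (f : 'rV[R]_n -> V) : linear f ->
  exists2 C : R, 0 < C & forall q, `|f q| <= C * `|q|.
Proof.
move=> fl; pose f' : {linear 'rV[R]_n -> V} :=
  HB.pack f (GRing.isLinear.Build _ _ _ _ f fl).
exists (\sum_j `|f (delta_mx ord0 j)| + 1).
  by rewrite ltr_wpDl // sumr_ge0.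
move=> q; rewrite {1}[q]row_sum_delta -[f _]/(f' _) linear_sum.
apply: le_trans (ler_norm_sum _ _ _) _.
apply: (@le_trans _ _ ((\sum_j `|f (delta_mx ord0 j)|) * `|q|)); last first.
  by rewrite ler_wpM2r // lerDl.
rewrite mulr_suml; apply: ler_sum => j _.
rewrite linearZ normrZ mulrC ler_wpM2l // ; exact: rV_norm_ge.
Qed.

Lemma unit_sphere_compact : compact [set q : 'rV[R]_n | `|q| = 1].
Proof.
apply: bounded_closed_compact.
  by exists 1; split=> // M M1 q /= ->; exact: ltW.
have -> : [set q : 'rV[R]_n | `|q| = 1] = Num.norm @^-1` [set 1] by [].
apply: preimage_closed; last exact: closed_eq.
by move=> q _; exact: norm_continuous.
Qed.

End row_linear.

Section row_full_normal_form.
Variable R : fieldType.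

(** Gaussian elimination writes B as L pid R with L and R invertible; R is moved to
the left of the partial identity as a block of an n x n matrix. *)
Lemma row_full_pid_mx n k (B : 'M[R]_(n, k)) : row_full B ->
  exists2 T, T \in unitmx & T *m B = pid_mx k.
Proof.
move=> fB; have kn : (k <= n)%N by rewrite -(eqP fB) rank_leq_row.
have nE := subnKC kn; move: (n - k)%N nE => m nE; subst n.
pose T1 : 'M[R]_(k + m) := block_mx (invmx (row_ebase B)) 0 0 1%:M.
have T1u : T1 \in unitmx.
  rewrite unitmxE det_lblock det1 mulr1 -unitmxE unitmx_inv.
  exact: row_ebase_unit.
exists (T1 *m invmx (col_ebase B)).
  by rewrite unitmx_mul T1u unitmx_inv col_ebase_unit.
have -> : T1 *m invmx (col_ebase B) *m B = T1 *m (pid_mx k *m row_ebase B).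
  have BE := mulmx_ebase B; rewrite (eqP fB) in BE.
  rewrite -mulmxA -[X in _ *m (_ *m X) = _]BE -!mulmxA mulKmx //.
  exact: col_ebase_unit.
rewrite pid_mx_col [X in T1 *m X]mul_col_mx mul1mx mul0mx /T1 mul_block_col.
by rewrite mulVmx ?row_ebase_unit // !mulmx0 mul0mx !addr0.
Qed.

End row_full_normal_form.

Section polyhedral_cone.
Variables (R : realType) (n l : nat) (lam : 'I_l -> 'rV[R]_n -> R).
Hypothesis n_gt0 : (0 < n)%N.
Hypothesis lam_linear : forall i, linear (lam i : 'rV[R]_n -> R^o).

Let cone q := forall i, 0 <= lam i q.

(** The facets of the cone that it meets away from the origin. *)
Definition zeroable i := exists a, [/\ a != 0, cone a & lam i a = 0].

Hypothesis zeroable_free :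
  forall y : 'I_l -> R, exists a, forall i, zeroable i -> lam i a = y i.
Hypothesis cone_interior :
  exists p (d : R), 0 < d /\ forall q, `|q - p| < d -> cone q.

Let lamE i a u v : lam i (a *: u + v) = a * lam i u + lam i v.
Proof. exact: (lam_linear i a u v). Qed.

Let lam0 i : lam i 0 = 0.
Proof. by have := lamE i (-1) 0 0; rewrite scaler0 addr0 mulN1r addNr. Qed.

Let cone_nonzero : exists2 a, a != 0 & cone a.
Proof.
have [p [d [d0 hd]]] := cone_interior.
pose u : 'rV[R]_n := const_mx (d / 2).
have u0 : u != 0.
  apply/negP => /eqP/rowP/(_ (Ordinal n_gt0)); rewrite !mxE => h.
  by have := divr_gt0 d0 (ltr0n _ 2); rewrite h ltxx.
have ud : `|u| < d.
  apply: (@le_lt_trans _ _ (d / 2)); last by rewrite ltr_pdivrMr // mulr_natr mulr2n ltrDl.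
  apply/rV_normP; first by rewrite divr_ge0 // ltW.
  by move=> i; rewrite mxE ger0_norm // divr_ge0 // ltW.
have [p0|p0] := eqVneq p 0.
  by exists u => //; apply: hd; rewrite p0 subr0.
by exists p => //; apply: hd; rewrite subrr normr0.
Qed.

Let lam_neq0 i : exists a, lam i a != 0.
Proof.
apply: contrapT => /forallNP h.
have lami a : lam i a = 0 by apply/eqP/negPn/negP; exact: h.
have [a a0 ca] := cone_nonzero.
have [b /(_ i)] := zeroable_free (fun=> 1).
rewrite lami => hb; have /hb/eqP : zeroable i by exists a.
by rewrite eq_sym oner_eq0.
Qed.

(** A linear functional that is nonnegative near one of its zeros is zero, and no
lam i is: a zero functional would be zeroable, contradicting [zeroable_free]. *)
Lemma interior_cone_gt0 q (d : R) i : 0 < d ->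
  (forall q', `|q' - q| < d -> cone q') -> 0 < lam i q.
Proof.
move=> d0 hd; have cq : cone q by apply: hd; rewrite subrr normr0.
rewrite lt_neqAle cq andbT; apply/eqP => /esym q0.
have [a ha] := lam_neq0 i.
pose e := d / (`|a| + 1); have e0 : 0 < e by rewrite divr_gt0 // ltr_wpDl.
have small s : `|s| = e -> `|(s *: a + q) - q| < d.
  move=> se; rewrite addrK normrZ se /e mulrAC ltr_pdivrMr ?ltr_wpDl//.
  by rewrite ltr_pM2l // ltrDl.
have := hd _ (small e _) i; rewrite gtr0_norm // => /(_ erefl).
have := hd _ (small (- e) _) i; rewrite normrN gtr0_norm // => /(_ erefl).
rewrite !lamE q0 !addr0 mulNr oppr_ge0 pmulr_rge0 // pmulr_rle0 // => h1 h2.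
by move/negP: ha; apply; rewrite eq_le h1 h2.
Qed.

(** Choose a minimal set A of functionals defining the cone. They are independent:
if i in A is not zeroable, a point where only lam i is negative is joined to an
interior point, and the segment leaves the cone where lam i = 0, which must be
the origin; this is impossible if A has another element, so A = {i}, and
lam i is not zero. Being independent, the functionals in A can be completed to a
system of linear coordinates. *)
Lemma cone_standard : exists (k : nat) (T : 'M[R]_n), T \in unitmx /\
  forall q, cone (q *m T) <-> forall i : 'I_n, (i < k)%N -> 0 <= q ord0 i.
Proof.
have [p [d [d0 hd]]] := cone_interior.
have ppos i : 0 < lam i p by exact: interior_cone_gt0 d0 hd.
pose defines (A : {set 'I_l}) := `[< forall q, cone q <-> forall i, i \in A -> 0 <= lam i q >].
have dT : defines [set: 'I_l]%SET.
  by apply/asboolP => q; split=> h i; [move=> _; exact: h|apply: h; rewrite inE].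
have [A /minsetP[/asboolP dA minA] _] := minset_exists dT.
have surj (y : 'I_l -> R) : exists a, forall i, i \in A -> lam i a = y i.
  have [allz|] := pselect (forall i, i \in A -> zeroable i).
    by have [a ha] := zeroable_free y; exists a => i /allz; exact: ha.
  move=> /existsNP[i /not_implyP[iA nzi]].
  have Ai j : j \in A -> j = i.
    move=> jA; apply/eqP/negPn/negP => ji.
    have /asboolPn : ~~ defines (A :\ i).
      apply/negP => /minA/(_ (subD1set _ _)) e.
      by move: iA; rewrite -e !inE eqxx.
    apply => q; split=> [/dA h t|h].
      by rewrite !inE => /andP[_]; exact: h.
    apply/dA => t tA; have [->|ti] := eqVneq t i; last by apply: h; rewrite !inE ti.
    rewrite leNgt; apply/negP => qi.
    (* up to a positive factor, where the segment from p to q meets lam i = 0 *)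
    pose a := (- lam i q) *: p + lam i p *: q.
    have lama s : lam s a = - lam i q * lam s p + lam i p * lam s q.
      by rewrite /a lamE -[_ *: q]addr0 lamE lam0 addr0.
    have ai : lam i a = 0 by rewrite lama; ring.
    have aj s : s \in A -> s != i -> 0 < lam s a.
      move=> sA si; rewrite lama ltr_pwDl //; first by rewrite mulr_gt0 // oppr_gt0.
      by rewrite mulr_ge0 ?(ltW (ppos _))//; apply: h; rewrite !inE si.
    apply: nzi; exists a; split=> //; last first.
      apply/dA => s sA; have [->|si] := eqVneq s i; first by rewrite ai.
      exact: ltW (aj _ sA si).
    apply/negP => /eqP a0; have := aj j jA ji.
    by rewrite a0 lam0 ltxx.
  exists ((y i / lam i p) *: p) => j /Ai ->.
  by rewrite -[_ *: p]addr0 lamE lam0 addr0 divfK // gt_eqF.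
pose k := #|A|; pose f (q : 'rV[R]_n) : 'rV[R]_k := \row_j lam (enum_val j) q.
have fl : linear f by move=> a u v; apply/rowP => j; rewrite !mxE lamE.
pose f' : {linear 'rV[R]_n -> 'rV[R]_k} :=
  HB.pack f (GRing.isLinear.Build _ _ _ _ f fl).
pose B := lin1_mx f'.
have BE q : q *m B = f q by rewrite /B mul_rV_lin1.
have fB : row_full B.
  apply/row_fullP.
  have /choice[b hb] : forall j : 'I_k, exists a, forall i, i \in A ->
      lam i a = (i == enum_val j)%:R.
    by move=> j; exact: surj.
  exists (\matrix_j b j); apply/row_matrixP => j.
  rewrite row_mul rowK BE; apply/rowP => i; rewrite !mxE hb ?enum_valP //.
  by rewrite (inj_eq enum_val_inj) eq_sym.
have [T Tu TB] := row_full_pid_mx fB.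
have kn : (k <= n)%N by rewrite -(eqP fB) rank_leq_row.
have fT q (j : 'I_k) : lam (enum_val j) (q *m T) = q ord0 (widen_ord kn j).
  have := BE (q *m T); rewrite -mulmxA TB => /rowP/(_ j).
  rewrite [X in _ = X -> _]mxE => <-; rewrite mxE (bigD1 (widen_ord kn j)) //=.
  rewrite mxE /= eqxx ltn_ord mulr1 big1 ?addr0 // => i ij.
  by rewrite mxE (_ : (i == j :> nat) = false) ?mulr0 //; apply: negbTE.
exists k, T; split=> // q; rewrite dA; split=> h.
  move=> i ik; have := h _ (enum_valP (Ordinal ik)).
  by rewrite fT; congr (0 <= q ord0 _); apply: val_inj.
move=> i iA; rewrite -(enum_rankK_in iA iA) fT; apply: h.
exact: (ltn_ord (enum_rank_in iA i)).
Qed.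

End polyhedral_cone.

(** * Good position *)

Section sc_balls.
Variables (R : realType) (F : scBanach R).

Lemma sc_open_ball (V : set (sc_space F 0)) u : open V -> V u ->
  exists2 d : R, 0 < d & forall y, sc_level F 0 y ->
    sc_norm 0 (y - sc_emb F 0 u) < d -> (sc_emb F 0 @` V) y.
Proof.
move=> oV Vu; have /nbhs_ballP[d /= d0 hd] : nbhs u V by exact: open_nbhs_nbhs.
exists d => // y y0 yu; exists (sc_at 0 y); last exact: sc_atK.
apply: hd; rewrite -ball_normE /= distrC -(sc_embK u) -sc_atB //.
exact: sc_level_emb.
Qed.

Lemma sc_closed_avoid (K : set F) x : closed (sc_emb F 0 @^-1` K) ->
  sc_level F 0 x -> ~ K x -> exists2 d : R, 0 < d &
    forall b, sc_level F 0 b -> K b -> d <= sc_norm 0 (b - x).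
Proof.
move=> cK x0 nKx; have := @sc_open_ball (~` (sc_emb F 0 @^-1` K)) (sc_at 0 x).
case; first exact: closed_openC.
  by rewrite /setC /preimage /mkset sc_atK.
rewrite sc_atK // => d d0 hd; exists d => // b b0 Kb.
rewrite leNgt; apply/negP => /(hd _ b0)[u nKu ub].
by apply: nKu; rewrite /preimage /mkset ub.
Qed.

End sc_balls.

Section good_positions.
Variables (R : realType) (S : splicing R) (n : nat).
Notation F := (sp_space S).
Variables (lin : {linear 'rV[R]_n -> F}) (Nc : set F).
Hypothesis lin_inj : injective lin.
Hypothesis good : good_position (sp_quadrant S) (range lin) Nc.

Lemma lin_infty q : sc_infty F (lin q).
Proof. by have [h _ _ _] := good; apply: h; exists q. Qed.

Lemma lin_level m q : sc_level F m (lin q). Proof. exact: lin_infty. Qed.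

Lemma lin_bound m : exists2 C : R, 0 < C &
  forall q, sc_norm m (lin q) <= C * `|q|.
Proof.
apply: (@rV_linear_bound R n (sc_space F m) (fun q => sc_at m (lin q))).
by move=> a u v; rewrite linearP sc_at_linear //; exact: lin_level.
Qed.

Lemma compl_level0 b : Nc b -> sc_level F 0 b.
Proof. by have [_ _ [h _ _ _ _] _] := good; exact: h. Qed.

Lemma compl_linear a u v : Nc u -> Nc v -> Nc (a *: u + v).
Proof. by have [_ _ [_ [_ h] _ _ _] _] := good; exact: h. Qed.

Lemma compl0 : Nc 0.
Proof. by have [_ _ [_ [h _] _ _ _] _] := good. Qed.

(** On the unit sphere of N, which is compact, the distance to the closed subspace
Nc is bounded below by a positive constant, as N meets Nc only in 0. *)
Lemma compl_lower_bound : exists2 r : R, 0 < r &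
  forall q b, Nc b -> r * `|q| <= sc_norm 0 (lin q + b).
Proof.
have [_ _ [_ _ clNc NNc _] _] := good.
have [C C0 hC] := lin_bound 0.
have /compact_near_coveringP/(_ _ ((0 : R)^'+)
  (fun r q => forall b, Nc b -> r <= sc_norm 0 (lin q + b)) _) :=
  @unit_sphere_compact R n.
have nz (q : 'rV[R]_n) : `|q| = 1 -> exists2 r0 : R, 0 < r0 &
    forall b, Nc b -> r0 <= sc_norm 0 (lin q + b).
  move=> q1; have nNc : ~ Nc (- lin q).
    move=> h; have : (range lin `&` Nc) (lin q).
      split; first by exists q.
      by have := compl_linear (-1) h compl0; rewrite scaleN1r opprK addr0.
    rewrite NNc /= -[0](linear0 lin) => /lin_inj q0.
    by move: q1; rewrite q0 normr0 => /esym/eqP; rewrite oner_eq0.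
  have nlq : sc_level F 0 (- lin q) by apply: sc_levelN; exact: lin_level.
  have [r0 r00 hr] := sc_closed_avoid clNc nlq nNc.
  exists r0 => // b Nb; rewrite addrC -[lin q]opprK.
  by apply: hr => //; exact: compl_level0.
case.
  move=> q /= q1; have [r0 r00 hr0] := nz q q1.
  exists ([set q' | `|q - q'| < r0 / 2 / C], [set r | r < r0 / 2]) => /=.
    split.
      apply/nbhs_ballP; exists (r0 / 2 / C) => /=; first by rewrite !divr_gt0.
      by move=> q'; rewrite -ball_normE.
    by apply: nbhs_right_lt; rewrite divr_gt0.
  move=> [q' r] /= [qq' rr0] b Nb.
  have := hr0 b Nb.
  have -> : lin q + b = (lin q' + b) + lin (q - q').
    by rewrite linearB [RHS]addrC addrA subrK.
  have l1 : sc_level F 0 (lin q' + b).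
    by apply: sc_levelD; [exact: lin_level|exact: compl_level0].
  have := sc_normD l1 (lin_level 0 (q - q')).
  have : sc_norm 0 (lin (q - q')) <= r0 / 2.
    by apply: le_trans (hC _) _; rewrite mulrC -ler_pdivlMr // ltW.
  move: (sc_norm 0 _) (sc_norm 0 _) (sc_norm 0 _) => x y z; lra.
move=> e /= e0 he.
pose r := e / 2; have r0 : 0 < r by rewrite divr_gt0.
exists r => // q b Nb.
have [->|q0] := eqVneq q 0; first by rewrite normr0 mulr0 sc_norm_ge0.
have nq : 0 < `|q| by rewrite normr_gt0.
have := he r; rewrite /ball /= sub0r normrN gtr0_norm // => /(_ _ r0).
have re : r < e by rewrite ltr_pdivrMr // mulr_natr mulr2n ltrDl.
move=> /(_ re (`|q|^-1 *: q)).
have n1 : `|(`|q|^-1 *: q)| = 1.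
  by rewrite normrZ ger0_norm ?invr_ge0 // mulVf // gt_eqF.
move=> /(_ n1 (`|q|^-1 *: b)).
have Nb' : Nc (`|q|^-1 *: b).
  by have := compl_linear (`|q|^-1) Nb compl0; rewrite addr0.
move=> /(_ Nb'); rewrite linearZ -scalerDr sc_normZ; last first.
  by apply: sc_levelD; [exact: lin_level|exact: compl_level0].
by rewrite ger0_norm ?invr_ge0 // mulrC ler_pdivlMr.
Qed.

Definition face_coord (i : 'I_(qd_dim (sp_quad S))) (q : 'rV[R]_n) : R :=
  qd_coord (C := sp_quad S) i (lin q).1.

Lemma face_coord_linear i : linear (face_coord i : 'rV[R]_n -> R^o).
Proof. by move=> a u v; rewrite /face_coord linearP /= qd_coord_linear. Qed.

Lemma quadrant_linP q : sp_quadrant S (lin q) <-> forall i, 0 <= face_coord i q.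
Proof.
have [l1 l2] := proj1 (sc_level_pair _ _) (lin_level 0 q).
by split=> [[[_ h] _]|h].
Qed.

(** If face_coord i vanishes at a nonzero point lin q of the cone, then for b in Nc
both lin q + s b and lin q - s b are in the quadrant when s is small, so the
i-th coordinate vanishes on Nc. Hence prescribing such coordinates in the whole
space and projecting to N along Nc prescribes them on N. *)
Lemma face_coord_free (y : 'I_(qd_dim (sp_quad S)) -> R) :
  exists a, forall i, zeroable face_coord i -> face_coord i a = y i.
Proof.
have [_ _ [_ _ _ _ dec] [c c0 hc]] := good.
have [w winf hw] := @qd_section _ _ (sp_quad S) y.
have wl : sc_level F 0 ((w, 0) : F).
  by apply/sc_level_pair; split; [exact: winf|exact: sc_level0].
have [_ [b [[a _ <-] Nb _ e]]] := dec 0%N _ wl.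
exists a => i [q [q0 qpos qi]].
have bi (t : R) : `|t| = 1 -> 0 <= t * qd_coord (C := sp_quad S) i b.1.
  (* the scale at which good position applies to s t b *)
  move=> t1; pose s := c * sc_norm 0 (lin q) / (sc_norm 0 b + 1).
  have nq0 : 0 < sc_norm 0 (lin q).
    rewrite lt_neqAle sc_norm_ge0 andbT eq_sym; apply/eqP => h.
    have /eqP := sc_norm_eq0 (lin_level 0 q) h.
    by rewrite -[0](linear0 lin) (inj_eq lin_inj) (negbTE q0).
  have nb0 : 0 < sc_norm 0 b + 1 by rewrite ltr_wpDl // sc_norm_ge0.
  have s0 : 0 < s by rewrite divr_gt0 // mulr_gt0.
  have Nsb : Nc ((s * t) *: b).
    by have := compl_linear (s * t) Nb compl0; rewrite addr0.
  have small : sc_norm 0 ((s * t) *: b) <= c * sc_norm 0 (lin q).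
    rewrite sc_normZ; last exact: compl_level0.
    rewrite normrM t1 mulr1 gtr0_norm // /s mulrAC ler_pdivrMr //.
    by rewrite ler_pM2l ?mulr_gt0// lerDl.
  have [_ h] := hc _ _ (imageP lin (I : setT q)) Nsb small.
  have [[_ hi] _] := h (proj2 (quadrant_linP q) qpos); move: (hi i).
  rewrite /= [X in qd_coord _ X]addrC qd_coord_linear.
  by rewrite -/(face_coord i q) qi addr0 -mulrA pmulr_rge0.
have bi0 : qd_coord (C := sp_quad S) i b.1 = 0.
  have := bi 1 (normr1 _); have := bi (-1) (normrN1 _).
  rewrite mul1r mulN1r oppr_ge0 => h1 h2.
  by apply/eqP; rewrite eq_le h1 h2.
rewrite -hw (_ : w = 1 *: (lin a).1 + b.1); last first.
  by rewrite scale1r; have := congr1 fst e.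
by rewrite qd_coord_linear bi0 mul1r addr0.
Qed.

Lemma face_cone_interior : exists p (d : R), 0 < d /\
  forall q, `|q - p| < d -> forall i, 0 <= face_coord i q.
Proof.
have [_ [V [oV [_ [[p _ <-] [u Vu up]]] hV]] _ _] := good.
have [C C0 hC] := lin_bound 0.
have [d d0 hd] := sc_open_ball oV Vu.
exists p, (d / C); split; first exact: divr_gt0.
move=> q qp; apply/quadrant_linP; apply: hV; split; first by exists q.
apply: hd; first exact: lin_level.
rewrite up -linearB; apply: le_lt_trans (hC _) _.
by rewrite mulrC -ltr_pdivlMr.
Qed.

End good_positions.

(** * Local parametrizations of submanifolds *)

Section local_params.
Variables (R : realType) (X : topologicalType) (P : mpolyfold R X) (n : nat).
Variables (M : set X) (L : local_param P n M).
Let c := lp_chart L.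
Let E := lp_space L.

Lemma lp_ptP q : lp_dom L q ->
  [/\ M (lp_pt L q), ch_dom c (lp_pt L q) &
      ch_map c (lp_pt L q) = lp_lin L q + lp_map L q].
Proof.
move=> Lq; have [h _ _] := lp_bij L; have [Mq cq] := h _ Lq.
by split=> //; rewrite ch_invK //; exact: lp_img.
Qed.

Lemma lp_pt_surj x : M x -> ch_dom c x -> exists2 q, lp_dom L q & lp_pt L q = x.
Proof. by move=> Mx cx; have [_ _ h] := lp_bij L; exact: h. Qed.

Lemma lp_map_level m q : lp_dom L q -> sc_level E m (lp_map L q).
Proof.
move=> Lq; have [/(_ m)[h _] _] := lp_map_smooth L 0%N.
by apply: h => //; exact: sc_level_const.
Qed.

Lemma lp_pt_infty q : lp_dom L q -> sc_infty E (ch_map c (lp_pt L q)).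
Proof.
move=> Lq m _; have [_ _ ->] := lp_ptP Lq.
apply: sc_levelD; last exact: lp_map_level.
exact: (lin_level (lp_good L)).
Qed.

Lemma lp_mp_infty q : lp_dom L q -> mp_infty P (lp_pt L q).
Proof.
move=> Lq; have [_ cq _] := lp_ptP Lq.
exact: chart_infty (lp_is_chart L) cq (lp_pt_infty Lq).
Qed.

(** The parameter is recovered from the chart by the projection along the
complement, which is bounded. *)
Lemma lp_coord_lipschitz : exists2 r : R, 0 < r & forall q q',
  lp_dom L q -> lp_dom L q' ->
  r * `|q - q'| <= sc_norm 0 (ch_map c (lp_pt L q) - ch_map c (lp_pt L q')).
Proof.
have [r r0 hr] := compl_lower_bound (@lp_lin_inj _ _ _ _ _ L) (lp_good L).
exists r => // q q' Lq Lq'.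
have [_ _ ->] := lp_ptP Lq; have [_ _ ->] := lp_ptP Lq'.
rewrite opprD addrACA -linearB; apply: hr.
rewrite addrC -scaleN1r.
by apply: (compl_linear (lp_good L)); exact: lp_map_compl.
Qed.

(** Since R^n carries the constant sequence of levels, there is no loss of level
here. *)
Lemma lp_pt_lipschitz m q0 : lp_dom L q0 -> exists C d : R, 0 < d /\
  forall q, lp_dom L q -> `|q - q0| < d ->
  sc_norm m (ch_map c (lp_pt L q) - ch_map c (lp_pt L q0)) <= C * `|q - q0|.
Proof.
move=> Lq0.
have [T hT] := @sc_k_diff _ m (sc_const R n) E _ _ q0 (lp_map_smooth L m.+1) Lq0
  (sc_level_const _ _).
have [C [d [d0 hd]]] := sc_diff_lipschitz (proj1 (lp_map_smooth L 0%N)) Lq0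
  (sc_level_const _ _) hT.
have [K K0 hK] := lin_bound (lp_good L) m.
exists (K + C), d; split=> // q Lq qq0.
have [_ _ ->] := lp_ptP Lq; have [_ _ ->] := lp_ptP Lq0.
rewrite opprD addrACA -linearB mulrDl.
apply: le_trans (sc_normD _ _) _.
- exact: (lin_level (lp_good L)).
- by apply: sc_levelB; exact: lp_map_level.
apply: lerD; first exact: hK.
have := hd q (sc_level_const _ _) Lq; rewrite sc_norm_const; exact.
Qed.

Lemma lp_pt_near q0 W : lp_dom L q0 -> nbhs (lp_pt L q0) W ->
  exists2 d : R, 0 < d & forall q, lp_dom L q -> `|q - q0| < d -> W (lp_pt L q).
Proof.
move=> Lq0 nW; have /subspace_continuousP/(_ q0 Lq0 W nW) := @lp_pt_cont _ _ _ _ _ L.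
rewrite nbhs_simpl /= => /nbhs_ballP[d /= d0 hd].
exists d => // q Lq qq0; apply: hd => //.
by rewrite -ball_normE /= distrC.
Qed.

Lemma lp_coord_near q0 (d : R) : lp_dom L q0 -> 0 < d ->
  exists2 W, nbhs (lp_pt L q0) W &
    forall q, lp_dom L q -> W (lp_pt L q) -> `|q - q0| < d.
Proof.
move=> Lq0 d0; have [g [gc gK]] := lp_coord_cont L.
have [M0 c0 _] := lp_ptP Lq0.
have nd : nbhs (g (lp_pt L q0)) [set q | `|q - q0| < d].
  rewrite gK //; apply/nbhs_ballP; exists d => //= q.
  by rewrite -ball_normE /= distrC.
have /subspace_continuousP/(_ _ (conj M0 c0) _ nd) := gc.
rewrite nbhs_simpl /= /within => nW; eexists; first exact: nW.
move=> q Lq /= Wq; have [Mq cq _] := lp_ptP Lq.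
by have := Wq (conj Mq cq); rewrite /from_subspace gK.
Qed.

(** If q is on no face it is interior to the cone, where all coordinates of lin q
are positive. For small q good position allows adding 2 A(q) without leaving
the quadrant, so lin q + A(q) is the midpoint of lin q and a point of the
quadrant, and all its coordinates are positive too. *)
Lemma lp_boundary_face k : (0 < n)%N ->
  lp_lin L @^-1` sp_quadrant (ch_spl c) =
    [set q | forall i : 'I_n, (i < k)%N -> 0 <= q ord0 i] ->
  exists2 d : R, 0 < d & forall q, lp_dom L q -> `|q| < d ->
    degeneracy c (lp_pt L q) <> 0%N ->
    exists2 i : 'I_n, (i < k)%N & q ord0 i = 0.
Proof.
move=> n0 std; have good := lp_good L.
have [_ _ _ [e e0 he]] := good.
have [r r0 hr] := compl_lower_bound (@lp_lin_inj _ _ _ _ _ L) good.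
have /sc_derivP[_ _ _ /(_ (e * r / 2))[]] := @lp_dmap0 _ _ _ _ _ L.
  by rewrite divr_gt0 // mulr_gt0.
move=> d d0 hd; exists d => // q Lq qd dg.
apply: contrapT => /forall2NP nface; apply: dg.
have stdP q' : sp_quadrant (ch_spl c) (lp_lin L q') =
    (forall i : 'I_n, (i < k)%N -> 0 <= q' ord0 i).
  exact: (congr1 (fun s => s q') std).
have [_ cq mq] := lp_ptP Lq; apply/degeneracyP => // i; rewrite mq.
have [V oV domE] := lp_dom_open L.
have Dq : sp_quadrant (ch_spl c) (lp_lin L q) by move: Lq; rewrite domE => -[].
have qk (j : 'I_n) : (j < k)%N -> 0 < q ord0 j.
  move=> jk; rewrite lt_neqAle.
  have -> : 0 <= q ord0 j.
    by move: Dq; rewrite stdP; exact.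
  by rewrite andbT eq_sym; apply/eqP => qj; have [] := nface j.
have [d1 d10 hd1] : exists2 d1 : R, 0 < d1 &
    forall j : 'I_n, (j < k)%N -> d1 <= q ord0 j.
  exists (\big[Num.min/1]_(j < n | (j < k)%N) q ord0 j).
    apply: (big_ind (fun x => 0 < x)) => // x y x0 y0.
    by rewrite lt_min x0.
  by move=> j jk; exact: bigmin_le_cond.
have lampos : 0 < face_coord (lp_lin L) i q.
  apply: (@interior_cone_gt0 _ _ _ _ n0 (@face_coord_linear _ _ _ _)
    (face_coord_free (@lp_lin_inj _ _ _ _ _ L) good)
    (face_cone_interior good) q d1 i d10).
  move=> q' qq'; apply/(quadrant_linP good).
  rewrite stdP => j jk; have := hd1 j jk.
  have := le_lt_trans (rV_norm_ge (q' - q) j) qq'; rewrite !mxE ltr_norml.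
  by move=> /andP[h1 _] h2; lra.
have [q0|q0] := eqVneq q 0.
  by move: lampos; rewrite q0 /face_coord linear0 lp_map0 addr0.
have nA : sc_norm 0 (lp_map L q) <= e * r / 2 * `|q|.
  have := hd q (sc_level_const _ _); rewrite sc_norm_const add0r => /(_ qd Lq).
  by rewrite lp_map0 !subr0.
have A0 := lp_map_compl Lq.
have A20 : lp_compl (l := L) (2 *: lp_map L q).
  by have := compl_linear good 2 A0 (compl0 good); rewrite addr0.
have small : sc_norm 0 (2 *: lp_map L q) <= e * sc_norm 0 (lp_lin L q).
  rewrite sc_normZ; last exact: lp_map_level.
  rewrite ger0_norm //.
  apply: (@le_trans _ _ (e * (r * `|q|))); last first.
    rewrite ler_pM2l //; have := hr q 0 (compl0 good); rewrite addr0; exact.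
  apply: (@le_trans _ _ (2 * (e * r / 2 * `|q|))); first by rewrite ler_pM2l.
  by rewrite le_eqVlt; apply/orP; left; apply/eqP; field.
have [_ h] := he _ _ (imageP (lp_lin L) (I : setT q)) A20 small.
have [[_ hi] _] := h Dq; move: (hi i).
rewrite /= addrC qd_coord_linear -/(face_coord (lp_lin L) i q) => hi2.
rewrite [X in qd_coord _ X]addrC -[X in X + _]scale1r qd_coord_linear.
rewrite -/(face_coord (lp_lin L) i q).
move: hi2 lampos; set u := qd_coord _ _; set v := face_coord _ _ _; lra.
Qed.

End local_params.

Section reparametrization.
Variables (R : realType) (X : topologicalType) (P : mpolyfold R X) (n : nat).
Variables (M : set X) (L : local_param P n M) (T : 'M[R]_n).
Hypothesis Tu : T \in unitmx.
Let c := lp_chart L.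
Let E := lp_space L.

Let lin (q : 'rV[R]_n) : E := lp_lin L (q *m T).

Let lin_linear : linear lin.
Proof. by move=> a u v; rewrite /lin mulmxDl -scalemxAl linearP. Qed.

Let lin' : {linear 'rV[R]_n -> E} :=
  HB.pack lin (GRing.isLinear.Build _ _ _ _ lin lin_linear).

Let TK (q : 'rV[R]_n) : q *m T *m invmx T = q. Proof. exact: mulmxK. Qed.
Let TVK (q : 'rV[R]_n) : q *m invmx T *m T = q. Proof. exact: mulmxKV. Qed.

Let lin_inj : injective lin'.
Proof. by move=> u v /(@lp_lin_inj _ _ _ _ _ L) uv; rewrite -(TK u) uv TK. Qed.

Let lin_range : range lin' = range (lp_lin L).
Proof.
apply/seteqP; split=> [_ [q _ <-]|_ [q _ <-]]; first by exists (q *m T).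
by exists (q *m invmx T) => //=; rewrite /lin TVK.
Qed.

Let good : good_position (sp_quadrant (ch_spl c)) (range lin') (lp_compl (l := L)).
Proof. by rewrite lin_range; exact: lp_good. Qed.

Let dom : set 'rV[R]_n := [set q | lp_dom L (q *m T)].

Lemma mulmxr_bound (A : 'M[R]_n) : exists2 C : R, 0 < C &
  forall q : 'rV[R]_n, `|q *m A| <= C * `|q|.
Proof.
apply: (@rV_linear_bound R n 'rV[R]_n (fun q => q *m A)) => a u v.
by rewrite mulmxDl -scalemxAl.
Qed.

Lemma mulmxr_continuous (A : 'M[R]_n) : continuous (fun q : 'rV[R]_n => q *m A).
Proof.
have fl : linear (fun q : 'rV[R]_n => q *m A).
  by move=> a u v; rewrite mulmxDl -scalemxAl.
pose f : {linear 'rV[R]_n -> 'rV[R]_n} :=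
  HB.pack (fun q : 'rV[R]_n => q *m A) (GRing.isLinear.Build _ _ _ _ _ fl).
apply: (@bounded_linear_continuous R 'rV[R]_n 'rV[R]_n f).
apply/linear_boundedP; have [C C0 hC] := mulmxr_bound A.
exists C; split; first by rewrite gtr0_real.
by move=> r Cr q; apply: le_trans (hC q) _; rewrite ler_wpM2r // ltW.
Qed.

Let dom_open : exists2 V, open V &
  dom = V `&` lin' @^-1` sp_quadrant (ch_spl c).
Proof.
have [V oV domE] := lp_dom_open L.
exists ((fun q => q *m T) @^-1` V).
  by move/continuousP: (@mulmxr_continuous T); apply.
by rewrite /dom domE.
Qed.

Let dom0 : dom 0. Proof. by rewrite /dom /= mul0mx; exact: lp_dom0. Qed.

Let map (q : 'rV[R]_n) : E := lp_map L (q *m T).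

Let map_smooth : @sc_smooth R (sc_const R n) E dom map.
Proof.
move=> k.
apply: (@sc_k_comp_linear R k (sc_const R n) (sc_const R n) E
  (fun q => q *m T) dom (lp_dom L) (lp_map L)) => //.
- by move=> a u v; rewrite mulmxDl -scalemxAl.
- move=> m; have [C C0 hC] := mulmxr_bound T; exists C => // h _.
  by rewrite !sc_norm_const; split; [exact: sc_level_const|exact: hC].
- exact: lp_map_smooth.
Qed.

Let dmap0 : @sc_deriv R (sc_const R n) E dom map 0 (fun=> 0).
Proof.
have /sc_derivP[_ _ _ h] := @lp_dmap0 _ _ _ _ _ L.
apply/sc_derivP; split.
- by move=> _ _; exact: sc_level0.
- by move=> a _ _ _ _; rewrite scaler0 addr0.
- by exists 0 => // q _; rewrite sc_normr0 mul0r.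
- move=> e e0; have [C C0 hC] := mulmxr_bound T.
  have [d d0 hd] := h (e / C) (divr_gt0 e0 C0).
  exists (d / C); first exact: divr_gt0.
  move=> q _; rewrite sc_norm_const => qd; rewrite /dom /map /= !add0r mul0mx => Lq.
  have := hd (q *m T) (sc_level_const _ _).
  rewrite sc_norm_const !add0r => /(_ _ Lq).
  have qTd : `|q *m T| < d.
    by apply: le_lt_trans (hC q) _; rewrite mulrC -ltr_pdivlMr.
  move=> /(_ qTd)/le_trans; apply.
  by rewrite -mulrA ler_wpM2l ?(ltW e0)// mulrC ler_pdivrMr // mulrC.
Qed.

Let pt (q : 'rV[R]_n) : X := ch_inv (c := c) (lin' q + map q).

Let bij : set_bij dom (M `&` ch_dom c) pt.
Proof.
have [h1 h2 h3] := lp_bij L; split.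
- by move=> q /h1.
- move=> u v /set_mem du /set_mem dv uv; rewrite -(TK u) -(TK v).
  congr (_ *m _); apply: h2; [exact: mem_set|exact: mem_set|exact: uv].
- by move=> x /h3[q Lq qx]; exists (q *m invmx T); rewrite /dom /pt /= /lin /map TVK.
Qed.

Let pt_cont : {within dom, continuous pt}.
Proof.
apply/subspace_continuousP => q dq W nW.
have /subspace_continuousP/(_ _ dq W nW) := @lp_pt_cont _ _ _ _ _ L.
by move=> h; exact: (@mulmxr_continuous T q _ h).
Qed.

Let coord_cont : exists g : X -> 'rV[R]_n,
  {within M `&` ch_dom c, continuous g} /\ forall q, dom q -> g (pt q) = q.
Proof.
have [g [gc gK]] := lp_coord_cont L.
exists (fun x => g x *m invmx T); split; last first.
  by move=> q dq; rewrite gK // TK.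
apply/subspace_continuousP => x Mx W nW.
have /subspace_continuousP/(_ x Mx) h := gc.
exact: (h _ (@mulmxr_continuous (invmx T) (g x) W nW)).
Qed.

(** Kept transparent, so that the chart of the new parametrization is convertible to
the old one. *)
Definition lp_reparam : local_param P n M.
Proof.
refine (@LocalParam R X P n M c (lp_is_chart L) lin' lin_inj
  (lp_compl (l := L)) good dom dom_open dom0 map map_smooth _ _ dmap0 _
  bij pt_cont coord_cont).
- by move=> q dq; apply: lp_map_compl.
- by rewrite /map mul0mx lp_map0.
- by move=> q dq; apply: (@lp_img _ _ _ _ _ L (q *m T)).
Defined.

Lemma lp_reparam_quadrant : lp_lin lp_reparam @^-1`
    sp_quadrant (ch_spl (lp_chart lp_reparam)) =
  [set q | (lp_lin L @^-1` sp_quadrant (ch_spl (lp_chart L))) (q *m T)].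
Proof. by []. Qed.

Lemma lp_reparam_chart : lp_chart lp_reparam = lp_chart L.
Proof. by []. Qed.

End reparametrization.

Section standard_form.
Variables (R : realType) (X : topologicalType) (P : mpolyfold R X) (n : nat).

(** The local faces of a branch are defined in coordinates in which the cone is
standard; this provides such coordinates without changing the chart. *)
Lemma lp_standard (M : set X) (L : local_param P n M) : (0 < n)%N ->
  exists (L' : local_param P n M) (k : nat), lp_chart L' = lp_chart L /\
    lp_lin L' @^-1` sp_quadrant (ch_spl (lp_chart L')) =
      [set q | forall i : 'I_n, (i < k)%N -> 0 <= q ord0 i].
Proof.
move=> n0; have good := lp_good L.
have [k [T [Tu hT]]] := cone_standard n0 (@face_coord_linear _ _ _ (lp_lin L))
  (face_coord_free (@lp_lin_inj _ _ _ _ _ L) good) (face_cone_interior good).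
exists (lp_reparam L Tu), k; split; first exact: lp_reparam_chart.
rewrite lp_reparam_quadrant; apply/seteqP; split=> q /=.
  by move=> /(quadrant_linP good)/hT.
by move=> /hT/(quadrant_linP good).
Qed.

Lemma lp_center (M : set X) (L : local_param P n M) x :
  ch_dom (lp_chart L) x -> ch_map (lp_chart L) x = 0 -> lp_pt L 0 = x.
Proof. by move=> cx x0; rewrite /lp_pt linear0 lp_map0 addr0 -x0 ch_mapK. Qed.

End standard_form.

(** * Topology of M-polyfolds *)

Section topology.

(** The sets of indices that contain a given finite subfamily generate a filter, to
which the near-covering form of compactness is applied. *)
Lemma compact_finite_subcover (T : topologicalType) (I : Type) (K : set T)
    (D : set I) (f : I -> set T) :
  compact K -> (forall i, D i -> open (f i)) -> K `<=` \bigcup_(i in D) f i ->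
  exists n (g : 'I_n -> I), (forall j, D (g j)) /\ K `<=` \bigcup_j f (g j).
Proof.
move=> /compact_near_coveringP cK fo Kf.
pose F : set_system (set I) :=
  [set A | exists n (g : 'I_n -> I), (forall j, D (g j)) /\
     forall D1, range g `<=` D1 -> A D1].
have FF : Filter F.
  split.
  - by exists 0%N, (fun j : 'I_0 => False_rect I (notF (ltn_ord j))); split=> // -[].
  - move=> A B [n1 [g1 [s1 h1]]] [n2 [g2 [s2 h2]]]; exists (n1 + n2)%N.
    exists (fun j : 'I_(n1 + n2) => match fintype.split j with inl k => g1 k | inr k => g2 k end).
    split; first by move=> j; case: fintype.split.
    move=> D3 D3r; split; [apply: h1|apply: h2] => _ [k _ <-]; apply: D3r.
      by exists (lshift n2 k) => //; rewrite (unsplitK (inl k)).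
    by exists (rshift n1 k) => //; rewrite (unsplitK (inr k)).
  - move=> A B AB [n1 [g1 [s1 h1]]]; exists n1, g1; split=> // D2 /h1; exact: AB.
have := cK _ F (fun D1 x => (\bigcup_(i in D1) f i) x) FF; case.
  move=> x /Kf[i Di fix_].
  exists (f i, [set D1 | D1 i]) => /=.
    split; first by apply: open_nbhs_nbhs; split=> //; exact: fo.
    exists 1%N, (fun=> i); split=> // D1; apply.
    by exists ord0.
  by move=> [x' D1] /= [fx' D1i]; exists i.
move=> n [g [Dg hg]]; exists n, g; split=> // x /(hg _ (@subset_refl _ _)).
by move=> [_ [j _ <-] fx]; exists j.
Qed.

Lemma hausdorff_separate (T : topologicalType) (x y : T) :
  hausdorff_space T -> x <> y ->
  exists A B, [/\ open A, open B, A x, B y & A `&` B = set0].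
Proof.
rewrite open_hausdorff => h /eqP/h[[A B] /= [Ax By] [oA oB /eqP AB]].
by exists A, B; split=> //; exact: set_mem.
Qed.

(** Every point outside U has an open neighbourhood B whose closure misses x. Refine
the cover by these B and by U to a locally finite one; near x only finitely many
members not contained in U matter, and their closures miss x. *)
Lemma paracompact_regular (T : topologicalType) (x : T) (U : set T) :
  paracompact T -> hausdorff_space T -> open U -> U x ->
  exists V, [/\ open V, V x & closure V `<=` U].
Proof.
move=> pT hT oU Ux.
(* the second kind of member is what Hausdorff separation provides *)
pose C : set (set T) := [set B | B = U \/ (open B /\ ~ closure B x)].
have oC : C `<=` open by move=> B [->//|[]].
have cC : \bigcup_(B in C) B = setT.
  rewrite -subTset => y _; have [Uy|nUy] := pselect (U y).
    by exists U => //; left.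
  have xy : x <> y by move=> e; apply: nUy; rewrite -e.
  have [A [B [oA oB Ax By AB]]] := hausdorff_separate hT xy.
  exists B => //; right; split=> // /(_ A (open_nbhs_nbhs (conj oA Ax))).
  by rewrite setIC AB => -[].
have [C' [oC' cC' rC' lf]] := pT C oC cC.
have [N nN fN] := lf x.
pose D := [set A | C' A /\ A `&` N !=set0].
pose bad := [set A | C' A /\ ~ A `<=` U].
have badx A : bad A -> ~ closure A x.
  move=> [C'A nAU] cAx; have [B [->//|[_ nBx]] AB] := rC' A C'A.
  by apply: nBx; apply: closure_subset AB _ cAx.
pose V := N° `&` ~` \bigcup_(A in D `&` bad) closure A.
exists V; split.
- apply: openI; first exact: open_interior.
  apply: closed_openC; apply: closed_bigcup.
    by apply: sub_finite_set fN; exact: subIsetl.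
  by move=> A _; exact: closed_closure.
- split; first exact: nN.
  by move=> [A [_ bA]]; exact: badx.
- move=> y cVy; apply: contrapT => nUy.
  have [A C'A Ay] : (\bigcup_(A in C') A) y by rewrite cC'.
  have bA : bad A by split=> // /(_ y Ay).
  have [z [[Nz nz] Az]] := cVy A (open_nbhs_nbhs (conj (oC' _ C'A) Ay)).
  apply: nz; exists A; last exact: subset_closure.
  split=> //; split=> //; exists z; split=> //; exact: interior_subset.
Qed.

Lemma compact_sequence (T : topologicalType) (v : T) (z : nat -> T) :
  (forall N, nbhs v N -> exists k0, forall k, (k0 <= k)%N -> N (z k)) ->
  compact ([set v] `|` range z).
Proof.
move=> hz; apply/compact_near_coveringP => J F P FF hP.
have [[N A] /= [nN FA] NA] := hP v (or_introl erefl).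
have [k0 hk0] := hz N nN.
have fin : \forall i \near F, forall k : 'I_k0, P i (z k).
  apply: filter_forall => k; have := hP (z k) (or_intror (imageP z (I : setT _))).
  move=> [[N' A'] /= [nN' FA'] NA']; apply: filterS FA' => i A'i.
  by apply: (NA' (z k, i)); split=> //; exact: nbhs_singleton.
apply: filterS2 FA fin => i Ai fi x [->|[k _ <-]].
  by apply: (NA (v, i)); split=> //; exact: nbhs_singleton.
have [kk|kk] := leqP k0 k; last exact: (fi (Ordinal kk)).
by apply: (NA (z k, i)); split=> //; exact: hk0.
Qed.

End topology.

Section mpolyfold_topology.
Variables (R : realType) (X : topologicalType) (P : mpolyfold R X).

Lemma chart_near c x (W : set X) : ch_dom c x -> nbhs x W ->
  exists2 d : R, 0 < d & forall y, ch_dom c y ->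
    sc_norm 0 (ch_map c y - ch_map c x) < d -> W y.
Proof.
move=> cx nW; have oW := @open_interior _ W.
have := rel_open_ball (@sp_core_level0 _ (ch_spl c)) (chart_image_open c oW).
move=> /(_ (ch_map c x))[].
  by exists x.
move=> d d0 hd; exists d => // y cy /(hd _ (chart_map_core cy))[y' [cy' Wy'] yy'].
have <- : y' = y by rewrite -(ch_mapK cy) -yy' ch_mapK.
exact: interior_subset.
Qed.

Lemma chart_nbhs (c : chart R X) x (d : R) : ch_dom c x -> 0 < d ->
  nbhs x [set y | ch_dom c y /\ sc_norm 0 (ch_map c y - ch_map c x) < d].
Proof.
move=> cx d0; have := @ch_map_cont _ _ c.
rewrite continuous_open_subspace; last exact: ch_dom_open.
move=> /(_ x (mem_set cx)) /cvgrPdist_lt/(_ d d0) h.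
apply: filterS2 h (open_nbhs_nbhs (conj (ch_dom_open c) cx)) => y h cy.
split=> //; have := sp_core_level0 (chart_map_core cy) => ly.
have := sp_core_level0 (chart_map_core cx) => lx.
rewrite /sc_norm sc_atB // distrC; exact: h.
Qed.

(** Charts make X first countable, so a point v adherent to M is the limit of a
sequence in M; the sequence together with v is compact in U, and properness
makes its trace on M compact, hence closed. *)
Lemma mp_separate (U M : set X) v :
  (forall K, K `<=` U -> compact K -> compact (M `&` K)) -> M `<=` U ->
  U v -> ~ M v -> exists2 N, nbhs v N & N `&` M = set0.
Proof.
move=> Mp MU Uv nMv; apply: contrapT => nN.
have [c Pc cv] := mp_cover P v.
pose B k := [set y | ch_dom c y /\ sc_norm 0 (ch_map c y - ch_map c v) < k.+1%:R^-1].
have nB k : nbhs v (B k) by apply: chart_nbhs; rewrite ?invr_gt0 ?ltr0n.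
have /choice[z hz] : forall k, exists z, B k z /\ M z.
  move=> k; apply: contrapT => h; apply: nN; exists (B k) => //.
  by apply/seteqP; split=> // y [By My]; apply: h; exists y.
have hz' N : nbhs v N -> exists k0, forall k, (k0 <= k)%N -> N (z k).
  move=> nN'; have [d d0 hd] := chart_near cv nN'.
  exists (Num.truncn d^-1) => k kk; have [[cz zv] _] := hz k.
  apply: hd => //; apply: lt_le_trans zv _.
  rewrite invf_ple ?posrE// ltW// (lt_le_trans (truncnS_gt _))//.
  by rewrite ler_nat ltnS.
have cK := compact_sequence hz'.
have cMK : compact (M `&` ([set v] `|` range z)).
  apply: Mp cK => y [->//|[k _ <-]]; apply: MU; exact: (hz k).2.
apply: nMv; have /(_ v)[//|//] := compact_closed (mp_hausdorff P) cMK.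
move=> N /hz'[k0 /(_ k0 (leqnn _)) Nk]; exists (z k0); split=> //; split.
  exact: (hz k0).2.
by right; exists k0.
Qed.

End mpolyfold_topology.

(** * Isotropy and orbits of ep-groupoids *)

Section local_inverse.
Variables (R : realType) (X Y : topologicalType).
Variables (P : mpolyfold R X) (Q : mpolyfold R Y).

Lemma local_diffeo_inverse (f : X -> Y) x : mp_local_diffeo P Q f ->
  exists (U : set X) (V : set Y) (g : Y -> X),
    [/\ open U /\ U x, open V, mp_smooth P Q U f /\ mp_smooth Q P V g,
        forall x, U x -> V (f x) /\ g (f x) = x &
        forall y, V y -> U (g y) /\ f (g y) = y].
Proof.
move=> /(_ x)[U [V [Ux [oU oV UV fs [g [gs gK]]]]]]; exists U, V, g; split=> //.
  by move=> u Uu; split; [rewrite -UV; exists u|exact: gK].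
by move=> y; rewrite -{1}UV => -[u Uu <-]; rewrite gK.
Qed.

End local_inverse.

Section groupoid.
Variables (R : realType) (X M : topologicalType) (G : ep_groupoid R X M).
Let PX := ep_obj G.
Let PM := ep_mor G.

Lemma orbitP x y : Defs.orbit G x = Defs.orbit G y <->
  exists g, ep_src G g = x /\ ep_tgt G g = y.
Proof.
split=> [/eqquotP/asboolP//|h].
by apply/eqquotP; exact/asboolP.
Qed.

Lemma src_open (V : set X) : open V -> open (ep_src G @^-1` V).
Proof.
move=> oV; rewrite -[_ @^-1` _]setTI; apply: smooth_preimage_open oV _.
  exact: openT.
by have [] := ep_src_smooth G.
Qed.

Lemma tgt_open (V : set X) : open V -> open (ep_tgt G @^-1` V).
Proof.
move=> oV; rewrite -[_ @^-1` _]setTI; apply: smooth_preimage_open oV _.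
  exact: openT.
by have [] := ep_tgt_smooth G.
Qed.

(** The target map is a local homeomorphism. *)
Lemma tgt_image_open (N : set M) : open N -> open (ep_tgt G @` N).
Proof.
move=> oN; rewrite openE => _ [h Nh <-].
have [U [V [g [[oU Uh] oV [_ [gc _]] fK gK]]]] :=
  local_diffeo_inverse h (proj2 (ep_tgt_etale G)).
have [Vh gh] := fK _ Uh.
have oVN : open (V `&` g @^-1` N) by exact: smooth_preimage_open.
have : nbhs (ep_tgt G h) (V `&` g @^-1` N).
  by apply: open_nbhs_nbhs; split=> //; split=> //=; rewrite gh.
apply: filterS => y [Vy Ny]; exists (g y) => //.
by have [] := gK _ Vy.
Qed.

Lemma orbit_open (W : set X) : open W -> open (Defs.orbit G @` W).
Proof.
move=> oW; have : open (ep_tgt G @` (ep_src G @^-1` W)).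
  by apply: tgt_image_open; exact: src_open.
suff -> : ep_tgt G @` (ep_src G @^-1` W) =
    Defs.orbit G @^-1` (Defs.orbit G @` W) by [].
apply/seteqP; split=> [_ [h Wh <-]|y [w Ww /orbitP[h [hw hy]]]].
  exists (ep_src G h) => //; apply/orbitP; by exists h.
by exists h => //=; rewrite hw.
Qed.

Lemma src_infty h : mp_infty PX (ep_src G h) -> mp_infty PM h.
Proof.
move=> xinf; have [U [V [g [[oU Uh] oV [_ gs] fK gK]]]] :=
  local_diffeo_inverse h (proj2 (ep_src_etale G)).
have [Vh gh] := fK _ Uh; rewrite -gh.
exact: smooth_infty oV gs Vh xinf.
Qed.

Lemma tgt_infty h : mp_infty PX (ep_src G h) -> mp_infty PX (ep_tgt G h).
Proof.
move=> /src_infty; apply: smooth_infty (ep_tgt_smooth G) _ => //.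
exact: openT.
Qed.

(** The morphism space serves as an intermediate M-polyfold: h is a boundary point
of it whenever its source is one, and then so is its target. *)
Lemma src_boundary h : mp_infty PX (ep_src G h) ->
  mp_boundary PX (ep_src G h) -> mp_boundary PX (ep_tgt G h).
Proof.
move=> xinf bx; have hinf := src_infty xinf.
have [U [V [g [[oU Uh] oV [fs gs] fK gK]]]] :=
  local_diffeo_inverse h (proj2 (ep_src_etale G)).
have bh : mp_boundary PM h by exact: diffeo_boundary fs gs fK gK Uh hinf bx.
have [U' [V' [g' [[oU' Uh'] oV' [fs' gs'] fK' gK']]]] :=
  local_diffeo_inverse h (proj2 (ep_tgt_etale G)).
have [Vh' gh'] := fK' _ Uh'.
apply: (diffeo_boundary oV' oU' gs' fs' gK' fK' Vh').
  exact: tgt_infty.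
by rewrite gh'.
Qed.

(** The isotropy group is compact by properness, and discrete because the source map
is locally injective. *)
Lemma isotropy_finite x : finite_set (isotropy G x).
Proof.
have [V [oV Vx pV]] := ep_proper G x.
have clx : closed [set x].
  apply: accessible_closed_set1; apply: hausdorff_accessible.
  exact: mp_hausdorff PX.
have cK : compact (ep_src G @^-1` closure V `&` ep_tgt G @^-1` [set x]).
  by apply: pV; exact: compact_set1.
have cI : compact (isotropy G x).
  have -> : isotropy G x =
      (ep_src G @^-1` closure V `&` ep_tgt G @^-1` [set x]) `&`
      ep_src G @^-1` [set x].
    apply/seteqP; split=> [g [sg tg]|g [[_ tg] sg]]; last by split.
    by split=> //; split=> //=; rewrite sg; exact: subset_closure.
  apply: compact_closedI => //.
  rewrite -[ep_src G @^-1` _]setCK; apply: open_closedC.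
  exact: (src_open (closed_openC clx)).
have /choice[U hU] : forall h, exists U : set M,
    [/\ open U, U h & forall k, U k -> ep_src G k = ep_src G h -> k = h].
  move=> h; have [U [V' [g [[oU Uh] _ _ fK _]]]] :=
    local_diffeo_inverse h (proj2 (ep_src_etale G)).
  exists U; split=> // k Uk e.
  by have [_ <-] := fK _ Uk; have [_ <-] := fK _ Uh; rewrite e.
have := @compact_finite_subcover _ _ _ (isotropy G x) U cI; case.
- by move=> h _; have [] := hU h.
- by move=> h Ih; exists h => //; have [] := hU h.
move=> n [p [DI cov]]; apply: (@sub_finite_set _ _ (range p)).
  move=> g Ig; have [j _ Ug] := cov g Ig; have [_ _ hk] := hU (p j).
  exists j => //; apply/esym/hk => //; have [-> _] := DI j; by have [] := Ig.
exact/finite_image/finite_finset.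
Qed.

Lemma unit_isotropy x : isotropy G x (ep_unit G x).
Proof. by split; [exact: ep_src_unit|exact: ep_tgt_unit]. Qed.

Lemma comp_isotropy x g h : isotropy G x g -> isotropy G x h ->
  isotropy G x (ep_comp G g h).
Proof.
move=> [sg tg] [sh th]; have e : ep_src G g = ep_tgt G h by rewrite sg th.
by split; rewrite ?ep_src_comp ?ep_tgt_comp.
Qed.

Lemma inv_isotropy x g : isotropy G x g -> isotropy G x (ep_inv G g).
Proof. by move=> [sg tg]; split; rewrite ?ep_src_inv ?ep_tgt_inv. Qed.

Lemma comp_inv_isotropy x g : isotropy G x g ->
  ep_comp G g (ep_inv G g) = ep_unit G x.
Proof. by move=> [_ tg]; rewrite ep_compgV tg. Qed.

Section invariant_neighbourhood.
Variables (x : X) (U : set X) (N : natural_rep G x U).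

Let phi := nr_act N.

Let phi_U g y : isotropy G x g -> U y -> U (phi g y).
Proof.
move=> Ig Uy; have [_ _ UU _ _] := nr_diffeo N Ig.
have : (phi g @` U) (phi g y) by exists y.
by rewrite UU.
Qed.

(* phi 1 is idempotent and injective *)
Let phi1 y : U y -> phi (ep_unit G x) y = y.
Proof.
move=> Uy; have I1 := unit_isotropy x.
have [_ _ _ _ [g [_ gK]]] := nr_diffeo N I1.
have := nr_comp N I1 I1 Uy.
have -> : ep_comp G (ep_unit G x) (ep_unit G x) = ep_unit G x.
  by have := @ep_comp1g _ _ _ G (ep_unit G x); rewrite ep_tgt_unit.
move=> /(congr1 g); rewrite gK // => e; rewrite {2}e.
by rewrite gK //; exact: phi_U.
Qed.

(** Start from a small neighbourhood given by regularity and intersect its preimages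
under the finitely many maps of the natural representation. *)
Lemma invariant_neighbourhood : exists V, [/\ open V, V x, closure V `<=` U &
  forall g, isotropy G x g -> nr_act N g @` V = V].
Proof.
have oU := nr_open N; have Ux := nr_mem N.
have [V' [oV' V'x cV']] := paracompact_regular (mp_paracompact PX)
  (mp_hausdorff PX) oU Ux.
pose W := U `&` [set y | forall g, isotropy G x g -> V' (phi g y)].
have oW : open W.
  have -> : W = U `&` ~` \bigcup_(g in isotropy G x) ~` (U `&` phi g @^-1` V').
    apply/seteqP; split=> y [Uy Wy]; split=> //.
      by move=> [g Ig]; apply; split=> //; exact: Wy.
    move=> g Ig; apply: contrapT => nV; apply: Wy; exists g => //.
    by move=> [].
  apply: openI => //; apply: closed_openC; apply: closed_bigcup.
    exact: isotropy_finite.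
  move=> g Ig; apply: open_closedC; apply: smooth_preimage_open => //.
  by have [_ _ _ [fc _] _] := nr_diffeo N Ig; exact: fc.
have WW g y : isotropy G x g -> W y -> W (phi g y).
  move=> Ig [Uy Wy]; split; first exact: phi_U.
  move=> h Ih; rewrite /phi -(nr_comp N) //; apply: Wy.
  exact: comp_isotropy.
exists W; split=> //.
- split=> // g Ig; have := nr_tgt N Ig Ux.
  by rewrite nr_Gamma_x // => e; rewrite /phi -e; have [_ ->] := Ig.
- apply: subset_trans cV'; apply: closure_subset => y [Uy Wy].
  by rewrite -(phi1 Uy); apply: Wy; exact: unit_isotropy.
- move=> g Ig; apply/seteqP; split=> [_ [y Wy <-]|y Wy]; first exact: WW.
  exists (phi (ep_inv G g) y); first by apply: WW Wy; exact: inv_isotropy.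
  have [Uy _] := Wy.
  rewrite /phi -(nr_comp N) //; last exact: inv_isotropy.
  by rewrite (comp_inv_isotropy Ig); exact: phi1.
Qed.

End invariant_neighbourhood.

End groupoid.

(** * Support and boundary of a branched ep-subgroupoid *)

Section branched.
Variables (R : realType) (X M : topologicalType) (G : ep_groupoid R X M).
Variable Theta : X -> rat.
Hypothesis branched : branched_ep_subgroupoid G Theta.
Let PX := ep_obj G.

Lemma supp_infty x : supp Theta x -> mp_infty PX x.
Proof. by have [_ _ h _] := branched; exact: h. Qed.

Lemma supp_orbit x y : Defs.orbit G x = Defs.orbit G y ->
  supp Theta x -> supp Theta y.
Proof.
by move=> /orbitP[h [<- <-]]; have [_ e _ _] := branched; rewrite /supp /= e.
Qed.

Lemma boundary_orbit x y : Defs.orbit G x = Defs.orbit G y -> supp Theta x ->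
  mp_boundary PX x -> mp_boundary PX y.
Proof.
move=> /orbitP[h [<- <-]] /supp_infty; exact: src_boundary.
Qed.

Lemma orbit_suppP x : orbit_supp G Theta (Defs.orbit G x) <-> supp Theta x.
Proof. by split=> [[y sy /supp_orbit]|sx]; [apply|exists x]. Qed.

(** The support and its boundary points are unions of orbits, so membership in S
and its boundary can be tested on any representative. *)
Lemma orbit_supp_boundaryP x : orbit_supp_boundary G Theta (Defs.orbit G x) <->
  supp Theta x /\ mp_boundary PX x.
Proof.
split=> [[y [sy by_ e]]|[sx bx]]; last by exists x.
by split; [exact: supp_orbit e sy|exact: boundary_orbit e sy by_].
Qed.

Lemma nonboundary_near x : mp_infty PX x -> ~ mp_boundary PX x ->
  exists W, [/\ open W, W x &
    forall y, W y -> mp_infty PX y -> ~ mp_boundary PX y].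
Proof.
move=> Px nbx; have [c Pc cx] := mp_cover PX x.
have xpos : forall i, 0 < qd_coord (C := sp_quad (ch_spl c)) i (ch_map c x).1.
  apply/degeneracyP => //; apply: contrapT => dg; apply: nbx.
  exact/(boundary_chart Px (atlas_chart Pc) cx).
have [K K0 hK] := qd_coord_bound (sp_quad (ch_spl c)).
pose d := \big[Num.min/1]_i qd_coord (C := sp_quad (ch_spl c)) i (ch_map c x).1.
have d0 : 0 < d by apply: (big_ind (fun x => 0 < x)) => // u v u0 v0; rewrite lt_min u0.
have nW := chart_nbhs cx (divr_gt0 d0 K0).
exists ([set y | ch_dom c y /\ sc_norm 0 (ch_map c y - ch_map c x) < d / K]°).
split; [exact: open_interior|exact: nW|].
move=> y /interior_subset[cy yd] Py.
move/(boundary_chart Py (atlas_chart Pc) cy); apply.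
apply/degeneracyP => // i.
have := sp_core_level0 (chart_map_core cy) => ly.
have := sp_core_level0 (chart_map_core cx) => lx.
have lyx := sc_levelB ly lx; have [lyx1 _] := proj1 (sc_level_pair _ _) lyx.
have di : d <= qd_coord (C := sp_quad (ch_spl c)) i (ch_map c x).1.
  exact: bigmin_le_cond.
have := hK i _ lyx1.
have -> : (ch_map c y - ch_map c x).1 = (-1) *: (ch_map c x).1 + (ch_map c y).1.
  by rewrite scaleN1r addrC.
rewrite qd_coord_linear => h.
have : `|-1 * qd_coord (C := sp_quad (ch_spl c)) i (ch_map c x).1 +
    qd_coord (C := sp_quad (ch_spl c)) i (ch_map c y).1| < d.
  apply: le_lt_trans h _; apply: le_lt_trans (_ : K * sc_norm 0 (ch_map c y - ch_map c x) < d).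
    rewrite ler_pM2l // [leRHS]sc_norm_pair // le_max; apply/orP; left.
    by rewrite scaleN1r addrC.
  by rewrite mulrC -ltr_pdivlMr.
rewrite ltr_norml => /andP[h1 _]; lra.
Qed.

Lemma compact_boundary : compact (orbit_supp G Theta) ->
  compact (orbit_supp_boundary G Theta).
Proof.
move=> cS.
(* the largest open set whose smooth points are interior *)
pose W := \bigcup_(W in [set W | open W /\
  forall y, W y -> mp_infty PX y -> ~ mp_boundary PX y]) W.
have oW : open W by apply: bigcup_open => ? [].
have -> : orbit_supp_boundary G Theta =
    orbit_supp G Theta `&` ~` (Defs.orbit G @` W).
  apply/seteqP; split=> [_ [x [sx bx] <-]|_ [[x sx <-] nW]].
    split; first by exists x.
    move=> [y [V [oV hV] Vy] e].
    have sy : supp Theta y by apply: supp_orbit sx.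
    apply: (hV y Vy); first exact: supp_infty.
    exact: boundary_orbit (esym e) sx bx.
  apply/orbit_supp_boundaryP; split=> //; apply: contrapT => nbx; apply: nW.
  have [V [oV Vx hV]] := nonboundary_near (supp_infty sx) nbx.
  by exists x => //; exists V.
by apply: compact_closedI => //; apply: open_closedC; exact: orbit_open.
Qed.

(** One entry of a branched cover, bundled so that compactness can select finitely
many patches over different points. *)
Record branching_patch := BranchingPatch {
  pa_pt : X;
  pa_U : set X;
  pa_V : set X;
  pa_supp : supp Theta pa_pt;
  pa_rep : natural_rep G pa_pt pa_U;
  pa_branching : local_branching G Theta pa_U;
  pa_V_open : open pa_V;
  pa_V_pt : pa_V pa_pt;
  pa_V_closure : closure pa_V `<=` pa_U;
  pa_V_invariant : forall g, isotropy G pa_pt g ->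
    nr_act pa_rep g @` pa_V = pa_V
}.

Lemma branched_cover_exists : compact (orbit_supp G Theta) ->
  inhabited (branched_cover G Theta).
Proof.
move=> cS; have [_ _ _ loc] := branched.
have := @compact_finite_subcover _ branching_patch _ setT
  (fun p => Defs.orbit G @` pa_V p) cS; case.
- by move=> p _; apply: orbit_open; exact: pa_V_open.
- move=> _ [x sx <-]; have [U [[N] [B]]] := loc x sx.
  have [V [oV Vx cV iV]] := invariant_neighbourhood N.
  by exists (BranchingPatch sx B oV Vx cV iV) => //; exists x.
move=> n [p [_ cov]]; constructor.
exact: (@BranchedCover R X M G Theta n (fun a => pa_pt (p a))
  (fun a => pa_U (p a)) (fun a => pa_V (p a)) (fun a => pa_supp (p a))
  (fun a => pa_rep (p a)) (fun a => pa_branching (p a))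
  (fun a => @pa_V_open (p a)) (fun a => @pa_V_pt (p a))
  (fun a => @pa_V_closure (p a)) (fun a => @pa_V_invariant (p a)) cov).
Qed.

End branched.

(** * Morphisms in local coordinates *)

Section pointwise_lipschitz.
Variables (R : realType) (n : nat) (Z : set 'rV[R]_n) (q0 : 'rV[R]_n).
Hypothesis Zq0 : Z q0.

(** Properties of the points of Z close to q0; Z will be a set of parameters with no
structure at all. *)
Definition eventually_near (A : set 'rV[R]_n) : Prop :=
  exists2 d : R, 0 < d & forall q, Z q -> `|q - q0| < d -> A q.

Lemma eventually_nearI A B :
  eventually_near A -> eventually_near B -> eventually_near (A `&` B).
Proof.
move=> [d d0 hd] [e e0 he]; exists (Num.min d e); first by rewrite lt_min d0.
by move=> q Zq; rewrite lt_min => /andP[qd qe]; split; [exact: hd|exact: he].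
Qed.

Lemma eventually_nearS A B : A `<=` B -> eventually_near A -> eventually_near B.
Proof. by move=> AB [d d0 hd]; exists d => // q Zq /hd qA; exact/AB/qA. Qed.

Lemma eventually_near_at A : eventually_near A -> A q0.
Proof. by move=> [d d0 hd]; apply: hd => //; rewrite subrr normr0. Qed.

(** Asking for all levels at once makes the loss of one level in [lip_at_core]
invisible, so that transitions can be chained freely. *)
Definition lip_at (E : scBanach R) (v : 'rV[R]_n -> E) : Prop :=
  forall m, exists C : R, eventually_near
    [set q | sc_norm m (v q - v q0) <= C * `|q - q0|].

Lemma lip_at_core (S : splicing R) (F : scBanach R) (O : set (sp_space S))
    (f : sp_space S -> F) (v : 'rV[R]_n -> sp_space S) (w : 'rV[R]_n -> F) :
  core_smooth O f -> O `<=` sp_core S ->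
  eventually_near
    [set q | [/\ O (v q), sc_infty (sp_space S) (v q) & w q = f (v q)]] ->
  lip_at v -> lip_at w.
Proof.
move=> fs Oc hO vl m.
have [Ov0 v0inf w0] := eventually_near_at hO.
have [C1 [d1 [d10 h1]]] := core_smooth_lipschitz fs Oc Ov0 (v0inf m.+1 I).
have [C2 h2] := vl m.+1.
have C20 : 0 < `|C2| + 1 by rewrite ltr_wpDl.
have hd : eventually_near [set q | `|q - q0| < d1 / (`|C2| + 1)].
  by exists (d1 / (`|C2| + 1)) => //; rewrite divr_gt0.
exists (`|C1| * (`|C2| + 1)).
have := eventually_nearI (eventually_nearI hO h2) hd.
apply: eventually_nearS => q [[[Oq qinf wq] q2] qd] /=.
have q2' : sc_norm m.+1 (v q - v q0) <= (`|C2| + 1) * `|q - q0|.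
  apply: le_trans q2 _; rewrite ler_wpM2r // (le_trans (ler_norm _)) //.
  by rewrite lerDl.
rewrite wq w0; apply: le_trans (h1 _ (qinf m.+1 I) Oq _) _.
  by apply: le_lt_trans q2' _; rewrite mulrC -ltr_pdivlMr.
rewrite -mulrA; apply: le_trans (_ : `|C1| * sc_norm m.+1 (v q - v q0) <= _).
  by rewrite ler_wpM2r ?sc_norm_ge0 // ler_norm.
by rewrite ler_wpM2l.
Qed.

Lemma lip_at_chart (X Y : topologicalType) (P : mpolyfold R X)
    (c : chart R X) (d : chart R Y) (D : set X) (f : X -> Y)
    (u : 'rV[R]_n -> X) :
  core_smooth (ch_map c @` D) (ch_map d \o f \o ch_inv (c := c)) ->
  D `<=` ch_dom c -> mp_chart P c ->
  eventually_near [set q | D (u q) /\ mp_infty P (u q)] ->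
  lip_at (ch_map c \o u) -> lip_at (ch_map d \o (f \o u)).
Proof.
move=> fs Dc Pc hD; apply: lip_at_core fs _ _.
  by move=> _ [x /Dc cx <-]; exact: chart_map_core.
apply: eventually_nearS hD => q [Dq Pq]; split.
- by exists (u q).
- exact: infty_chart Pq Pc (Dc _ Dq).
- by rewrite /= ch_mapK //; exact: Dc.
Qed.

End pointwise_lipschitz.

Section local_morphisms.
Variables (R : realType) (X M : topologicalType) (G : ep_groupoid R X M).
Let PX := ep_obj G.
Let PM := ep_mor G.

(** psi preserves the pointwise Lipschitz property of maps into X, whatever charts
are used before and after. *)
Definition lip_transport (W : set X) (psi : X -> X) : Prop :=
  forall n (Z : set 'rV[R]_n) q0 (u : 'rV[R]_n -> X) (c c' : chart R X),
    Z q0 -> mp_chart PX c -> mp_chart PX c' -> W (u q0) -> ch_dom c (u q0) ->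
    ch_dom c' (psi (u q0)) -> (forall q, Z q -> mp_infty PX (u q)) ->
    (forall N, nbhs (u q0) N -> eventually_near Z q0 [set q | N (u q)]) ->
    lip_at Z q0 (ch_map c \o u) -> lip_at Z q0 (ch_map c' \o (psi \o u)).

(** psi is the target map after a local inverse of the source map, and phi the
reverse. In coordinates psi is a chain of four transitions: to an atlas chart
around the source, to the morphism space, to an atlas chart around the target,
and to the final chart. *)
Lemma local_morphism h : exists (W W' : set X) (psi phi : X -> X),
  [/\ [/\ open W, W (ep_src G h) & psi (ep_src G h) = ep_tgt G h],
      [/\ open W', W' (ep_tgt G h), phi (ep_tgt G h) = ep_src G h &
        {within W', continuous phi}],
      forall x, W x -> W' (psi x) /\ phi (psi x) = x,
      forall y, W' y -> [/\ W (phi y), psi (phi y) = y &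
        Defs.orbit G (phi y) = Defs.orbit G y] &
      lip_transport W psi].
Proof.
have [U [V [sig [[oU Uh] oV [[ssc sss] [sc sigs]] sK sV]]]] :=
  local_diffeo_inverse h (proj2 (ep_src_etale G)).
have [U' [V' [tau [[oU' Uh'] oV' [_ [tc taus]] tK tV]]]] :=
  local_diffeo_inverse h (proj2 (ep_tgt_etale G)).
have [Vsh sigh] := sK _ Uh; have [Vth tauh] := tK _ Uh'.
pose W := V `&` sig @^-1` U'; pose W' := V' `&` tau @^-1` U.
have oW : open W by exact: smooth_preimage_open.
have oW' : open W' by exact: smooth_preimage_open.
exists W, W', (ep_tgt G \o sig), (ep_src G \o tau); split.
- by split=> //=; [split=> //=; rewrite sigh|rewrite sigh].
- split=> //=; [split=> //=; rewrite tauh //|by rewrite tauh|].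
  apply/subspace_continuousP => y [Vy Uy] N nN.
  have oN := @open_interior _ N.
  have : nbhs y (V' `&` tau @^-1` (ep_src G @^-1` N°)).
    apply: open_nbhs_nbhs; split; last by split.
    apply: smooth_preimage_open => //; exact: src_open.
  by apply: filterS => z [_ sz] _; exact: (interior_subset sz).
- move=> x [Vx Ux] /=; have [Usx ssx] := sV _ Vx; have [V'x tx] := tK _ Ux.
  by split; [split=> //=; rewrite tx|rewrite tx].
- move=> y [Vy Uy] /=; have [Uty tty] := tV _ Vy; have [Vy' sy] := sK _ Uy.
  split; [by split=> //=; rewrite sy|by rewrite sy|].
  by apply/orbitP; exists (tau y).
- move=> n Z q0 u c c' Zq0 Pc Pc' [Vu U'u] cu c'u uinf ucont ulip.
  have near_open N : open N -> N (u q0) -> eventually_near Z q0 [set q | N (u q)].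
    by move=> oN Nu; apply: ucont; exact: open_nbhs_nbhs.
  have [d1 Pd1 d1u] := mp_cover PX (u q0).
  have [e Pe eu] := mp_cover PM (sig (u q0)).
  have [d2 Pd2 d2u] := mp_cover PX (ep_tgt G (sig (u q0))).
  have nZ : eventually_near Z q0 [set q | mp_infty PX (u q)].
    by exists 1 => // q /uinf.
  have tgtc : {within setT, continuous (ep_tgt G)} by have [] := ep_tgt_smooth G.
  have l1 : lip_at Z q0 (ch_map d1 \o u).
    apply: (@lip_at_chart _ _ _ _ Zq0 _ _ PX c d1 (ch_dom c `&` ch_dom d1) id u _ _ Pc _ ulip).
    + by have [] := Pc d1 Pd1.
    + by move=> x [].
    + refine (eventually_nearI (near_open (ch_dom c `&` ch_dom d1) _ _) nZ).
        by apply: openI; exact: ch_dom_open.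
      by split.
  have l2 : lip_at Z q0 (ch_map e \o (sig \o u)).
    apply: (lip_at_chart Zq0 (sigs d1 e Pd1 Pe) _ (atlas_chart Pd1) _ l1).
      by move=> x [[]].
    refine (eventually_nearI
      (near_open (ch_dom d1 `&` V `&` sig @^-1` ch_dom e) _ _) nZ);
      last by split.
    rewrite -setIA; apply: openI; first exact: ch_dom_open.
    by apply: smooth_preimage_open => //; exact: ch_dom_open.
  have l3 : lip_at Z q0 (ch_map d2 \o (ep_tgt G \o (sig \o u))).
    apply: (lip_at_chart Zq0 ((proj2 (ep_tgt_smooth G)) e d2 Pe Pd2) _
      (atlas_chart Pe) _ l2).
      by move=> x [[]].
    have oD : open (V `&` sig @^-1` (ch_dom e `&` ep_tgt G @^-1` ch_dom d2)).
      apply: smooth_preimage_open => //; apply: openI; first exact: ch_dom_open.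
      by apply: tgt_open; exact: ch_dom_open.
    have := eventually_nearI (near_open _ oD (conj Vu (conj eu d2u))) nZ.
    apply: eventually_nearS => q [[Vq [eq tq]] qinf].
    by split; [split|apply: smooth_infty oV _ Vq qinf; split].
  apply: (@lip_at_chart _ _ _ _ Zq0 _ _ PX d2 c' (ch_dom d2 `&` ch_dom c') id
    (ep_tgt G \o (sig \o u)) _ _ (atlas_chart Pd2) _ l3).
  + by have [] := Pc' d2 Pd2.
  + by move=> x [].
  + have oD : open (V `&` sig @^-1` (ep_tgt G @^-1` (ch_dom d2 `&` ch_dom c'))).
      apply: smooth_preimage_open => //; apply: tgt_open.
      by apply: openI; exact: ch_dom_open.
    have := eventually_nearI (near_open _ oD (conj Vu (conj d2u c'u))) nZ.
    apply: eventually_nearS => q [[Vq tq] qinf]; split; first exact: tq.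
    by have [Us ss] := sV _ Vq; apply: tgt_infty; rewrite ss.
Qed.

End local_morphisms.

(** * Independence of the choices *)

Section column_removal.
Variables (R : realType) (n : nat) (i : 'I_n).

Lemma col'_norm_le (v : 'rV[R]_n) : `|col' i v| <= `|v|.
Proof. by apply/rV_normP => // j; rewrite mxE; exact: rV_norm_ge. Qed.

(** On a face the omitted coordinate is constant, so distances can be measured
after its omission. *)
Lemma col'_norm_face (v : 'rV[R]_n) : v ord0 i = 0 -> `|v| <= `|col' i v|.
Proof.
move=> vi; apply/rV_normP => // j; have [->|ij] := eqVneq j i.
  by rewrite vi normr0.
have [k ->] : exists k, j = lift i k.
  by have [k ->] := unlift_some (contra_neq (@esym _ _ _) ij); exists k.
have := rV_norm_ge (col' i v) k; rewrite mxE; exact.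
Qed.

Lemma col'B (u v : 'rV[R]_n) : col' i u - col' i v = col' i (u - v).
Proof. by apply/rowP => j; rewrite !mxE. Qed.

End column_removal.

Section transport.
Variables (R : realType) (X M : topologicalType) (G : ep_groupoid R X M).
Let PX := ep_obj G.
Variables (n : nat) (M1 M2 : set X).
Variables (L : local_param PX n M1) (L' : local_param PX n M2).
Variables (W : set X) (psi : X -> X).
Hypothesis psi_lip : lip_transport G W psi.

Let T := [set q | [/\ lp_dom L q, W (lp_pt L q), M2 (psi (lp_pt L q)) &
  ch_dom (lp_chart L') (psi (lp_pt L q))]].

(** The relation between the parameters is defined where psi maps M1 into M2. This
set T need not be open, so only a Lipschitz bound at each of its points can be
expected, and the constant is not uniform. *)
Lemma transport_coordinates : exists kappa : 'rV[R]_n -> 'rV[R]_n,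
  (forall q, T q -> lp_dom L' (kappa q) /\
    lp_pt L' (kappa q) = psi (lp_pt L q)) /\
  forall q0, T q0 -> exists C : R, eventually_near T q0
    [set q | `|kappa q - kappa q0| <= C * `|q - q0|].
Proof.
have /choice[kappa hk] : forall q, exists q', T q ->
    lp_dom L' q' /\ lp_pt L' q' = psi (lp_pt L q).
  move=> q; have [[Lq Wq M2q cq]|nT] := pselect (T q); last by exists 0.
  by have [q' Lq' e] := lp_pt_surj M2q cq; exists q'.
exists kappa; split=> // q0 Tq0; have [Lq0 Wq0 M2q0 cq0] := Tq0.
have [_ c0 _] := lp_ptP Lq0.
have [r r0 hr] := lp_coord_lipschitz L'.
have lipT : lip_at T q0 (ch_map (lp_chart L') \o (psi \o lp_pt L)).
  apply: (psi_lip Tq0 (lp_is_chart L) (lp_is_chart L') Wq0 c0 cq0).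
  - by move=> q [Lq _ _ _]; exact: lp_mp_infty.
  - by move=> N /(lp_pt_near Lq0)[d d0 hd]; exists d => // q [Lq _ _ _]; exact: hd.
  - move=> m; have [C [d [d0 hd]]] := lp_pt_lipschitz m Lq0.
    by exists C, d => // q [Lq _ _ _]; exact: hd.
have [C hC] := lipT 0%N; exists (C / r).
have TT : eventually_near T q0 T by exists 1.
have := eventually_nearI TT hC; apply: eventually_nearS => q [Tq /= hq].
have [Lk ek] := hk q Tq; have [Lk0 ek0] := hk q0 Tq0.
rewrite mulrAC ler_pdivlMr // mulrC; apply: le_trans (hr _ _ Lk Lk0) _.
by rewrite ek ek0.
Qed.

Lemma transport_null (Z : set 'rV[R]_n) : lebesgue_null (Z `&` T) ->
  lebesgue_null [set q' | exists q, [/\ (Z `&` T) q, lp_dom L' q' &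
    lp_pt L' q' = psi (lp_pt L q)]].
Proof.
move=> nZ; have [kappa [hk klip]] := transport_coordinates.
apply: (@null_sub _ _ (kappa @` (Z `&` T))).
  move=> q' [q [ZTq Lq' e]]; exists q => //.
  have [_ Tq] := ZTq; have [Lk ek] := hk q Tq.
  have [_ inj _] := lp_bij L'.
  by apply: inj; rewrite ?inE // ek e.
apply: (null_pointwise_lipschitz (alpha := id)); last by rewrite image_id.
move=> q0 [_ Tq0]; have [C [d d0 hd]] := klip q0 Tq0.
by exists C, d; split=> // q [_ Tq]; exact: hd.
Qed.

Lemma transport_face_null (i j : 'I_n) (Z : set 'rV[R]_n) :
  Z `<=` [set q | q ord0 i = 0] ->
  lebesgue_null (col' i @` (Z `&` T)) ->
  lebesgue_null (col' j @` [set q' | exists q, [/\ (Z `&` T) q, lp_dom L' q' &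
    lp_pt L' q' = psi (lp_pt L q)]]).
Proof.
move=> Zi nZ; have [kappa [hk klip]] := transport_coordinates.
apply: (@null_sub _ _ ((fun q => col' j (kappa q)) @` (Z `&` T))).
  move=> _ [q' [q [ZTq Lq' e]] <-]; exists q => //.
  have [_ Tq] := ZTq; have [Lk ek] := hk q Tq.
  have [_ inj _] := lp_bij L'.
  by congr (col' _ _); apply: inj; rewrite ?inE // ek e.
apply: (null_pointwise_lipschitz (alpha := col' i)) nZ.
move=> q0 [Zq0 Tq0]; have [C [d d0 hd]] := klip q0 Tq0.
exists C, d; split=> // q [Zq Tq].
have e : `|col' i q - col' i q0| = `|q - q0|.
  apply/eqP; rewrite eq_le col'B col'_norm_le col'_norm_face // !mxE.
  by rewrite (Zi _ Zq) (Zi _ Zq0) subrr.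
rewrite e => /(hd q Tq) /=; apply: le_trans.
by rewrite col'B col'_norm_le.
Qed.

End transport.

Section independence.
Variables (R : realType) (X M : topologicalType) (G : ep_groupoid R X M).
Variables (Theta : X -> rat) (n : nat).
Hypothesis branched : branched_ep_subgroupoid G Theta.
Hypothesis dimn : dimensional G Theta n.
Let PX := ep_obj G.
Variable C : branched_cover G Theta.

Lemma branch_sub (a : 'I_(bc_num C)) (i : 'I_(lb_num (bc_branching a))) x :
  lb_branch i x -> supp Theta x /\ bc_U a x.
Proof.
by move=> ix; have := lb_union (bc_branching a) => e; have : (supp Theta `&` bc_U a) x;
  [rewrite e; exists i|].
Qed.

Lemma branch_submanifold (a : 'I_(bc_num C)) (i : 'I_(lb_num (bc_branching a))) :
  submanifold PX n (lb_branch i).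
Proof. exact: (dimn (bc_pt_supp a) (bc_rep a)). Qed.

(** Branches are closed in the patch, so only those through z come near z. *)
Lemma branch_nearby (a : 'I_(bc_num C)) z : supp Theta z -> bc_V a z ->
  \forall z1 \near z, supp Theta z1 -> bc_V a z1 /\
    exists i : 'I_(lb_num (bc_branching a)), lb_branch i z /\ lb_branch i z1.
Proof.
move=> sz Vz; have Uz : bc_U a z by apply: bc_V_closure; exact: subset_closure.
have nV : nbhs z (bc_V a) by apply: open_nbhs_nbhs; split=> //; exact: bc_V_open.
have sep : \forall z1 \near z, forall i : 'I_(lb_num (bc_branching a)),
    ~ lb_branch i z -> ~ lb_branch i z1.
  apply: filter_forall => i; have [iz|niz] := pselect (lb_branch i z).
    by apply: nearW => z1 /(_ iz).
  have [N nN NM] := @mp_separate _ _ PX (bc_U a) (lb_branch i) z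
    (@lb_proper _ _ _ _ _ _ (bc_branching a) i)
    (fun x ix => proj2 (branch_sub ix)) Uz niz.
  apply: filterS nN => z1 Nz1 _ iz1.
  by have : (N `&` lb_branch i) z1 by []; rewrite NM.
apply: filterS2 nV sep => z1 Vz1 sepz1 sz1; split=> //.
have : (supp Theta `&` bc_U a) z1.
  by split=> //; apply: bc_V_closure; exact: subset_closure.
rewrite (lb_union (bc_branching a)) => -[i _ iz1]; exists i; split=> //.
by apply: contrapT => /sepz1.
Qed.

Lemma patch_morphism y : supp Theta y ->
  exists (a : 'I_(bc_num C)) h, bc_V a (ep_src G h) /\ ep_tgt G h = y.
Proof.
move=> sy; have [a _ [v Vv e]] := @bc_cover _ _ _ _ _ C _ (proj2 (orbit_suppP branched y) sy).
by have [h [hv hy]] := proj1 (orbitP G v y) e; exists a, h; rewrite hv.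
Qed.

(** The inverse of psi takes points of M2 close to lp_pt L' q0 back to points of
the support close to z, which lie on branches through z by [branch_nearby]. *)
Lemma patch_transport (M2 : set X) (L' : local_param PX n M2) q0 :
  M2 `<=` supp Theta -> lp_dom L' q0 ->
  exists (a : 'I_(bc_num C)) z (W : set X) (psi : X -> X),
    lip_transport G W psi /\ forall N, nbhs z N -> exists2 d : R, 0 < d &
      forall q, lp_dom L' q -> `|q - q0| < d ->
        exists z1 (i : 'I_(lb_num (bc_branching a))),
          [/\ N z1 /\ W z1, lb_branch i z, lb_branch i z1, bc_V a z1 &
            psi z1 = lp_pt L' q /\
            Defs.orbit G z1 = Defs.orbit G (lp_pt L' q)].
Proof.
move=> M2s Lq0; have [M2q0 _ _] := lp_ptP Lq0.
have [a [h [Vz hy]]] := patch_morphism (M2s _ M2q0).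
have [W [W' [psi [phi [[oW Wz psiz] [oW' W'y phiy phic] WK W'K psil]]]]] :=
  local_morphism G h.
rewrite hy in W'y phiy.
have orbz : Defs.orbit G (ep_src G h) = Defs.orbit G (lp_pt L' q0).
  by have [_ _] := W'K _ W'y; rewrite phiy.
have sz : supp Theta (ep_src G h).
  exact: (supp_orbit branched (esym orbz) (M2s _ M2q0)).
exists a, (ep_src G h), W, psi; split=> // N nN.
have near_z := filterI nN (branch_nearby sz Vz).
have : nbhs (lp_pt L' q0) (W' `&` phi @^-1`
    [set z1 | N z1 /\ (supp Theta z1 -> bc_V a z1 /\
      exists i : 'I_(lb_num (bc_branching a)),
        lb_branch i (ep_src G h) /\ lb_branch i z1)]°).
  apply: open_nbhs_nbhs; split.
    by apply: smooth_preimage_open => //; exact: open_interior.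
  by split=> //; rewrite /preimage /mkset phiy; exact: near_z.
move=> /(lp_pt_near Lq0)[d d0 hd]; exists d => // q Lq qd.
have [W'q /interior_subset[Nz1 hz1]] := hd q Lq qd.
have [Wq psiq orbq] := W'K _ W'q.
have [M2q _ _] := lp_ptP Lq.
have sz1 : supp Theta (phi (lp_pt L' q)).
  exact: (supp_orbit branched (esym orbq) (M2s _ M2q)).
by have [Vz1 [i [iz iz1]]] := hz1 sz1; exists (phi (lp_pt L' q)), i; split.
Qed.

Lemma measure_zero_local_param (A : set (orbit_space G)) (M2 : set X)
    (L' : local_param PX n M2) : M2 `<=` supp Theta -> measure_zero n C A ->
  lebesgue_null (lp_dom L' `&` [set q | A (Defs.orbit G (lp_pt L' q))]).
Proof.
move=> M2s [AS nA]; apply: null_local => q0 [Lq0 Aq0].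
have [a [z [W [psi [psil near]]]]] := patch_transport M2s Lq0.
have /choice[p hp] : forall i : 'I_(lb_num (bc_branching a)),
    exists p : set X * set 'rV[R]_n, [/\ nbhs z p.1, lebesgue_null p.2 &
      forall z1 q, p.1 z1 -> W z1 -> lb_branch i z -> lb_branch i z1 ->
        bc_V a z1 -> lp_dom L' q -> psi z1 = lp_pt L' q ->
        A (Defs.orbit G z1) -> p.2 q].
  move=> i; have [iz|niz] := pselect (lb_branch i z); last first.
    by exists (setT, set0); split=> //; [exact: filterT|exact: null_set0].
  have [_ /(_ z iz)[L [cz _]]] := branch_submanifold i.
  pose Z := lp_dom L `&` lp_pt L @^-1` branch_preimage A i.
  pose Q := [set q' | exists q, [/\ (Z `&` [set q | [/\ lp_dom L q,
      W (lp_pt L q), M2 (psi (lp_pt L q)) &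
      ch_dom (lp_chart L') (psi (lp_pt L q))]]) q, lp_dom L' q' &
    lp_pt L' q' = psi (lp_pt L q)]].
  exists (ch_dom (lp_chart L), Q); split.
  - by apply: open_nbhs_nbhs; split=> //; exact: ch_dom_open.
  - apply: transport_null => //; apply: null_sub (nA a i L).
    exact: subIsetl.
  - move=> z1 q /= cz1 Wz1 _ iz1 Vz1 Lq e Az1.
    have [q1 Lq1 e1] := lp_pt_surj iz1 cz1.
    have [M2q cq _] := lp_ptP Lq.
    have Bz1 : branch_preimage A i z1 by split=> //; split=> //; exists z1.
    exists q1; split; [|exact: Lq|by rewrite e1 e].
    split; last by split; rewrite ?e1 ?e.
    by split; rewrite // /preimage /mkset e1.
have nN : nbhs z [set z1 | forall i, (p i).1 z1].
  by apply: filter_forall => i; have [] := hp i.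
have [d d0 hd] := near _ nN; exists d => //.
apply: (@null_sub _ _ (\bigcup_i (p i).2)); last first.
  by apply: null_bigcup_count => i; have [] := hp i.
move=> q [[Lq Aq] qd]; have [z1 [i [[Nz1 Wz1] iz iz1 Vz1 [e orb]]]] := hd q Lq qd.
exists i => //; have [_ _ h] := hp i; apply: (h z1) => //.
by rewrite orb.
Qed.

(** As in [measure_zero_local_param], with each parametrization of a branch through
z put in standard form. Being in the boundary of X forces the parameters close
to 0 onto one of finitely many faces, and each face is transported separately. *)
Lemma boundary_measure_zero_local_param (A : set (orbit_space G)) (M2 : set X)
    (L' : local_param PX n M2) (j : 'I_n) :
  M2 `<=` supp Theta -> boundary_measure_zero n C A ->
  lebesgue_null (col' j @` (lp_dom L' `&` [set q | q ord0 j = 0] `&`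
    [set q | A (Defs.orbit G (lp_pt L' q))])).
Proof.
move=> M2s [AS nA]; have n0 : (0 < n)%N := leq_ltn_trans (leq0n j) (ltn_ord j).
apply: null_local => _ [q0 [[Lq0 q0j] Aq0] <-].
have [a [z [W [psi [psil near]]]]] := patch_transport M2s Lq0.
have /choice[p hp] : forall i : 'I_(lb_num (bc_branching a)),
    exists p : set X * set 'rV[R]_n, [/\ nbhs z p.1, lebesgue_null (col' j @` p.2) &
      forall z1 q, p.1 z1 -> W z1 -> lb_branch i z -> lb_branch i z1 ->
        bc_V a z1 -> lp_dom L' q -> psi z1 = lp_pt L' q ->
        A (Defs.orbit G z1) -> p.2 q].
  move=> i; have [iz|niz] := pselect (lb_branch i z); last first.
    exists (setT, set0); split=> //; first exact: filterT.
    by rewrite image_set0; exact: null_set0.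
  have [_ /(_ z iz)[L0 [cz0 z0]]] := branch_submanifold i.
  have [L [k [cE std]]] := lp_standard L0 n0.
  have cz : ch_dom (lp_chart L) z by rewrite cE.
  have Lz : lp_pt L 0 = z.
    apply: lp_center => //; move: z0; rewrite -[ch_map (lp_chart L0)]/(_).
    by case: _ / (esym cE).
  have [d d0 hd] := lp_boundary_face n0 std.
  have [N0 nN0 hN0] := lp_coord_near (lp_dom0 L) d0.
  rewrite Lz in nN0.
  pose Z f := lp_dom L `&` [set q | q ord0 f = 0] `&`
    lp_pt L @^-1` branch_preimage A i.
  pose Q f := [set q' | exists q, [/\ (Z f `&` [set q | [/\ lp_dom L q,
      W (lp_pt L q), M2 (psi (lp_pt L q)) &
      ch_dom (lp_chart L') (psi (lp_pt L q))]]) q, lp_dom L' q' &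
    lp_pt L' q' = psi (lp_pt L q)]].
  exists (ch_dom (lp_chart L) `&` N0, \bigcup_(f in [set f : 'I_n | (f < k)%N]) Q f).
  split.
  - by apply: filterI nN0; apply: open_nbhs_nbhs; split=> //; exact: ch_dom_open.
  - rewrite image_bigcup bigcup_mkcond; apply: null_bigcup_count => f.
    case: ifPn => [/set_mem fk|_]; last exact: null_set0.
    apply: (@transport_face_null _ _ _ _ _ _ _ L L' W psi psil f j (Z f)); first by move=> q [[]].
    apply: null_sub (nA a i L k std f fk).
    by move=> _ [q [Zq _] <-]; exists q.
  - move=> z1 q /= [cz1 N0z1] Wz1 _ iz1 Vz1 Lq e Az1.
    have [q1 Lq1 e1] := lp_pt_surj iz1 cz1.
    have [M2q cq _] := lp_ptP Lq.
    have q1d : `|q1| < d by rewrite -[q1]subr0; apply: hN0 => //; rewrite e1.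
    have bz1 : mp_boundary PX (lp_pt L q1).
      rewrite e1; have [sz1 _] := branch_sub iz1.
      by have [] := proj1 (orbit_supp_boundaryP branched z1) (AS _ Az1).
    have dg := proj1 (boundary_chart (lp_mp_infty Lq1) (lp_is_chart L)
      (let: And3 _ c _ := lp_ptP Lq1 in c)) bz1.
    have [f fk q1f] := hd q1 Lq1 q1d dg.
    have Bz1 : branch_preimage A i z1 by split=> //; split=> //; exists z1.
    exists f => //; exists q1; split; [|exact: Lq|by rewrite e1 e].
    split; last by split; rewrite ?e1 ?e.
    by split; [split|rewrite /preimage /mkset e1].
have nN : nbhs z [set z1 | forall i, (p i).1 z1].
  by apply: filter_forall => i; have [] := hp i.
have [d d0 hd] := near _ nN; exists d => //.
apply: (@null_sub _ _ (\bigcup_i (col' j @` (p i).2))); last first.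
  by apply: null_bigcup_count => i; have [] := hp i.
move=> _ [[q [[Lq qj] Aq] <-] qd].
have qd' : `|q - q0| < d.
  apply: le_lt_trans qd; rewrite col'B; apply: col'_norm_face.
  by rewrite !mxE qj q0j subrr.
have [z1 [i [[Nz1 Wz1] iz iz1 Vz1 [e orb]]]] := hd q Lq qd'.
exists i => //; exists q => //; have [_ _ h] := hp i; apply: (h z1) => //.
by rewrite orb.
Qed.

End independence.

Section main.
Variables (R : realType) (X M : topologicalType) (G : ep_groupoid R X M).
Variables (Theta : X -> rat) (n : nat).
Hypothesis branched : branched_ep_subgroupoid G Theta.
Hypothesis dimn : dimensional G Theta n.

Lemma measure_zero_indep (C C' : branched_cover G Theta) A :
  measure_zero n C A -> measure_zero n C' A.
Proof.
move=> zA; have [AS _] := zA; split=> // a i L.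
apply: null_sub (measure_zero_local_param branched dimn L _ zA).
  by move=> q [Lq [_ [Aq _]]].
by move=> x /branch_sub[].
Qed.

Lemma boundary_measure_zero_indep (C C' : branched_cover G Theta) A :
  boundary_measure_zero n C A -> boundary_measure_zero n C' A.
Proof.
move=> zA; have [AS _] := zA; split=> // a i L k std f fk.
apply: null_sub (boundary_measure_zero_local_param branched dimn L f _ zA).
  by move=> _ [q [Lq [_ [Aq _]]] <-]; exists q.
by move=> x /branch_sub[].
Qed.

End main.

(** The requirements determine LS as soon as one index exists. *)
Lemma completion_exists_unique (T : topologicalType) (I : Type) (S : set T)
    (Z : I -> set (set T)) : inhabited I -> (forall i j, Z i = Z j) ->
  exists! LS : set (set T), [/\ sigma_algebra S LS, borel_on S `<=` LS &
    forall i, LS = borel_completion S (Z i)].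
Proof.
move=> [i0] ZE; exists (borel_completion S (Z i0)); split.
  split; first exact: smallest_sigma_algebra.
    move=> A BA; apply: sub_sigma_algebra; by left.
  by move=> i; rewrite (ZE i0 i).
by move=> LS [_ _ /(_ i0) ->].
Qed.

Theorem theorem1p7 (R : realType) (X M : topologicalType)
    (G : ep_groupoid R X M) (Theta : X -> rat) (n : nat)
    (hilbertG : ep_separable_hilbert G)
    (branchedTheta : branched_ep_subgroupoid G Theta)
    (dimTheta : dimensional G Theta n)
    (compactS : compact (orbit_supp G Theta)) :
  let S := orbit_supp G Theta in
  let dS := orbit_supp_boundary G Theta in
  [/\ compact dS,
      inhabited (branched_cover G Theta),
      (forall (C C' : branched_cover G Theta) (A : set (orbit_space G)),
        (measure_zero n C A <-> measure_zero n C' A) /\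
        (boundary_measure_zero n C A <-> boundary_measure_zero n C' A)),
      (exists! LS : set (set (orbit_space G)),
        [/\ sigma_algebra S LS, borel_on S `<=` LS &
            forall C : branched_cover G Theta,
              LS = borel_completion S (measure_zero n C)]) &
      (exists! LdS : set (set (orbit_space G)),
        [/\ sigma_algebra dS LdS, borel_on dS `<=` LdS &
            forall C : branched_cover G Theta,
              LdS = borel_completion dS (boundary_measure_zero n C)])].
Proof.
move=> S dS; have cover := branched_cover_exists branchedTheta compactS.
split=> //.
- exact: compact_boundary.
- move=> C C' A; split; split;
    solve [exact: measure_zero_indep|exact: boundary_measure_zero_indep].
- apply: completion_exists_unique => // C C'; apply/seteqP.
  by split=> A; exact: measure_zero_indep.
- apply: completion_exists_unique => // C C'; apply/seteqP.
  by split=> A; exact: boundary_measure_zero_indep.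
Qed.
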